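(* Let $H$ be a Hilbert space with a fixed orthonormal basis $\{e_n\}$, and let $A,B,C,D\in\mathbb{B}(H)$ be such that $b_1I\le A\le a_1I$, $b_2I\le B\le a_2I$, $b_3I\le C\le a_3I$ and $b_4I\le D\le a_4I$ for some scalars $0<b_i<a_i$, $i=1,\dots,4$. Let $\sigma$ be an operator mean whose representing function $f$ is non-constant and submultiplicative. Put $$\mu=\frac{a_1a_2b_1b_2\left(f(a_3a_4b_1^{-1}b_2^{-1})-f(a_1^{-1}a_2^{-1}b_3b_4)\right)}{a_1a_2a_3a_4-b_1b_2b_3b_4},$$ $$\nu=\frac{a_1a_2a_3a_4f(a_1^{-1}a_2^{-1}b_3b_4)-b_1b_2b_3b_4f(b_1^{-1}b_2^{-1}a_3a_4)}{a_1a_2a_3a_4-b_1b_2b_3b_4},\qquad g(t)=\mu t+\nu-f(t).$$ Then there are fixed points $c,t_0\in(a_1^{-1}a_2^{-1}b_3b_4,\;a_3a_4b_1^{-1}b_2^{-1})$ such that, with $$\omega=\frac{a_1a_2b_1b_2\left(f(a_3a_4b_1^{-1}b_2^{-1})-f(a_1^{-1}a_2^{-1}b_3b_4)\right)}{(a_1a_2a_3a_4-b_1b_2b_3b_4)f'(c)},$$ the following hold: (i) $(A\circ B)\sigma(C\circ D)\le\frac1\omega\left((A\sigma C)\circ(B\sigma D)\right)$; (ii) $\left((A\circ B)\sigma(C\circ D)\right)-\left((A\sigma C)\circ(B\sigma D)\right)\le-g(t_0)(A\circ B)$.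
   Context: $\mathbb{B}(H)$ is the algebra of bounded linear operators on $H$, $I$ is the identity, and $X\le Y$ means that $Y-X$ is a positive (semidefinite) operator. The Hadamard product of $A,B\in\mathbb{B}(H)$ with respect to $\{e_n\}$ is $A\circ B=U^*(A\otimes B)U$, where $U:H\to H\otimes H$ is the isometry with $Ue_n=e_n\otimes e_n$. A real-valued continuous function $f$ is submultiplicative if $f(xy)\le f(x)f(y)$ for all $x,y$ in its domain (here $(0,\infty)$). An operator mean $\sigma$ (in the sense of Kubo and Ando) is a binary operation on strictly positive (invertible) operators such that (i) $I\sigma I=I$; (ii) $C^*(A\sigma B)C\le(C^*AC)\sigma(C^*BC)$; (iii) $A_n\downarrow A$ and $B_n\downarrow B$ imply $A_n\sigma B_n\downarrow A\sigma B$ (decreasing strong convergence); (iv) $A\le B$ and $C\le D$ imply $A\sigma C\le B\sigma D$. Operator means correspond bijectively to positive operator monotone functions $f$ on $(0,\infty)$ with $f(1)=1$ (the representing function of $\sigma$), via $f(t)I=I\sigma(tI)$, and $A\sigma B=A^{1/2}f(A^{-1/2}BA^{-1/2})A^{1/2}$ for strictly positive invertible $A,B$. *)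

(* Defs.v *)
From HB Require Import structures.
From mathcomp Require Import all_boot all_order all_algebra.
From mathcomp Require Import complex.
From mathcomp Require Import all_classical all_reals all_analysis.

Set Implicit Arguments.
Unset Strict Implicit.
Unset Printing Implicit Defensive.

Import Order.TTheory GRing.Theory Num.Theory.
Import numFieldNormedType.Exports.

Local Open Scope classical_set_scope.
Local Open Scope complex_scope.
Local Open Scope ring_scope.

(* The inner product is linear in its first argument and conjugate-linear in
   the second one. *)
Record hilbertSpace (R : realType) := HilbertSpace {
  hilbert_sort :> completeNormedModType R[i];
  hdot : {dot hilbert_sort for (@Num.conj R[i])};
  hdot_norm : forall x : hilbert_sort, hdot x x = `|x| ^+ 2 }.
Arguments hdot {R h}.

Section BoundedOperators.
Context {R : realType}.
Implicit Types H K L : hilbertSpace R.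

(* For a linear f, bounded_near f (nbhs 0) is boundedness in operator norm,
   see linear_boundedP. *)
Definition bounded_operator H K : {pred H -> K} :=
  fun f => `[< linear f /\ bounded_near f (nbhs (0 : H)) >].

Fact bounded_operator_submod H K : submod_closed (@bounded_operator H K).
Proof.
split=> [|a f g /asboolP[lf bf] /asboolP[lg bg]]; apply/asboolP; split.
- by move=> a x y; rewrite /GRing.zero /= scaler0 addr0.
- by apply/ex_bound; exists 0; near=> x; rewrite /= normr0.
- move=> b x y; rewrite !fctE lf lg !scalerDr !scalerA mulrC -!addrA.
  by congr (_ + _); rewrite addrCA.
- move/ex_bound: bf => [M hM]; move/ex_bound: bg => [N hN].
  apply/ex_bound; exists (`|a| * M + N).
  near=> x; rewrite /= !fctE (le_trans (ler_normD _ _))// normrZ lerD//.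
    by rewrite ler_wpM2l//; near: x.
  by near: x.
Unshelve. all: by end_near. Qed.

HB.instance Definition _ H K :=
  GRing.isSubmodClosed.Build R[i] (H -> K) (@bounded_operator H K)
    (@bounded_operator_submod H K).

Record bop H K := Bop {
  bop_fun :> H -> K;
  bop_funP : bop_fun \in @bounded_operator H K }.

HB.instance Definition _ H K := [isSub for @bop_fun H K].
HB.instance Definition _ H K := [Choice of bop H K by <:].
HB.instance Definition _ H K := [SubChoice_isSubLmodule of bop H K by <:].
HB.instance Definition _ H K := isPointed.Build (bop H K) 0.

Fact bop_linear H K (A : bop H K) : linear A.
Proof. by case: A => f /= /asboolP[]. Qed.

HB.instance Definition _ H K (A : bop H K) :=
  GRing.isLinear.Build R[i] H K *:%R A (bop_linear A).

Fact id_bop_subproof H : (@idfun H : H -> H) \in @bounded_operator H H.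
Proof.
apply/asboolP; split=> //.
exact/linear_bounded_continuous/(fun x => cvg_id).
Qed.

Definition id_bop H : bop H H := Bop (id_bop_subproof H).

Fact comp_bop_subproof H K L (A : bop K L) (B : bop H K) :
  (A \o B : H -> L) \in @bounded_operator H L.
Proof.
have cA : continuous A.
  by apply/linear_bounded_continuous; have /asboolP[] := bop_funP A.
have cB : continuous B.
  by apply/linear_bounded_continuous; have /asboolP[] := bop_funP B.
apply/asboolP; split; first by move=> a x y /=; rewrite !linearP.
apply: (@continuous_linear_bounded _ _ _ 0 (A \o B)).
by apply: continuous_comp; [exact: cB | exact: cA].
Qed.

Definition comp_bop H K L (A : bop K L) (B : bop H K) : bop H L :=
  Bop (comp_bop_subproof A B).

(* The unique operator with this property exists by the Riesz representation
   theorem. *)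
Definition adjoint H K (A : bop H K) : bop K H :=
  get [set B : bop K H | forall x y, hdot (A x) y = hdot x (B y)].

Definition positive_op H (A : bop H H) : Prop :=
  forall x, 0 <= hdot (A x) x.

Definition op_le H (A B : bop H H) : Prop := positive_op (B - A).

Definition invertible_op H (A : bop H H) : Prop :=
  exists B, comp_bop A B = id_bop H /\ comp_bop B A = id_bop H.

Definition strictly_positive H (A : bop H H) : Prop :=
  positive_op A /\ invertible_op A.

Definition decreases_to H (A_ : nat -> bop H H) (A : bop H H) : Prop :=
  (forall n, op_le (A_ n.+1) (A_ n)) /\
  (forall x, (fun n => A_ n x) @ \oo --> A x).

End BoundedOperators.

Declare Scope op_scope.
Delimit Scope op_scope with OP.
Notation "A <= B" := (op_le A B) : op_scope.
Notation "A ** B" := (comp_bop A B) (at level 40, left associativity) : op_scope.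
Notation "A ^*" := (adjoint A) : op_scope.

Section TensorAndHadamard.
Context {R : realType}.
Implicit Types H K : hilbertSpace R.

Definition lin_span H (S : set H) : set H :=
  [set x | exists n (a : 'I_n -> R[i]) (v : 'I_n -> H),
     (forall i, S (v i)) /\ x = \sum_(i < n) a i *: v i].

Definition orthonormal_basis H (I : Type) (e : I -> H) : Prop :=
  [/\ forall i, hdot (e i) (e i) = 1,
      forall i j, i <> j -> hdot (e i) (e j) = 0
    & dense (lin_span (range e))].

(* A model of the Hilbert space tensor product; any two models are related by
   a unique unitary that respects elementary tensors. *)
Record hilbert_tensor H K := HilbertTensor {
  tensor_space :> hilbertSpace R;
  tmul : {bilinear H -> K -> tensor_space};
  tmul_dot : forall x x' y y',
    hdot (tmul x y) (tmul x' y') = hdot x x' * hdot y y';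
  tmul_dense : dense (lin_span (range (fun p : H * K => tmul p.1 p.2))) }.

(* The bounded operator T with T (x (x) y) = A x (x) B y; it exists, and it is
   unique because elementary tensors have dense span. *)
Definition tensor_op H K (T : hilbert_tensor H K) (A : bop H H) (B : bop K K) :
    bop T T :=
  get [set X : bop T T | forall x y, X (tmul T x y) = tmul T (A x) (B y)].

(* For an orthonormal basis e, the family e i (x) e i is orthonormal, so the
   isometry exists; it is unique because e has dense span. *)
Definition diag_isometry H (T : hilbert_tensor H H) (I : Type) (e : I -> H) :
    bop H T :=
  get [set U : bop H T |
    (forall x, `|U x| = `|x|) /\ (forall i, U (e i) = tmul T (e i) (e i))].

Definition hadamard H (T : hilbert_tensor H H) (I : Type) (e : I -> H)
    (A B : bop H H) : bop H H :=
  let U := diag_isometry T e in (U^* ** tensor_op T A B ** U)%OP.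

End TensorAndHadamard.

Section OperatorMeans.
Context {R : realType}.

(* A mean acts on the operators of all Hilbert spaces, so that its representing
   function is operator monotone and not only monotone on matrices of a given
   size. The operation is total; only its values at strictly positive operators
   are constrained. *)
Record operator_mean
    (sigma : forall H : hilbertSpace R, bop H H -> bop H H -> bop H H) : Prop := {
  mean_strictly_positive : forall H (A B : bop H H),
    strictly_positive A -> strictly_positive B ->
    strictly_positive (sigma H A B);
  mean_id : forall H, sigma H (id_bop H) (id_bop H) = id_bop H;
  mean_transformer : forall H (A B C : bop H H),
    strictly_positive A -> strictly_positive B ->
    strictly_positive (C^* ** A ** C)%OP ->
    strictly_positive (C^* ** B ** C)%OP ->
    (C^* ** sigma H A B ** C <= sigma H (C^* ** A ** C) (C^* ** B ** C))%OP;
  mean_continuous : forall H (A_ B_ : nat -> bop H H) (A B : bop H H),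
    (forall n, strictly_positive (A_ n)) ->
    (forall n, strictly_positive (B_ n)) ->
    strictly_positive A -> strictly_positive B ->
    decreases_to A_ A -> decreases_to B_ B ->
    decreases_to (fun n => sigma H (A_ n) (B_ n)) (sigma H A B);
  mean_monotone : forall H (A B C D : bop H H),
    strictly_positive A -> strictly_positive B ->
    strictly_positive C -> strictly_positive D ->
    (A <= B)%OP -> (C <= D)%OP -> (sigma H A C <= sigma H B D)%OP }.

Definition representing_function
    (sigma : forall H : hilbertSpace R, bop H H -> bop H H -> bop H H)
    (f : R -> R) : Prop :=
  forall H (t : R), 0 < t ->
    sigma H (id_bop H) (t%:C *: id_bop H) = (f t)%:C *: id_bop H.

Definition submultiplicative (f : R -> R) : Prop :=
  {in `]0, +oo[, continuous f} /\
  (forall x y : R, 0 < x -> 0 < y -> f (x * y) <= f x * f y).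

Definition nonconstant_on_pos (f : R -> R) : Prop :=
  exists x y : R, [/\ 0 < x, 0 < y & f x <> f y].

End OperatorMeans.

(* Main.v *)
Require Import Defs.
From HB Require Import structures.
From mathcomp Require Import all_boot all_order all_algebra.
From mathcomp Require Import complex.
From mathcomp Require Import all_classical all_reals all_analysis.
From mathcomp Require Import ring lra.

Set Implicit Arguments.
Unset Strict Implicit.
Unset Printing Implicit Defensive.

Import Order.TTheory GRing.Theory Num.Theory.
Import numFieldNormedType.Exports.

Local Open Scope classical_set_scope.
Local Open Scope complex_scope.
Local Open Scope ring_scope.

(** The mean of two positive operators P and Q is a function of the pair: where
    Q = t P it is f(t) P. Write P and Q for the Hadamard products A o B and C o D,
    and S for (A sigma C) o (B sigma D). The constants are such that
    m P <= Q <= M P, and the line t |-> mu t + nu is the chord of f over [m, M].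

    Upper bounds. If f(t) <= a t + b on [m, M], then P sigma Q <= a Q + b P
    (mean_le_line).

    Lower bounds. On the tensor product, (A sigma C) (x) (B sigma D) is the
    function f(x) f(y) of two commuting ratios, x of C to A and y of D to B, of
    which C (x) D is the function x y. Since f is submultiplicative and concave,
    f(x) f(y) >= f(x y) >= mu x y + nu, so that (A sigma C) (x) (B sigma D) is at
    least mu (C (x) D) + nu (A (x) B) (tensor_mean_ge). The Hadamard product is
    the compression of the tensor product by an isometry, whence
    S >= mu Q + nu P.

    The two inequalities then compare f with its chord. For (i) one needs
    f(t) <= k (mu t + nu) on [m, M] with k = 1 / omega = f'(c) / mu: this holds
    at a point c where f is differentiable and steep enough, and concavity gives
    such a point (chord_ratio); mu > 0 because a concave submultiplicative f that
    is not constant is increasing (concave_submul_lt). For (ii) one needs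
    f(t) <= mu t + nu - g(t0), and t0 is a point where f is farthest above its
    chord (chord_gap).

    The mean is given by axioms and not by a formula. Three facts stand in for
    the functional calculus. The transformer inequality is an equality for an
    invertible C, and this makes 1 sigma X commute with X (mean_comm). The
    operator D = 1 + eta + K (X - t)^2 is nearly 1 where X is close to t, and
    comparing X with t by means of D shows that 1 sigma X is nearly f(t) there
    (mean_lower, mean_upper). Finally, an operator that commutes with X and is
    positive near each spectral value of X, up to such quadratic errors, is
    positive (localize); this is the weak law of large numbers behind Bernstein
    polynomials, with products of commuting positive operators in the place of
    products of probabilities.

    Concavity of f comes from the mean on C^2: the form of 1 sigma X at a unit
    vector v is at most f(<X v, v>) (mean_jensen), which for a diagonal X is the
    concavity inequality. *)

(** * The real part of the inner product *)

Section RealInnerProduct.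
Context {R : realType}.
Implicit Types H K : hilbertSpace R.

Lemma cReD (z w : R[i]) : complex.Re (z + w) = complex.Re z + complex.Re w.
Proof. by case: z; case: w. Qed.

Lemma cReN (z : R[i]) : complex.Re (- z) = - complex.Re z.
Proof. by case: z. Qed.

Lemma cReM (z w : R[i]) : complex.Re (z * w) =
  complex.Re z * complex.Re w - complex.Im z * complex.Im w.
Proof. by case: z; case: w. Qed.

Lemma cReJ (z : R[i]) : complex.Re z^*%C = complex.Re z.
Proof. by case: z. Qed.

(** Hermitian operators have real quadratic forms, so all the estimates live in
    R; the complex inner product is recovered from rdot by hdotE. *)
Definition rdot H (x y : H) : R := complex.Re (hdot x y).

Lemma hdotC H (x y : H) : hdot x y = (hdot y x)^*%C.
Proof. by rewrite hermC expr0 mul1r. Qed.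

Lemma hdotDl H (x y z : H) : hdot (x + y) z = hdot x z + hdot y z.
Proof. exact: linearDl. Qed.

Lemma hdotNl H (x z : H) : hdot (- x) z = - hdot x z.
Proof. exact: linearNl. Qed.

Lemma hdot0l H (z : H) : hdot 0 z = 0.
Proof. exact: linear0l. Qed.

Lemma hdotZl H (a : R[i]) (x y : H) : hdot (a *: x) y = a * hdot x y.
Proof. exact: linearZl_LR. Qed.

Lemma hdotZr H (a : R[i]) (x y : H) : hdot x (a *: y) = a^*%C * hdot x y.
Proof. exact: linearZr_LR. Qed.

Lemma rdotC H (x y : H) : rdot x y = rdot y x.
Proof. by rewrite /rdot hdotC cReJ. Qed.

Lemma rdotDl H (x y z : H) : rdot (x + y) z = rdot x z + rdot y z.
Proof. by rewrite /rdot hdotDl cReD. Qed.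

Lemma rdotDr H (x y z : H) : rdot z (x + y) = rdot z x + rdot z y.
Proof. by rewrite rdotC rdotDl !(rdotC z). Qed.

Lemma rdotNl H (x z : H) : rdot (- x) z = - rdot x z.
Proof. by rewrite /rdot hdotNl cReN. Qed.

Lemma rdotNr H (x z : H) : rdot z (- x) = - rdot z x.
Proof. by rewrite rdotC rdotNl rdotC. Qed.

Lemma rdot0l H (z : H) : rdot 0 z = 0.
Proof. by rewrite /rdot hdot0l. Qed.

Lemma rdot0r H (z : H) : rdot z 0 = 0.
Proof. by rewrite rdotC rdot0l. Qed.

Lemma rdotZl H (a : R) (x z : H) : rdot (a%:C *: x) z = a * rdot x z.
Proof. by rewrite /rdot hdotZl cReM /= mul0r subr0. Qed.

Lemma rdotZr H (a : R) (x z : H) : rdot z (a%:C *: x) = a * rdot z x.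
Proof. by rewrite rdotC rdotZl rdotC. Qed.

Definition rdotE H :=
  (@rdotDl H, @rdotDr H, @rdotNl H, @rdotNr H, @rdotZl H, @rdotZr H,
   @rdot0l H, @rdot0r H).

Lemma hdotE H (x y : H) : hdot x y = rdot x y +i* rdot x ('i *: y).
Proof. by rewrite /rdot hdotZr; case: (hdot x y) => u v /=; congr (_ +i* _); ring. Qed.

Lemma rdot_iZ H (x y : H) : rdot ('i *: x) ('i *: y) = rdot x y.
Proof.
by rewrite /rdot hdotZr hdotZl mulrA; case: (hdot x y) => u v /=; ring.
Qed.

Lemma rdot_ix H (x : H) : rdot x ('i *: x) = 0.
Proof.
rewrite /rdot hdotZr cReM /= hdot_norm ger0_Im ?exprn_ge0//.
by rewrite mul0r mulr0 subr0.
Qed.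

Lemma norm_Re H (x : H) : `|x| = (complex.Re `|x|)%:C.
Proof. by rewrite RRe_real// normr_real. Qed.

Lemma rdot_norm H (x : H) : rdot x x = (complex.Re `|x|) ^+ 2.
Proof. by rewrite /rdot hdot_norm {1}norm_Re /= !expr2 /=; ring. Qed.

Lemma rdot_ge0 H (x : H) : 0 <= rdot x x.
Proof. by rewrite rdot_norm sqr_ge0. Qed.

Definition nrm H (x : H) : R := Num.sqrt (rdot x x).

Lemma norm_nrm H (x : H) : `|x| = (nrm x)%:C.
Proof.
rewrite /nrm rdot_norm sqrtr_sqr norm_Re; congr (_%:C).
have := normr_ge0 x; rewrite {1}norm_Re ler0c => h.
by rewrite /= ger0_norm.
Qed.

Lemma nrm_ge0 H (x : H) : 0 <= nrm x. Proof. exact: sqrtr_ge0. Qed.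

Lemma sqr_nrm H (x : H) : nrm x ^+ 2 = rdot x x.
Proof. by rewrite sqr_sqrtr// rdot_ge0. Qed.

Lemma nrm_eq0 H (x : H) : (nrm x == 0) = (x == 0).
Proof. by rewrite -[RHS]normr_eq0 norm_nrm; apply/eqP/eqP => [->//|[]]. Qed.

Lemma rdot_eq0 H (x : H) : rdot x x = 0 -> x = 0.
Proof.
by move=> h; apply/eqP; rewrite -nrm_eq0 /nrm h sqrtr0.
Qed.

Lemma rdot_inj H (x y : H) : (forall z, rdot x z = rdot y z) -> x = y.
Proof.
move=> h; apply/eqP; rewrite -subr_eq0; apply/eqP/rdot_eq0.
by rewrite rdotDl h -rdotDl subrr rdot0l.
Qed.

Lemma nrmD H (x y : H) : nrm (x + y) <= nrm x + nrm y.
Proof.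
by have := ler_normD x y; rewrite !norm_nrm -rmorphD lecR.
Qed.

Lemma nrmZ H (a : R) (x : H) : nrm (a%:C *: x) = `|a| * nrm x.
Proof.
by rewrite /nrm !rdotE mulrA -expr2 sqrtrM ?sqr_ge0// sqrtr_sqr.
Qed.

Lemma nrmN H (x : H) : nrm (- x) = nrm x.
Proof. by rewrite /nrm !rdotE opprK. Qed.

Lemma nrmBC H (x y : H) : nrm (x - y) = nrm (y - x).
Proof. by rewrite -nrmN opprB. Qed.

(** The form is evaluated at its minimiser t = - b / c; for c = 0 it is affine
    in t, so that it can only be nonnegative when b vanishes. *)
Lemma quad_form_CS (a b c : R) :
  (forall t : R, 0 <= a + t * b *+ 2 + t ^+ 2 * c) -> 0 <= c ->
  b ^+ 2 <= a * c.
Proof.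
move=> h; rewrite le_eqVlt => /predU1P[c0|c0].
  have [->|b0] := eqVneq b 0; first by rewrite -c0 mulr0 expr0n.
  have := h (- (a + 1) / b / 2); rewrite -c0.
  suff -> : a + (- (a + 1) / b / 2) * b *+ 2 + (- (a + 1) / b / 2) ^+ 2 * 0 = - 1.
    by rewrite oppr_ge0 ler10.
  by field.
have := h (- b / c).
have -> : a + - b / c * b *+ 2 + (- b / c) ^+ 2 * c = (a * c - b ^+ 2) / c.
  by field; rewrite gt_eqF.
by rewrite pmulr_lge0 ?invr_gt0// subr_ge0.
Qed.

Lemma rdot_CS H (x y : H) : (rdot x y) ^+ 2 <= rdot x x * rdot y y.
Proof.
apply: quad_form_CS (rdot_ge0 _) => t.
suff -> : rdot x x + t * rdot x y *+ 2 + t ^+ 2 * rdot y y =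
  rdot (x + t%:C *: y) (x + t%:C *: y) by exact: rdot_ge0.
by rewrite !rdotE (rdotC y x); ring.
Qed.

Lemma rdot_abs H (x y : H) : `|rdot x y| <= nrm x * nrm y.
Proof.
by rewrite -sqrtr_sqr -sqrtrM ?rdot_ge0// ler_sqrt ?rdot_CS// mulr_ge0 ?rdot_ge0.
Qed.

Lemma rdot_le_nrm H (x y : H) : rdot x y <= nrm x * nrm y.
Proof. exact: le_trans (ler_norm _) (rdot_abs _ _). Qed.

End RealInnerProduct.

(** * Operators and their quadratic forms *)

Section Sequences.
Context {R : realType}.
Implicit Types H K : hilbertSpace R.

Lemma gt0C (e : R[i]) : 0 < e -> exists2 d : R, 0 < d & e = d%:C.
Proof.
case: e => d f; rewrite ltcE /= => /andP[/eqP -> d0].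
by exists d.
Qed.

(** Convergence in the real-valued norm; a filter on H would bring in bounds in
    R[i]. *)
Definition hlim H (u : nat -> H) (l : H) := forall e : R, 0 < e ->
  exists N, forall n, (N <= n)%N -> nrm (u n - l) < e.

Lemma inv_small (e : R) : 0 < e -> exists N : nat, forall n, (N <= n)%N -> n.+1%:R^-1 < e.
Proof.
move=> e0; exists (Num.truncn e^-1) => n nN.
by rewrite invf_plt ?posrE// (lt_le_trans (truncnS_gt _))// ler_nat.
Qed.

Lemma hilbert_complete H (u : nat -> H) :
  (forall e : R, 0 < e -> exists N, forall n m, (N <= n)%N -> (N <= m)%N ->
    nrm (u n - u m) < e) ->
  exists l, hlim u l.
Proof.
move=> cu; have /cauchy_cvg/cvg_ex[l /cvgrPdist_lt ul] : cauchy (u @ \oo).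
  apply/cauchy_ballP => _ /gt0C[e e0 ->].
  have [N hN] := cu e e0.
  exists ([set x | exists2 n, (N <= n)%N & x = u n],
          [set x | exists2 n, (N <= n)%N & x = u n]) => /=.
    by split; exists N => //= n nN; exists n.
  case=> x y /= [[n nN ->] [m mN ->]].
  by rewrite -ball_normE /= norm_nrm ltcR; exact: hN.
exists l => e e0; have := ul e%:C; rewrite ltcR => /(_ e0)[N _ hN].
by exists N => n nN; rewrite nrmBC -ltcR -norm_nrm; exact: hN.
Qed.

End Sequences.

Section Operators.
Context {R : realType}.
Implicit Types H K L : hilbertSpace R.

Lemma bop_bound H K (A : bop H K) :
  exists2 c : R, 0 < c & forall x, nrm (A x) <= c * nrm x.
Proof.
have /asboolP[lA bA] := bop_funP A.
pose F : {linear H -> K} := A.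
have /linear_boundedP[M [Mr hM]] : bounded_near F (nbhs (0 : H)) := bA.
have [M' eM] : exists M', M = M'%:C by move/complex_realP: Mr.
exists (Num.max (M' + 1) 1); first by rewrite lt_max ltr01 orbT.
move=> x; have := hM (Num.max (M' + 1) 1)%:C.
rewrite eM ltcR lt_max ltrDl ltr01 => /(_ isT x).
by rewrite !norm_nrm -rmorphM lecR.
Qed.

Lemma mk_bopP H K (f : H -> K) (c : R) : linear f ->
  (forall x, nrm (f x) <= c * nrm x) -> f \in @bounded_operator R H K.
Proof.
move=> lf hf; apply/asboolP; split => //.
pose F : {linear H -> K} := HB.pack f (GRing.isLinear.Build _ _ _ _ f lf).
apply/(@linear_boundedP _ _ _ F); exists c%:C; split.
  by apply/complex_realP; exists c.
move=> r cr x; rewrite /= !norm_nrm.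
apply: le_trans (_ : (c * nrm x)%:C <= _); first by rewrite lecR.
by rewrite rmorphM ler_wpM2r ?ler0c ?nrm_ge0// ltW.
Qed.

Lemma bop_ext H K (A B : bop H K) : (forall x, A x = B x) -> A = B.
Proof. by move=> h; apply/val_inj/funext. Qed.

Lemma addoE H K (A B : bop H K) x : (A + B) x = A x + B x. Proof. by []. Qed.
Lemma oppoE H K (A : bop H K) x : (- A) x = - A x. Proof. by []. Qed.
Lemma scaleoE H K a (A : bop H K) x : (a *: A) x = a *: A x. Proof. by []. Qed.
Lemma compoE H K L (A : bop K L) (B : bop H K) x : (A ** B)%OP x = A (B x).
Proof. by []. Qed.
Lemma idoE H x : id_bop H x = x. Proof. by []. Qed.
Lemma zerooE H K x : (0 : bop H K) x = 0. Proof. by []. Qed.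

Lemma bopD H K (A : bop H K) x y : A (x + y) = A x + A y.
Proof. exact: linearD. Qed.
Lemma bopN H K (A : bop H K) x : A (- x) = - A x.
Proof. exact: linearN. Qed.
Lemma bopZ H K (A : bop H K) a x : A (a *: x) = a *: A x.
Proof. exact: linearZZ. Qed.
Lemma bop0 H K (A : bop H K) : A 0 = 0.
Proof. exact: linear0. Qed.

Definition bopE := (addoE, oppoE, scaleoE, compoE, idoE, zerooE,
  bopD, bopN, bopZ, bop0).

Lemma hdot_rdot H K (A : bop H K) (B : bop K H) :
  (forall x y, rdot (A x) y = rdot x (B y)) ->
  forall x y, hdot (A x) y = hdot x (B y).
Proof. by move=> h x y; rewrite !hdotE -bopZ !h. Qed.

(** Self-adjointness, since by hdot_rdot it passes from the real part to hdot. *)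
Definition herm H (A : bop H H) := forall x y, rdot (A x) y = rdot x (A y).

Lemma rdot_i H (x y : H) : rdot ('i *: x) y = - rdot x ('i *: y).
Proof. by rewrite -(rdot_iZ x) scalerA -expr2 sqr_i scaleN1r rdotNr opprK. Qed.

(** Polarisation at x - i y: a form that is real on the diagonal is hermitian. *)
Lemma positive_opP H (A : bop H H) :
  positive_op A <-> herm A /\ forall x, 0 <= rdot (A x) x.
Proof.
split=> [pA|[hA pA] x].
  have Im0 x : rdot (A x) ('i *: x) = 0.
    by have := pA x; rewrite hdotE lecE /= => /andP[/eqP ->].
  split=> [x y|x]; last first.
    by have := pA x; rewrite hdotE lecE /= => /andP[].
  have := Im0 (x - 'i *: y).
  rewrite !(bopE, scalerDr, scalerN, scalerA).
  have -> : ('i : R[i]) * 'i = - 1 by rewrite -expr2 sqr_i.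
  rewrite scaleN1r opprK !rdotE !Im0 rdot_iZ (rdotC (A y)) => h.
  have h2 : rdot ('i *: A y) y = 0.
    by rewrite rdot_i Im0 oppr0.
  by move: h; rewrite h2; lra.
rewrite hdotE lecE /= pA andbT; apply/eqP.
have := hA ('i *: x) x; rewrite bopZ rdotC.
by rewrite (rdotC (A x)) rdot_i; lra.
Qed.

Lemma op_leP H (A B : bop H H) : (A <= B)%OP <->
  herm (B - A) /\ forall x, rdot (A x) x <= rdot (B x) x.
Proof.
rewrite /op_le positive_opP; split=> -[h1 h2]; split=> // x.
  by have := h2 x; rewrite !bopE !rdotE subr_ge0.
by rewrite !bopE !rdotE subr_ge0.
Qed.

Lemma hermD H (A B : bop H H) : herm A -> herm B -> herm (A + B).
Proof. by move=> hA hB x y; rewrite !bopE !rdotE hA hB. Qed.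
Lemma hermN H (A : bop H H) : herm A -> herm (- A).
Proof. by move=> hA x y; rewrite !bopE !rdotE hA. Qed.
Lemma hermZ H (a : R) (A : bop H H) : herm A -> herm (a%:C *: A).
Proof. by move=> hA x y; rewrite !bopE !rdotE hA. Qed.
Lemma herm1 H : herm (id_bop H).
Proof. by []. Qed.
Lemma hermM H (A B : bop H H) : herm A -> herm B ->
  (forall x, A (B x) = B (A x)) -> herm (A ** B)%OP.
Proof. by move=> hA hB AB x y; rewrite !compoE AB hB hA AB. Qed.

Lemma op_le_herm H (A B : bop H H) : herm A -> herm B ->
  (forall x, rdot (A x) x <= rdot (B x) x) -> (A <= B)%OP.
Proof. by move=> hA hB h; apply/op_leP; split => //; apply/hermD/hermN. Qed.

Lemma herm_geC H (A : bop H H) a : (a%:C *: id_bop H <= A)%OP -> herm A.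
Proof.
move=> /op_leP[h _].
have -> : A = (A - a%:C *: id_bop H) + a%:C *: id_bop H by rewrite subrK.
by apply: hermD => //; exact/hermZ/herm1.
Qed.

Lemma op_le_refl H (A : bop H H) : (A <= A)%OP.
Proof. by apply/op_leP; split=> // x y; rewrite subrr !bopE !rdotE. Qed.

Lemma herm_eq0 H (A : bop H H) : herm A -> (forall x, rdot (A x) x = 0) -> A = 0.
Proof.
move=> hA h; apply/bop_ext => x; apply: rdot_inj => y.
have := h (x + y); rewrite !bopE !rdotE !h (hA y) (rdotC y); lra.
Qed.

Lemma op_le_anti H (A B : bop H H) : (A <= B)%OP -> (B <= A)%OP -> A = B.
Proof.
move=> /op_leP[h1 h2] /op_leP[h3 h4]; apply/esym/eqP; rewrite -subr_eq0; apply/eqP.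
apply: herm_eq0 => // x; rewrite !bopE !rdotE.
by apply/eqP; rewrite subr_eq0 eq_le h2 h4.
Qed.

Lemma op_leZ H (a : R) (A B : bop H H) : 0 <= a ->
  (A <= B)%OP -> (a%:C *: A <= a%:C *: B)%OP.
Proof.
move=> a0 /op_leP[h1 h2]; apply/op_leP; split.
  by rewrite -scalerBr; exact: hermZ.
by move=> x; rewrite !bopE !rdotE ler_wpM2l.
Qed.

Lemma adjoint_unique H K (A : bop H K) (B : bop K H) :
  (forall x y, rdot (A x) y = rdot x (B y)) -> (A^*)%OP = B.
Proof.
move=> AB; rewrite /adjoint.
set P := [set _ | _]; have hC : P (get P) by apply: getPex; exists B; exact: hdot_rdot.
by apply/bop_ext => y; apply: rdot_inj => x; rewrite rdotC (rdotC (B y)) -AB /rdot hC.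
Qed.

Lemma adjoint_herm H (A : bop H H) : herm A -> (A^*)%OP = A.
Proof. exact: adjoint_unique. Qed.

(** The minimiser of the convex functional <A x, x> - 2 phi x solves A y = phi:
    for A the identity this is the Riesz representation theorem, for phi an
    inner product it is the surjectivity of A. *)
Lemma coercive_solve H (A : bop H H) (b c : R) (phi : H -> R) :
  herm A -> 0 < b -> (forall x, b * rdot x x <= rdot (A x) x) ->
  (forall x y, phi (x + y) = phi x + phi y) ->
  (forall (a : R) x, phi (a%:C *: x) = a * phi x) ->
  (forall x, phi x <= c * nrm x) ->
  exists y, forall x, phi x = rdot (A y) x.
Proof.
move=> hA b0 Ab phiD phiZ phic.
pose J x := rdot (A x) x - 2 * phi x.
have Jlb x : - (c ^+ 2 / b) <= J x.
  rewrite /J; apply: le_trans (_ : b * (nrm x) ^+ 2 - 2 * (c * nrm x) <= _).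
    rewrite -subr_ge0.
    have -> : b * nrm x ^+ 2 - 2 * (c * nrm x) - - (c ^+ 2 / b) =
              (b * nrm x - c) ^+ 2 / b by field; rewrite gt_eqF.
    by rewrite divr_ge0 ?sqr_ge0 ?ltW.
  by rewrite sqr_nrm lerB ?Ab// ler_wpM2l ?phic.
have Jinf : has_inf (range J).
  by split; [exists (J 0), 0 | exists (- (c ^+ 2 / b)) => _ [x _ <-]].
pose j := inf (range J).
have jJ x : j <= J x by apply: (ge_inf Jinf.2); exists x.
have /boolp.choice[u Ju] : forall n : nat, exists x, J x < j + n.+1%:R^-1.
  move=> n; have n0 : 0 < (n.+1%:R^-1 : R) by rewrite invr_gt0.
  by have [_ [x _ <-] h] := inf_adherent n0 Jinf; exists x.
have [y hy] : exists l, hlim u l.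
  (* By the parallelogram identity a minimising sequence is a Cauchy sequence. *)
  apply: hilbert_complete => e e0.
  have [|N hN] := @inv_small R (b * e ^+ 2 / 4); first by rewrite divr_gt0 ?mulr_gt0 ?exprn_gt0.
  exists N => n m nN mN; rewrite -(ltr_pXn2r (n := 2)) ?nnegrE ?nrm_ge0 ?ltW//.
  rewrite sqr_nrm -(ltr_pM2l b0); apply: le_lt_trans (Ab _) _.
  have -> : rdot (A (u n - u m)) (u n - u m) =
     2 * J (u n) + 2 * J (u m) - 4 * J ((2^-1)%:C *: (u n + u m)).
    by rewrite /J !phiZ !phiD !bopE !rdotE (hA (u m)) (rdotC (u m)); lra.
  have := jJ ((2^-1)%:C *: (u n + u m)); have := Ju n; have := Ju m.
  have := hN _ nN; have := hN _ mN.
  move: (n.+1%:R^-1) (m.+1%:R^-1) (b * e ^+ 2) => r1 r2 r3.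
  by lra.
exists y => x.
(* The first variation of J at u n is small because u n is nearly minimal. *)
have var n : (rdot (A (u n)) x - phi x) ^+ 2 <= n.+1%:R^-1 * rdot (A x) x.
  apply: quad_form_CS => [t|]; last first.
    by apply: le_trans (Ab x); rewrite mulr_ge0 ?rdot_ge0 ?ltW.
  have := jJ (u n + t%:C *: x); have := Ju n.
  rewrite /J phiD phiZ !bopE !rdotE (hA x (u n)) (rdotC x (A (u n))).
  by move: (n.+1%:R^-1) => r1; lra.
apply/eqP; rewrite -subr_eq0 -normr_le0; apply/ler_addgt0Pl => e e0.
rewrite addr0.
have q0 : 0 <= rdot (A x) x by apply: le_trans (Ab x); rewrite mulr_ge0 ?rdot_ge0 ?ltW.
pose d := e / 2 / (nrm (A x) + 1); pose d2 := (e / 2) ^+ 2 / (rdot (A x) x + 1).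
have n0 := nrm_ge0 (A x).
have d0 : 0 < d by rewrite !divr_gt0// ltr_wpDl.
have d20 : 0 < d2 by rewrite divr_gt0 ?exprn_gt0 ?divr_gt0// ltr_wpDl.
have [N hN] := hy _ d0; have [N' hN'] := inv_small d20.
pose n := maxn N N'.
have h1 : `|rdot (A (u n)) x - phi x| <= e / 2.
  have e2 : 0 <= e / 2 by lra.
  rewrite -(@ler_pXn2r _ 2) ?nnegrE ?normr_ge0//.
  rewrite real_normK ?num_real//.
  apply: le_trans (var n) _.
  have := hN' n (leq_maxr _ _) => /ltW h; apply: le_trans (ler_wpM2r q0 h) _.
  rewrite /d2 -mulrA ler_piMr ?sqr_ge0// mulrC ler_pdivrMr ?mul1r ?lerDl//.
  by rewrite ltr_wpDl.
have h2 : `|rdot (A (u n - y)) x| <= e / 2.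
  have h v : rdot (A v) x <= nrm v * nrm (A x) by rewrite hA; exact: rdot_le_nrm.
  have hv : nrm (u n - y) * nrm (A x) <= e / 2.
    apply: le_trans (ler_wpM2r n0 (ltW (hN n (leq_maxl _ _)))) _.
    rewrite /d -(mulrA (e / 2)) ler_piMr//; first by lra.
    rewrite mulrC ler_pdivrMr ?mul1r ?lerDl//.
    by rewrite ltr_wpDl.
  rewrite ler_norml (le_trans (h _) hv) andbT lerNl -rdotNl -bopN.
  by apply: le_trans (h _) _; rewrite nrmN.
have -> : phi x - rdot (A y) x = - (rdot (A (u n)) x - phi x) + rdot (A (u n - y)) x.
  by rewrite !bopE !rdotE; ring.
by apply: le_trans (ler_normD _ _) _; rewrite normrN [e]splitr lerD.
Qed.

End Operators.

(** * Limits and extension by density *)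

Section Limits.
Context {R : realType}.
Implicit Types H K L : hilbertSpace R.

Lemma rdot_Zc H (a : R[i]) (x y : H) : rdot (a *: x) y = rdot x (a^*%C *: y).
Proof. by rewrite /rdot hdotZl hdotZr conjcK. Qed.

Lemma nrmZc H (a : R[i]) (x : H) : nrm (a *: x) = complex.Re `|a| * nrm x.
Proof.
by apply: complexI; rewrite -norm_nrm normrZ norm_nrm rmorphM; congr (_ * _).
Qed.

Lemma Re_norm_ge0 (a : R[i]) : 0 <= complex.Re `|a|.
Proof. by have := normr_ge0 a; rewrite lecE /= => /andP[]. Qed.

Lemma nrm_small_eq0 H (x : H) : (forall e : R, 0 < e -> nrm x <= e) -> x = 0.
Proof.
move=> h; apply/eqP; rewrite -nrm_eq0 -(rwP eqP); apply: le_anti.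
rewrite nrm_ge0 andbT; apply/ler_addgt0Pl => e e0; rewrite addr0; exact: h.
Qed.

Lemma hlim_unique H (u : nat -> H) l m : hlim u l -> hlim u m -> l = m.
Proof.
move=> ul um; apply/eqP; rewrite -subr_eq0; apply/eqP/nrm_small_eq0 => e e0.
have e2 : 0 < e / 2 by lra.
have [N hN] := ul _ e2; have [M hM] := um _ e2.
have h1 := hN _ (leq_maxl N M); have h2 := hM _ (leq_maxr N M).
have -> : l - m = (l - u (maxn N M)) + (u (maxn N M) - m) by rewrite addrA subrK.
by apply: le_trans (nrmD _ _) _; rewrite nrmBC; lra.
Qed.

Lemma hlimD H (u v : nat -> H) l m : hlim u l -> hlim v m ->
  hlim (fun n => u n + v n) (l + m).
Proof.
move=> ul um e e0; have e2 : 0 < e / 2 by lra.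
have [N hN] := ul _ e2; have [M hM] := um _ e2.
exists (maxn N M) => n; rewrite geq_max => /andP[/hN h1 /hM h2].
by rewrite opprD addrACA; apply: le_lt_trans (nrmD _ _) _; lra.
Qed.

Lemma hlim_bop H K (A : bop H K) (u : nat -> H) l : hlim u l ->
  hlim (fun n => A (u n)) (A l).
Proof.
have [c c0 hc] := bop_bound A => ul e e0.
have [|N hN] := ul (e / c); first by rewrite divr_gt0.
exists N => n /hN h; rewrite -bopN -bopD; apply: le_lt_trans (hc _) _.
by rewrite mulrC -ltr_pdivlMr.
Qed.

Lemma hlimZ H (a : R[i]) (u : nat -> H) l : hlim u l ->
  hlim (fun n => a *: u n) (a *: l).
Proof. exact: (@hlim_bop H H (a *: id_bop H)). Qed.

Lemma hlim_cst H (l : H) : hlim (fun _ => l) l.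
Proof. by move=> e e0; exists 0%N => n _; rewrite subrr /nrm rdot0l sqrtr0. Qed.

Lemma hlim_ext H (u v : nat -> H) l : (forall n, u n = v n) -> hlim u l -> hlim v l.
Proof. by move=> uv ul e /ul[N hN]; exists N => n /hN; rewrite uv. Qed.

Lemma hlimS H (u : nat -> H) l : hlim u l -> hlim (fun n => u n.+1) l.
Proof. by move=> ul e /ul[N hN]; exists N => n nN; apply/hN/leqW. Qed.

Lemma hlim_nrm_le H (u : nat -> H) l c : hlim u l -> (forall n, nrm (u n) <= c) ->
  nrm l <= c.
Proof.
move=> ul uc; apply/ler_addgt0Pr => e e0; have [N hN] := ul _ e0.
have -> : l = u N + (l - u N) by rewrite addrC subrK.
apply: le_trans (nrmD _ _) _; rewrite lerD// nrmBC ltW//; exact: hN.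
Qed.

Lemma hlim_rdot H (u : nat -> H) l y : hlim u l ->
  rdot (u n) y @[n --> \oo] --> rdot l y.
Proof.
move=> ul; apply/cvgrPdist_le => e e0.
have y0 : 0 < nrm y + 1 by rewrite ltr_wpDl ?nrm_ge0.
have [|N hN] := ul (e / (nrm y + 1)); first by rewrite divr_gt0.
exists N => // n nN; rewrite -rdotNl -rdotDl.
apply: le_trans (rdot_abs _ _) _; rewrite nrmBC.
apply: le_trans (_ : e / (nrm y + 1) * nrm y <= _).
  by rewrite ler_wpM2r ?nrm_ge0// ltW// hN.
by rewrite -mulrA ler_piMr ?(ltW e0)// mulrC ler_pdivrMr// mul1r lerDl.
Qed.

Lemma hlim_rdot2 H K (u : nat -> H) (v : nat -> K) l m y x : hlim u l -> hlim v m ->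
  (forall n, rdot (u n) y = rdot x (v n)) -> rdot l y = rdot x m.
Proof.
move=> ul vm uv; rewrite (rdotC x).
apply: cvg_unique (hlim_rdot (y := y) ul) _ => //.
have -> : (fun n => rdot (u n) y) = (fun n => rdot (v n) x).
  by apply/funext => n; rewrite uv rdotC.
exact: hlim_rdot.
Qed.

Lemma dense_approx H (S : set H) : dense S ->
  forall x (e : R), 0 < e -> exists2 d, S d & nrm (x - d) < e.
Proof.
move=> dS x e e0; have e0' : (0 : R[i]) < e%:C by rewrite ltcR.
have [|d [Bd Sd]] := dS (interior (ball x e%:C)) _ (@open_interior _ _).
  by exists x; exact: nbhsx_ballx.
exists d => //; have /interior_subset := Bd.
by rewrite -ball_normE /= norm_nrm ltcR.
Qed.

(** A bounded linear relation with dense domain extends by continuity to a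
    bounded operator; working with a relation spares choosing coordinates. *)
Lemma extend_dense H K (G : H -> K -> Prop) (c : R) : 0 <= c ->
  (forall a d w d' w', G d w -> G d' w' -> G (a *: d + d') (a *: w + w')) ->
  (forall d w, G d w -> nrm w <= c * nrm d) ->
  dense [set d | exists w, G d w] ->
  exists2 T : bop H K, forall x, nrm (T x) <= c * nrm x &
    forall d w, G d w -> T d = w.
Proof.
move=> c0 Glin Gc Gd.
pose P x y := forall e : R, 0 < e -> exists d w, [/\ G d w, nrm (x - d) < e & nrm (y - w) < e].
have GP d w : G d w -> P d w.
  move=> h e e0; exists d, w; split=> //; by rewrite subrr /nrm rdot0l sqrtr0.
have Plin a x y x' y' : P x y -> P x' y' -> P (a *: x + x') (a *: y + y').
  move=> h h' e e0; have a0 := Re_norm_ge0 a.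
  have a1 : 0 < complex.Re `|a| + 1 by lra.
  have e1 : 0 < e / (complex.Re `|a| + 1) by rewrite divr_gt0.
  have [d [w [Gdw dx wy]]] := h _ e1; have [d' [w' [Gdw' dx' wy']]] := h' _ e1.
  exists (a *: d + d'), (a *: w + w'); split; first exact: Glin.
    rewrite opprD addrACA -scalerBr; apply: le_lt_trans (nrmD _ _) _.
    by rewrite nrmZc -[ltRHS](divfK (lt0r_neq0 a1)) mulrDr mulr1 ler_ltD// mulrC ler_wpM2r// ltW.
  rewrite opprD addrACA -scalerBr; apply: le_lt_trans (nrmD _ _) _.
  by rewrite nrmZc -[ltRHS](divfK (lt0r_neq0 a1)) mulrDr mulr1 ler_ltD// mulrC ler_wpM2r// ltW.
have Pc x y : P x y -> nrm y <= c * nrm x.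
  move=> h; apply/ler_addgt0Pr => e e0.
  have e1 : 0 < e / (c + 1) by rewrite divr_gt0// ltr_wpDl.
  have [d [w [Gdw dx wy]]] := h _ e1.
  have -> : y = w + (y - w) by rewrite addrC subrK.
  have hd : nrm d <= nrm x + nrm (x - d).
    have {1}-> : d = x - (x - d) by rewrite opprB addrC subrK.
    by rewrite -[nrm (x - d)]nrmN nrmD.
  apply: le_trans (nrmD _ _) _; apply: le_trans (lerD (Gc _ _ Gdw) (ltW wy)) _.
  apply: le_trans (lerD (ler_wpM2l c0 hd) (lexx _)) _.
  rewrite mulrDr -addrA lerD2l.
  apply: le_trans (lerD (ler_wpM2l c0 (ltW dx)) (lexx _)) _.
  by rewrite -[leRHS](divfK (lt0r_neq0 (ltr_wpDl c0 ltr01))) mulrDr mulr1 mulrC.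
have Pex x : exists y, P x y.
  have /boolp.choice[dw hdw] : forall n : nat, exists p : H * K,
      G p.1 p.2 /\ nrm (x - p.1) < n.+1%:R^-1.
    move=> n; have n0 : 0 < (n.+1%:R^-1 : R) by rewrite invr_gt0.
    by have [d [w h] hd] := dense_approx Gd x n0; exists (d, w).
  have close e : 0 < e -> exists N, forall n, (N <= n)%N -> nrm (x - (dw n).1) < e.
    move=> /inv_small[N hN]; exists N => n /hN; apply: lt_trans; exact: (hdw n).2.
  have [y hy] : exists l, hlim (fun n => (dw n).2) l.
    apply: hilbert_complete => e e0.
    have e1 : 0 < e / (c + 1) / 2 by rewrite !divr_gt0// ltr_wpDl.
    have [N hN] := close _ e1; exists N => n m /hN h1 /hN h2.
    have : G (- 1 *: (dw m).1 + (dw n).1) (- 1 *: (dw m).2 + (dw n).2).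
      by apply: Glin; [exact: (hdw m).1 | exact: (hdw n).1].
    rewrite !scaleN1r !(addrC (- _)) => /Gc; move/le_lt_trans; apply.
    have h3 : nrm ((dw n).1 - (dw m).1) < e / (c + 1).
      have -> : (dw n).1 - (dw m).1 = ((dw n).1 - x) + (x - (dw m).1).
        by rewrite addrA subrK.
      apply: le_lt_trans (nrmD _ _) _; rewrite nrmBC; lra.
    apply: le_lt_trans (ler_wpM2l c0 (ltW h3)) _.
    by rewrite mulrCA -[ltRHS]mulr1 ltr_pM2l// ltr_pdivrMr ?mul1r ?ltrDl// ltr_wpDl.
  exists y => e e0; have [N hN] := close _ e0; have [M hM] := hy _ e0.
  exists (dw (maxn N M)).1, (dw (maxn N M)).2; split; first exact: (hdw _).1.
    by apply: hN; rewrite leq_maxl.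
  by rewrite nrmBC; apply: hM; rewrite leq_maxr.
(* On the difference of two pairs the bound reads |y - y'| <= c |0|. *)
have Puniq x y y' : P x y -> P x y' -> y = y'.
  move=> h h'; have := Plin (- 1) _ _ _ _ h h'.
  rewrite !scaleN1r addNr => /Pc; rewrite {2}/nrm rdot0l sqrtr0 mulr0 => h0.
  apply/esym/eqP; rewrite -subr_eq0 -nrm_eq0 addrC.
  by apply/eqP/le_anti; rewrite h0 nrm_ge0.
have [T hT] := boolp.choice Pex.
have lT : linear T.
  by move=> a x y; apply: Puniq (hT _) _; apply: Plin; exact: hT.
have bT x : nrm (T x) <= c * nrm x by exact: Pc (hT x).
exists (Bop (mk_bopP lT bT)) => // d w /GP h; exact: Puniq (hT d) h.
Qed.

End Limits.

(** * Adjoints, inverses and square roots *)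

Section Calculus.
Context {R : realType}.
Implicit Types H K L : hilbertSpace R.

Lemma nrm_leP H K (x : H) (y : K) (c : R) : 0 <= c ->
  (nrm x <= c * nrm y) <-> (rdot x x <= c ^+ 2 * rdot y y).
Proof.
move=> c0; rewrite -!sqr_nrm -exprMn.
by rewrite (@ler_pXn2r _ 2) ?nnegrE ?mulr_ge0 ?nrm_ge0.
Qed.

Lemma bop_bound2 H K (A : bop H K) :
  exists2 c : R, 0 < c & forall x, rdot (A x) (A x) <= c * rdot x x.
Proof.
have [c c0 hc] := bop_bound A; exists (c ^+ 2); first by rewrite exprn_gt0.
by move=> x; apply/(nrm_leP _ _ (ltW c0)).
Qed.

Lemma bop_form_bound H (A : bop H H) :
  exists2 c : R, 0 < c & forall x, rdot (A x) x <= c * rdot x x.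
Proof.
have [c c0 hc] := bop_bound A; exists c => // x.
apply: le_trans (rdot_le_nrm _ _) _; rewrite -sqr_nrm expr2 mulrA.
by rewrite ler_wpM2r ?nrm_ge0.
Qed.

(** The Riesz representation of x |-> <A x, y>. *)
Lemma adjoint_exists H K (A : bop H K) :
  exists B : bop K H, forall x y, rdot (A x) y = rdot x (B y).
Proof.
have [c c0 hc] := bop_bound A.
have /boolp.choice[B hB] : forall y : K, exists w : H, forall x, rdot (A x) y = rdot x w.
  move=> y.
  have [|x x'|a x|x|w hw] := @coercive_solve _ H (id_bop H) 1 (c * nrm y)
    (fun x => rdot (A x) y) (@herm1 _ H) ltr01.
  - by move=> x; rewrite mul1r.
  - by rewrite !bopE !rdotE.
  - by rewrite !bopE !rdotE.
  - apply: le_trans (rdot_le_nrm _ _) _; rewrite -mulrA (mulrC (nrm y)) mulrA.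
    by rewrite ler_wpM2r// nrm_ge0.
  by exists w => x; rewrite hw rdotC.
have lB : linear B.
  move=> a y z; apply: rdot_inj => x.
  rewrite [LHS]rdotC -hB rdotDr rdotDl; congr (_ + _); last by rewrite hB rdotC.
  by rewrite rdotC rdot_Zc -bopZ rdotC hB rdot_Zc conjcK rdotC.
have bB y : nrm (B y) <= c * nrm y.
  have := hB y (B y); rewrite -sqr_nrm => h.
  have h2 : nrm (B y) ^+ 2 <= c * nrm (B y) * nrm y.
    rewrite -h; apply: le_trans (rdot_le_nrm _ _) _.
    by rewrite ler_wpM2r// nrm_ge0.
  have [->|n0] := eqVneq (nrm (B y)) 0; first by rewrite mulr_ge0 ?nrm_ge0 ?ltW.
  have n1 : 0 < nrm (B y) by rewrite lt0r n0 nrm_ge0.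
  by rewrite -(ler_pM2l n1) -expr2 mulrCA mulrA.
by exists (Bop (mk_bopP lB bB)).
Qed.

Lemma adjointP H K (A : bop H K) x y : rdot (A x) y = rdot x ((A^*)%OP y).
Proof. by have [B hB] := adjoint_exists A; rewrite (adjoint_unique hB). Qed.

Lemma adjointC H K (A : bop H K) x y : rdot ((A^*)%OP y) x = rdot y (A x).
Proof. by rewrite rdotC -adjointP rdotC. Qed.

Lemma adjointM H K L (A : bop K L) (B : bop H K) :
  ((A ** B)^* = B^* ** A^*)%OP.
Proof. by apply: adjoint_unique => x y; rewrite !bopE !adjointP. Qed.

Lemma herm_conj H K (C : bop H K) (A : bop K K) : herm A -> herm (C^* ** A ** C)%OP.
Proof. by move=> hA x y; rewrite !bopE adjointC hA adjointP. Qed.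

Lemma op_le_conj H K (C : bop H K) (A B : bop K K) : (A <= B)%OP ->
  (C^* ** A ** C <= C^* ** B ** C)%OP.
Proof.
move=> /op_leP[h1 h2]; apply/op_leP; split.
  have -> : (C^* ** B ** C - C^* ** A ** C = C^* ** (B - A) ** C)%OP.
    by apply/bop_ext => x; rewrite !bopE.
  exact: herm_conj.
by move=> x; rewrite !bopE !adjointC.
Qed.

Lemma op_geC H (A : bop H H) (b : R) :
  (b%:C *: id_bop H <= A)%OP <-> herm A /\ forall x, b * rdot x x <= rdot (A x) x.
Proof.
split=> [h|[h1 h2]].
  by split; [exact: herm_geC h | move: h => /op_leP[_ h] x; have := h x; rewrite !bopE !rdotE].
by apply: op_le_herm => // [|x]; [exact/hermZ/herm1 | rewrite !bopE !rdotE].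
Qed.

Lemma op_leC H (A : bop H H) (b : R) :
  (A <= b%:C *: id_bop H)%OP <-> herm A /\ forall x, rdot (A x) x <= b * rdot x x.
Proof.
split=> [/op_leP[h1 h2]|[h1 h2]].
  split=> [|x]; last by have := h2 x; rewrite !bopE !rdotE.
  have -> : A = b%:C *: id_bop H - (b%:C *: id_bop H - A) by rewrite opprB addrC subrK.
  by apply/hermD/hermN => //; exact/hermZ/herm1.
by apply: op_le_herm => // [|x]; [exact/hermZ/herm1 | rewrite !bopE !rdotE].
Qed.

(** Minimisation gives the surjectivity of A, and the lower bound both its
    injectivity and the bound 1 / b of the inverse. *)
Lemma positive_inverse H (A : bop H H) (b : R) : 0 < b ->
  (b%:C *: id_bop H <= A)%OP ->
  exists B : bop H H, [/\ (A ** B = id_bop H)%OP, (B ** A = id_bop H)%OP & herm B].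
Proof.
move=> b0 /op_geC[hA bA].
have /boolp.choice[B hB] : forall y : H, exists w : H, A w = y.
  move=> y; have [x x'|a x|x|w hw] := @coercive_solve _ H A b (nrm y)
    (fun x => rdot y x) hA b0 bA; rewrite ?rdotE//.
    exact: rdot_le_nrm.
  by exists w; apply: rdot_inj => z; rewrite hw.
have Ainj x y : A x = A y -> x = y.
  move=> h; apply/eqP; rewrite -subr_eq0; apply/eqP/rdot_eq0/le_anti.
  rewrite rdot_ge0 andbT -(ler_pM2l b0) mulr0; apply: le_trans (bA _) _.
  by rewrite !bopE h subrr rdot0l.
have lB : linear B by move=> a y z; apply: Ainj; rewrite !bopE !hB.
have bB y : nrm (B y) <= b^-1 * nrm y.
  have h : b * nrm (B y) ^+ 2 <= nrm y * nrm (B y).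
    by rewrite sqr_nrm; apply: le_trans (bA _) _; rewrite hB rdot_le_nrm.
  have [->|n0] := eqVneq (nrm (B y)) 0; first by rewrite mulr_ge0 ?nrm_ge0 ?invr_ge0 ?ltW.
  have n1 : 0 < nrm (B y) by rewrite lt0r n0 nrm_ge0.
  by rewrite mulrC ler_pdivlMr// mulrC -(ler_pM2r n1) -mulrA -expr2.
exists (Bop (mk_bopP lB bB)); split.
- by apply: bop_ext => x; rewrite !bopE /= hB.
- by apply: bop_ext => x; rewrite !bopE /=; apply: Ainj; rewrite hB.
- by move=> x y /=; rewrite -{2}(hB x) hA hB.
Qed.

Lemma strictly_positiveI H (A : bop H H) (b : R) : 0 < b ->
  (b%:C *: id_bop H <= A)%OP -> strictly_positive A.
Proof.
move=> b0 bA; have [B [h1 h2 _]] := positive_inverse b0 bA.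
split; last by exists B.
move: bA => /op_geC[hA bA]; apply/positive_opP; split => // x.
by apply: le_trans (bA x); rewrite mulr_ge0 ?rdot_ge0 ?ltW.
Qed.

Lemma positive_CS H (A : bop H H) : herm A -> (forall x, 0 <= rdot (A x) x) ->
  forall x y, rdot (A x) y ^+ 2 <= rdot (A x) x * rdot (A y) y.
Proof.
move=> hA pA x y; apply: quad_form_CS (pA y) => t.
suff -> : rdot (A x) x + t * rdot (A x) y *+ 2 + t ^+ 2 * rdot (A y) y =
  rdot (A (x + t%:C *: y)) (x + t%:C *: y) by exact: pA.
by rewrite !bopE !rdotE (hA y x) (rdotC y (A x)); ring.
Qed.

(** Cauchy-Schwarz for the form <A x, y> at y = A x turns the bound of the
    quadratic form into a bound of the norm. *)
Lemma positive_bound H (A : bop H H) (k : R) : herm A -> 0 <= k ->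
  (forall x, 0 <= rdot (A x) x) -> (forall x, rdot (A x) x <= k * rdot x x) ->
  forall x, nrm (A x) <= k * nrm x.
Proof.
move=> hA k0 pA Ak x; apply/nrm_leP => //.
have := positive_CS hA pA x (A x).
have [->|n0] := eqVneq (rdot (A x) (A x)) 0; first by rewrite mulr_ge0 ?sqr_ge0 ?rdot_ge0.
have n1 : 0 < rdot (A x) (A x) by rewrite lt0r n0 rdot_ge0.
move=> h; rewrite -(ler_pM2r n1) -expr2; apply: le_trans h _.
apply: le_trans (_ : k * rdot x x * (k * rdot (A x) (A x)) <= _).
  by rewrite ler_pM.
by rewrite le_eqVlt; apply/orP; left; apply/eqP; ring.
Qed.

(** The square root is 1 - Y with Y the fixed point of Y = (T + Y^2)/2, where
    T = 1 - A has norm k < 1, so that the iteration contracts by k. The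
    iterates are polynomials in T, hence Y commutes with whatever commutes
    with T. *)
Lemma sqrt_contraction H (T : bop H H) (k : R) : herm T -> 0 <= k -> k < 1 ->
  (forall x, nrm (T x) <= k * nrm x) ->
  exists Y : bop H H, [/\ herm Y, forall x, nrm (Y x) <= k * nrm x,
    forall x, Y x + Y x = T x + Y (Y x) &
    forall B : bop H H, (T ** B = B ** T)%OP -> (Y ** B = B ** Y)%OP].
Proof.
move=> hT k0 k1 Tk.
have half2 x : (2^-1)%:C *: x + (2^-1)%:C *: x = x :> H.
  rewrite -scalerDl -rmorphD (_ : 2^-1 + 2^-1 = 1 :> R) ?scale1r//.
  by lra.
pose Y n := iter n (fun Y => (2^-1)%:C *: (T + (Y ** Y)%OP)) (0 : bop H H).
have YS n x : Y n.+1 x = (2^-1)%:C *: (T x + Y n (Y n x)) by [].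
have Y0 x : Y 0 x = 0 by [].
have hY n : herm (Y n).
  elim: n => [|n IH]; first by move=> x y; rewrite !bopE !rdotE.
  by apply/hermZ/hermD => //; exact: hermM.
have bY n x : nrm (Y n x) <= k * nrm x.
  elim: n x => [|n IH] x.
    by rewrite Y0 {1}/nrm rdot0l sqrtr0 mulr_ge0 ?nrm_ge0.
  rewrite YS nrmZ ger0_norm ?invr_ge0//.
  have h1 := nrmD (T x) (Y n (Y n x)); have h2 := Tk x.
  have h3 := IH (Y n x); have h4 := ler_wpM2l k0 (IH x).
  have h5 : k * (k * nrm x) <= k * nrm x.
    by rewrite ler_wpM2l// ler_piMl ?nrm_ge0 ?ltW.
  by lra.
have dY n x : nrm (Y n.+1 x - Y n x) <= k ^+ n.+1 * nrm x.
  elim: n x => [|n IH] x.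
    by rewrite expr1 Y0 subr0.
  have -> : Y n.+2 x - Y n.+1 x = (2^-1)%:C *:
     (Y n.+1 (Y n.+1 x - Y n x) + (Y n.+1 (Y n x) - Y n (Y n x))).
    by rewrite 2!YS -scalerBr bopD bopN addrA subrK opprD addrACA subrr add0r.
  rewrite nrmZ ger0_norm ?invr_ge0//.
  have h1 := nrmD (Y n.+1 (Y n.+1 x - Y n x)) (Y n.+1 (Y n x) - Y n (Y n x)).
  have h2 := bY n.+1 (Y n.+1 x - Y n x); have h3 := ler_wpM2l k0 (IH x).
  have h4 := IH (Y n x); have h5 := ler_wpM2l (exprn_ge0 n.+1 k0) (bY n x).
  have e1 : k ^+ n.+2 * nrm x = k * (k ^+ n.+1 * nrm x) by rewrite mulrA -exprS.
  have e2 : k ^+ n.+2 * nrm x = k ^+ n.+1 * (k * nrm x) by rewrite mulrA -exprSr.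
  by rewrite e1; rewrite e1 in e2; rewrite -e2 in h5; lra.
have tailY n p x : nrm (Y (n + p)%N x - Y n x) <= k ^+ n * (nrm x / (1 - k)).
  have k2 : 0 < 1 - k by rewrite subr_gt0.
  suff h : (1 - k) * nrm (Y (n + p)%N x - Y n x) <= k ^+ n * nrm x * (1 - k ^+ p).
    rewrite mulrA ler_pdivlMr// mulrC; apply: le_trans h _.
    rewrite ler_piMr ?mulr_ge0 ?nrm_ge0 ?exprn_ge0// lerBlDr lerDl exprn_ge0//.
  elim: p => [|p IH].
    by rewrite addn0 subrr /nrm rdot0l sqrtr0 mulr0 expr0 subrr mulr0.
  rewrite addnS.
  have -> : Y (n + p).+1 x - Y n x =
    (Y (n + p).+1 x - Y (n + p)%N x) + (Y (n + p)%N x - Y n x) by rewrite addrA subrK.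
  apply: le_trans (ler_wpM2l (ltW k2) (nrmD _ _)) _; rewrite mulrDr.
  apply: le_trans (lerD (ler_wpM2l (ltW k2) (dY _ _)) IH) _.
  have h : k ^+ (n + p).+1 <= k ^+ n * k ^+ p by rewrite -exprD exprS ler_piMl ?exprn_ge0 ?(ltW k1).
  have -> : k ^+ n * nrm x * (1 - k ^+ p.+1) =
      (1 - k) * (k ^+ n * k ^+ p * nrm x) + k ^+ n * nrm x * (1 - k ^+ p).
    by rewrite exprS; ring.
  by rewrite lerD2r ler_wpM2l ?(ltW k2)// ler_wpM2r ?nrm_ge0.
have kto0 (e : R) : 0 < e -> exists N, forall n, (N <= n)%N -> k ^+ n < e.
  move=> e0; have := @cvg_expr R k; rewrite ger0_norm// k1 => /(_ isT).
  move=> /cvgrPdist_lt/(_ e e0)[N _ hN]; exists N => n nN.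
  by have := hN n nN; rewrite /= sub0r normrN ger0_norm// exprn_ge0.
have /boolp.choice[Yl hYl] : forall x, exists l, hlim (fun n => Y n x) l.
  move=> x; apply: hilbert_complete => e e0.
  have c0 : 0 <= nrm x / (1 - k) by rewrite divr_ge0 ?nrm_ge0// subr_ge0 ltW.
  have c1 : 0 < nrm x / (1 - k) + 1 by rewrite ltr_wpDl.
  have [|N hN] := kto0 (e / (nrm x / (1 - k) + 1)); first by rewrite divr_gt0.
  have key n m : (N <= n)%N -> (n <= m)%N -> nrm (Y m x - Y n x) < e.
    move=> nN nm; rewrite -(subnKC nm); apply: le_lt_trans (tailY _ _ _) _.
    apply: le_lt_trans (ler_wpM2r c0 (ltW (hN _ nN))) _.
    by rewrite -mulrA -[ltRHS]mulr1 ltr_pM2l// mulrC ltr_pdivrMr// mul1r ltrDl.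
  exists N => n m nN mN; have [nm|mn] := leqP n m; last exact/key/ltnW.
  by rewrite nrmBC; exact: key.
have lY : linear Yl.
  move=> a x y; apply: hlim_unique (hYl _) _.
  apply: hlim_ext (hlimD (hlimZ a (hYl x)) (hYl y)) => n.
  by rewrite !bopE.
have bYl x : nrm (Yl x) <= k * nrm x by exact: hlim_nrm_le (hYl x) (bY ^~ x).
exists (Bop (mk_bopP lY bYl)); split => //=.
- by move=> x y /=; apply: hlim_rdot2 (hYl x) (hYl y) _ => n; rewrite hY.
- move=> x; apply: (@hlim_unique _ _ (fun n => Y n.+1 x + Y n.+1 x)).
    by apply: hlimD; exact: hlimS (hYl x).
  apply: (@hlim_ext _ _ (fun n => T x + Y n (Y n x))) => [n|].
    by rewrite YS half2.
  apply: hlimD (hlim_cst _) _; rewrite -[Yl (Yl x)]add0r.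
  apply: (@hlim_ext _ _ (fun n => Y n (Y n x - Yl x) + Y n (Yl x))) => [n|].
    by rewrite bopD bopN subrK.
  apply: hlimD (hYl _) => e e0; have [N hN] := hYl x e e0.
  exists N => n /hN h; rewrite subr0; apply: le_lt_trans (bY _ _) _.
  by apply: le_lt_trans h; rewrite ler_piMl ?nrm_ge0 ?ltW.
- move=> B TB; apply: bop_ext => x; rewrite !bopE /=.
  apply: hlim_unique (hYl _) _.
  have YB n y : Y n (B y) = B (Y n y).
    elim: n y => [|n IH] y; first by rewrite !Y0 bop0.
    by rewrite !YS bopZ bopD !IH -!compoE TB.
  by apply: hlim_ext (hlim_bop B (hYl x)) => n; rewrite YB.
Qed.

(** Pointwise, so that commutation facts rewrite inside quadratic forms. *)
Definition opcomm H (A B : bop H H) := forall x, A (B x) = B (A x).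

Lemma opcomm_refl H (A : bop H H) : opcomm A A.
Proof. by []. Qed.

Lemma opcomm_sym H (A B : bop H H) : opcomm A B -> opcomm B A.
Proof. by move=> AB x. Qed.

Lemma opcommD H (A B C : bop H H) : opcomm A C -> opcomm B C -> opcomm (A + B) C.
Proof. by move=> hAC hBC x; rewrite !addoE bopD hAC hBC. Qed.

Lemma opcommN H (A C : bop H H) : opcomm A C -> opcomm (- A) C.
Proof. by move=> hAC x; rewrite !oppoE bopN hAC. Qed.

Lemma opcommB H (A B C : bop H H) : opcomm A C -> opcomm B C -> opcomm (A - B) C.
Proof. by move=> hAC hBC; apply/opcommD/opcommN. Qed.

Lemma opcommZ H a (A C : bop H H) : opcomm A C -> opcomm (a *: A) C.
Proof. by move=> hAC x; rewrite !scaleoE bopZ hAC. Qed.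

Lemma opcommM H (A B C : bop H H) : opcomm A C -> opcomm B C -> opcomm (A ** B)%OP C.
Proof. by move=> hAC hBC x; rewrite !compoE hBC hAC. Qed.

Lemma opcomm1 H (C : bop H H) : opcomm (id_bop H) C.
Proof. by []. Qed.

Lemma opcommP H (A B : bop H H) : opcomm A B <-> (A ** B = B ** A)%OP.
Proof.
by split=> [AB|AB x]; [exact: bop_ext | rewrite -!compoE AB].
Qed.

End Calculus.

(** commute proves that two explicit polynomials in commuting operators
    commute, by descending through sums, scalings and products. *)
Ltac split_opcomm := first [ apply: opcomm1 | apply: opcommD | apply: opcommN
  | apply: opcommZ | apply: opcommM ].
Ltac commute := repeat first [ assumption | exact: opcomm_refl
  | apply: opcomm_sym; assumption | split_opcomm | apply: opcomm_sym; split_opcomm ].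

(** * Positivity tested near each spectral value *)

Section CommutingPositive.
Context {R : realType}.
Implicit Types H K L : hilbertSpace R.

(** After division by a larger than the norm of A the operator T = 1 - A / a
    is a contraction, as sqrt_contraction demands. *)
Lemma sqrt_op H (A : bop H H) (b : R) : 0 < b -> (b%:C *: id_bop H <= A)%OP ->
  exists S : bop H H, exists2 s : R, 0 < s &
  [/\ (s%:C *: id_bop H <= S)%OP, (S ** S = A)%OP &
    forall B : bop H H, opcomm A B -> opcomm S B].
Proof.
move=> b0 /op_geC[hA bA]; have [c c0 Ac] := bop_form_bound A.
pose a := c + b; have a0 : 0 < a by rewrite addr_gt0.
pose k := c / a; have k0 : 0 <= k by rewrite divr_ge0 ?ltW.
have k1 : k < 1 by rewrite ltr_pdivrMr// mul1r ltrDl.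
pose T : bop H H := id_bop H - (a^-1)%:C *: A.
have hT : herm T by apply/hermD/hermN/hermZ => //; exact: herm1.
have pT x : 0 <= rdot (T x) x.
  rewrite !bopE !rdotE subr_ge0 mulrC ler_pdivrMr//; apply: le_trans (Ac x) _.
  by rewrite mulrC ler_wpM2l ?rdot_ge0// lerDl ltW.
have Tk x : rdot (T x) x <= k * rdot x x.
  rewrite !bopE !rdotE lerBlDr -lerBlDl -[X in X - _]mul1r -mulrBl.
  have -> : 1 - k = a^-1 * b by rewrite /k /a; field; rewrite gt_eqF.
  by rewrite -mulrA ler_wpM2l// invr_ge0 ltW.
have [Y [hY Yk YE Ycomm]] := sqrt_contraction hT k0 k1 (positive_bound hT k0 pT Tk).
pose r := Num.sqrt a; have r0 : 0 < r by rewrite sqrtr_gt0.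
have rr : r * r = a by rewrite -expr2 sqr_sqrtr// ltW.
exists (r%:C *: (id_bop H - Y)), (r * (1 - k)).
  by rewrite mulr_gt0// subr_gt0.
split.
- apply/op_geC; split; first by apply/hermZ/hermD/hermN => //; exact: herm1.
  move=> x; rewrite !bopE !rdotE -mulrA ler_wpM2l ?(ltW r0)// mulrBl mul1r lerD2l.
  rewrite lerN2; apply: le_trans (rdot_le_nrm _ _) _.
  by rewrite -sqr_nrm expr2 mulrA ler_wpM2r ?nrm_ge0.
- apply: bop_ext => x; rewrite !bopE -!scalerBr scalerA -rmorphM rr.
  have -> : x - Y x - (Y x - Y (Y x)) = x - T x.
    have -> : T x = Y x + Y x - Y (Y x) by rewrite YE addrK.
    by rewrite !opprD !opprK !addrA.
  rewrite !bopE opprD opprK addrA subrr add0r scalerA -rmorphM divff ?scale1r//.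
  by rewrite gt_eqF.
- move=> B AB; have /opcommP/Ycomm/opcommP YB : opcomm T B by rewrite /T; commute.
  by commute.
Qed.

(** For A >= e > 0 the product A B = S B S with S the square root of A is
    visibly positive; then e tends to 0. *)
Lemma positive_mul H (A B : bop H H) : herm A -> herm B ->
  (forall x, 0 <= rdot (A x) x) -> (forall x, 0 <= rdot (B x) x) ->
  opcomm A B -> forall x, 0 <= rdot (A (B x)) x.
Proof.
move=> hA hB pA pB AB x.
apply/ler_addgt0Pr => e e0.
have d0 : 0 < rdot (B x) x + 1 by rewrite ltr_wpDl.
pose d := e / (rdot (B x) x + 1); have dp : 0 < d by rewrite divr_gt0.
have hAd : (d%:C *: id_bop H <= A + d%:C *: id_bop H)%OP.
  apply/op_geC; split; first by apply/hermD/hermZ => //; exact: herm1.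
  by move=> y; rewrite !bopE !rdotE lerDr.
have [S [s s0 [/op_geC[hS _] SS Scomm]]] := sqrt_op dp hAd.
have /Scomm SB : opcomm (A + d%:C *: id_bop H) B by commute.
have := pB (S x); rewrite -SB -hS -[S (S _)]compoE SS !bopE !rdotE.
move/le_trans; apply; rewrite lerD2l /d mulrAC ler_pdivrMr//.
by rewrite ler_pM2l// lerDl.
Qed.

(** Bernstein's weak law of large numbers, one coin toss at a time: averaging
    the bounds centred at j and j + 1 with weights 1 - y and y moves the centre
    of N y - j to that of (N - 1) y - j and adds the variance y (1 - y). *)
Lemma localize_step H (W y : bop H H) (eta kappa : R) (n : nat) :
  herm W -> herm y -> opcomm W y ->
  (forall x, 0 <= rdot (y x) x) -> (forall x, rdot (y x) x <= rdot x x) ->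
  (forall j, (j <= n)%N -> forall x, 0 <= rdot (W x) x + eta * rdot x x +
     kappa * rdot (n%:R%:C *: y x - j%:R%:C *: x) (n%:R%:C *: y x - j%:R%:C *: x)) ->
  forall x, 0 <= rdot (W x) x + eta * rdot x x +
     kappa * n%:R * rdot (y (x - y x)) x.
Proof.
move=> hW hy Wy y0 y1 base.
(* G i j is the bound with centre j after i tosses: i = 0 is the assumption, and
   i = n, j = 0 the conclusion. *)
pose G (i j : nat) : bop H H := W + eta%:C *: id_bop H + kappa%:C *:
  ((((n%:R - i%:R)%:C *: y - j%:R%:C *: id_bop H) **
    ((n%:R - i%:R)%:C *: y - j%:R%:C *: id_bop H))%OP +
   i%:R%:C *: (y ** (id_bop H - y))%OP).
have hG i j : herm (G i j).
  apply: hermD; first by apply/hermD/hermZ => //; exact: herm1.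
  apply/hermZ/hermD; [apply: hermM|apply/hermZ/hermM] => //;
    try (by apply/hermD/hermN/hermZ => //; apply/hermZ || exact: herm1).
  - by apply/hermD/hermN => //; exact: herm1.
  - by move=> x; rewrite !bopE.
have GE i j z u : rdot (G i j z) u = rdot (W z) u + eta * rdot z u + kappa *
    ((n%:R - i%:R) ^+ 2 * rdot (y (y z)) u - 2 * (n%:R - i%:R) * j%:R * rdot (y z) u +
     j%:R ^+ 2 * rdot z u + i%:R * (rdot (y z) u - rdot (y (y z)) u)).
  by rewrite !bopE !rdotE; ring.
have Gy i j : opcomm (G i j) y.
  by rewrite /G; commute.
clearbody G.
suff pG i : (i <= n)%N -> forall j, (j + i <= n)%N -> forall x, 0 <= rdot (G i j x) x.
  move=> x; have := pG n (leqnn n) 0%N (leqnn n) x.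
  rewrite GE subrr bopD bopN rdotDl rdotNl; lra.
elim: i => [_ j|i IH ilt j].
  rewrite addn0 => jn x; have := base j jn x.
  rewrite GE !rdotE subr0 (hy (y x)) (rdotC x); lra.
rewrite addnS => jn x.
have h1 := IH (ltnW ilt) j (ltnW jn); have h2 := IH (ltnW ilt) j.+1 jn.
have p1 := positive_mul hy (hG i j.+1) y0 h2 (opcomm_sym (Gy i j.+1)) x.
have h1y : herm (id_bop H - y) by apply/hermD/hermN => //; exact: herm1.
have p2 := positive_mul h1y (hG i j) _ h1 _ x.
have {}p2 : 0 <= rdot ((id_bop H - y) (G i j x)) x.
  apply: p2 => z; first by rewrite !bopE !rdotE subr_ge0.
  by move: z; apply: opcommB => // z; rewrite Gy.
apply: le_trans (addr_ge0 p1 p2) _; rewrite le_eqVlt; apply/orP; left; apply/eqP.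
rewrite addoE oppoE idoE rdotDl rdotNl (hy (G i j.+1 x)) (hy (G i j x)) !GE.
rewrite -[j.+1%:R]natr1 -[i.+1%:R]natr1 !hy.
move: (n%:R : R) (i%:R : R) (j%:R : R) => rn ri rj; ring.
Qed.

(** A substitute for the spectral theorem: W is positive as soon as, near every
    possible spectral value t of Y, it is positive up to an error that is
    quadratic in Y - t. Apply localize_step with y = (Y - m) / (M - m) and the
    points t = m + (M - m) j / n: what remains is eta plus K times a variance
    of order 1 / n. *)
Lemma localize H (W Y : bop H H) (m M : R) : m < M -> herm W ->
  (m%:C *: id_bop H <= Y)%OP -> (Y <= M%:C *: id_bop H)%OP ->
  opcomm W Y ->
  (forall eta : R, 0 < eta -> exists2 K : R, 0 <= K & forall t, m <= t <= M ->
    forall x, 0 <= rdot (W x) x + eta * rdot x x +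
      K * rdot (Y x - t%:C *: x) (Y x - t%:C *: x)) ->
  forall x, 0 <= rdot (W x) x.
Proof.
move=> mM hW /op_geC[hY mY] /op_leC[_ YM] WY h x.
have L0 : 0 < M - m by rewrite subr_gt0.
pose y : bop H H := ((M - m)^-1)%:C *: (Y - m%:C *: id_bop H).
have hy : herm y by apply/hermZ/hermD/hermN/hermZ => //; exact: herm1.
have yE z : Y z = (M - m)%:C *: y z + m%:C *: z.
  by rewrite !bopE scalerA -rmorphM divff ?gt_eqF// scale1r subrK.
have yq z : rdot (y z) z = (M - m)^-1 * (rdot (Y z) z - m * rdot z z).
  by rewrite !bopE !rdotE.
have y0 z : 0 <= rdot (y z) z.
  by rewrite yq mulr_ge0 ?invr_ge0 ?(ltW L0)// subr_ge0.
have y1 z : rdot (y z) z <= rdot z z.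
  by rewrite yq mulrC ler_pdivrMr// lerBlDr mulrC -mulrDl subrK.
have Wy : opcomm W y.
  by apply: opcomm_sym; rewrite /y; commute.
apply/ler_addgt0Pr => e e0.
have n0 : 0 < rdot x x + 1 by rewrite ltr_wpDl ?rdot_ge0.
have [|K K0 hK] := h (e / 2 / (rdot x x + 1)); first by rewrite !divr_gt0.
pose C := K * (M - m) ^+ 2 * rdot (y (x - y x)) x.
have e2 : 0 < e / 2 by lra.
have [n hn] : exists n : nat, C / n.+1%:R <= e / 2.
  have C1 : 0 < `|C| + 1 by rewrite ltr_wpDl.
  have [|N /(_ N (leqnn _)) hN] := @inv_small R (e / 2 / (`|C| + 1)); first by rewrite divr_gt0.
  exists N; apply: le_trans (_ : (`|C| + 1) * N.+1%:R^-1 <= _).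
    by rewrite ler_wpM2r ?invr_ge0// ler_wpDr// ler_norm.
  by rewrite mulrC -ler_pdivlMr// ltW.
have nn : (n.+1%:R : R) != 0 by rewrite pnatr_eq0.
have := @localize_step _ W y (e / 2 / (rdot x x + 1)) (K * (M - m) ^+ 2 / n.+1%:R ^+ 2) n.+1
  hW hy Wy y0 y1 _ x.
have -> : K * (M - m) ^+ 2 / n.+1%:R ^+ 2 * n.+1%:R * rdot (y (x - y x)) x = C / n.+1%:R.
  by rewrite /C; field; rewrite addrC natr1.
move=> hloc; apply: le_trans (hloc _) _ => [j jn z|].
  pose t := m + (M - m) * (j%:R / n.+1%:R).
  have jn1 : 0 <= (j%:R / n.+1%:R : R) <= 1.
    by rewrite divr_ge0// ler_pdivrMr ?ltr0n// mul1r ler_nat.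
  have tmM : m <= t <= M.
    move/andP: jn1 => [j0 j1]; rewrite /t lerDl mulr_ge0 ?(ltW L0)//=.
    by rewrite -lerBrDl ler_piMr ?(ltW L0).
  have := hK t tmM z; rewrite yE.
  have -> : (M - m)%:C *: y z + m%:C *: z - t%:C *: z =
    ((M - m) / n.+1%:R)%:C *: (n.+1%:R%:C *: y z - j%:R%:C *: z).
    rewrite scalerBr !scalerA -!rmorphM divfK// -addrA -scalerBl -rmorphB.
    congr (_ + _); rewrite -scaleNr -rmorphN; congr (_%:C *: _).
    by rewrite /t; field; rewrite addrC natr1.
  rewrite !rdotZl !rdotZr.
  set q := rdot _ (_ *: y z - _); set w := rdot _ _; set z2 := rdot z z.
  have -> : K * ((M - m) / n.+1%:R * ((M - m) / n.+1%:R * q)) =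
    K * (M - m) ^+ 2 / n.+1%:R ^+ 2 * q by field; rewrite addrC natr1.
  by [].
rewrite -addrA lerD2l.
have h1 : e / 2 / (rdot x x + 1) * rdot x x <= e / 2.
  rewrite -(mulrA (e / 2)) ler_piMr ?(ltW e2)//.
  by rewrite mulrC ler_pdivrMr// mul1r lerDl.
by move: hn h1; move: (C / _) (e / 2 / _ * _) => u v; lra.
Qed.

End CommutingPositive.

Section ChordBound.
Context {R : realType}.
Implicit Types H : hilbertSpace R.

(** If G dominates f(Y), in the local sense that localize can use, and
    t Q + V <= f(t) P for every t in the range of Y, then Q Y + V <= P G:
    near the spectral value t of Y the left side is t Q + V, which is at most
    f(t) P, and f(t) P is at most P G. *)
Lemma chord_bound H (P G Y Q V : bop H H) (m M : R) (f : R -> R) : m < M ->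
  (m%:C *: id_bop H <= Y)%OP -> (Y <= M%:C *: id_bop H)%OP ->
  herm P -> herm G -> herm Q -> herm V ->
  (forall x, 0 <= rdot (P x) x) ->
  opcomm P Y -> opcomm G Y -> opcomm Q Y -> opcomm V Y -> opcomm P G ->
  (forall eta : R, 0 < eta -> exists2 K : R, 0 <= K & forall t, m <= t <= M ->
    forall x, f t * rdot x x <= (1 + eta) * rdot (G x) x +
      K * rdot (G (Y x - t%:C *: x)) (Y x - t%:C *: x)) ->
  (forall t, m <= t <= M -> forall x,
    t * rdot (Q x) x + rdot (V x) x <= f t * rdot (P x) x) ->
  forall x, rdot (Q (Y x)) x + rdot (V x) x <= rdot (P (G x)) x.
Proof.
move=> mM mY YM hP hG hQ hV P0 PY GY QY VY PG hfG hPQ.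
have hY : herm Y := herm_geC mY.
pose W : bop H H := (P ** G)%OP - (Q ** Y)%OP - V.
have hW : herm W by apply/hermD/hermN => //; apply/hermD/hermN; exact: hermM.
have WY : opcomm W Y by rewrite /W; commute.
suff W0 x : 0 <= rdot (W x) x by move=> x; have := W0 x; rewrite !bopE !rdotE; lra.
move: x; apply: (localize mM hW mY YM WY) => eta eta0.
have [c c0 hc] := bop_form_bound (P ** G)%OP; have [d d0 hd] := bop_bound Q.
have PGc x : rdot (P (G x)) x <= c * rdot x x := hc x.
have Qd x u : rdot (Q u) x <= eta / 2 * rdot x x + d ^+ 2 / (2 * eta) * rdot u u.
  apply: le_trans (rdot_le_nrm _ _) _.
  apply: le_trans (ler_wpM2r (nrm_ge0 x) (hd u)) _; rewrite -!sqr_nrm -subr_ge0.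
  have -> : eta / 2 * nrm x ^+ 2 + d ^+ 2 / (2 * eta) * nrm u ^+ 2 - d * nrm u * nrm x =
    (eta * nrm x - d * nrm u) ^+ 2 / (2 * eta) by field; rewrite gt_eqF.
  by rewrite divr_ge0 ?sqr_ge0// mulr_ge0// ltW.
have e0 : 0 < eta / (2 * c) by rewrite divr_gt0// mulr_gt0.
have [K K0 hK] := hfG _ e0.
exists (K * c + d ^+ 2 / (2 * eta)) => [|t tmM x].
  apply: addr_ge0; first by rewrite mulr_ge0// ltW.
  by rewrite divr_ge0 ?sqr_ge0// mulr_ge0// ltW.
set u := Y x - t%:C *: x.
pose Z : bop H H := Y - t%:C *: id_bop H.
have hZ : herm Z by apply/hermD/hermN/hermZ => //; exact: herm1.
have GZ : opcomm G Z by rewrite /Z; commute.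
have PZ : opcomm P Z by rewrite /Z; commute.
have uE : u = Z x by [].
have ZE y : Y y - t%:C *: y = Z y by [].
clearbody Z.
pose E : bop H H := (1 + eta / (2 * c))%:C *: G + K%:C *: (Z ** (G ** Z))%OP -
  (f t)%:C *: id_bop H.
have hE : herm E.
  apply/hermD/hermN/hermZ; last exact: herm1.
  apply/hermD; apply/hermZ => //.
  by move=> y z; rewrite !compoE hZ hG hZ.
have EE y : E y = (1 + eta / (2 * c))%:C *: G y + K%:C *: Z (G (Z y)) - (f t)%:C *: y by [].
have E0 y : 0 <= rdot (E y) y.
  have h : f t * rdot y y <= (1 + eta / (2 * c)) * rdot (G y) y +
    K * rdot (G (Z y)) (Z y) by rewrite -ZE; exact: hK.
  by rewrite EE !rdotE hZ; move: (1 + _) h => r; lra.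
have PE : opcomm P E by rewrite /E; commute.
have := positive_mul hP hE P0 E0 PE x.
have -> : rdot (P (E x)) x = (1 + eta / (2 * c)) * rdot (P (G x)) x +
    K * rdot (P (G u)) u - f t * rdot (P x) x.
  by rewrite EE uE bopD bopN bopD !bopZ !rdotE PZ hZ.
have h1 := hPQ t tmM x; have h2 := PGc u; have h3 := PGc x; have h4 := Qd x u.
have h5 := ler_wpM2l K0 h2; have h6 := ler_wpM2l (ltW e0) h3.
have h7 : eta / (2 * c) * (c * rdot x x) = eta / 2 * rdot x x.
  by field; rewrite gt_eqF.
have -> : rdot (W x) x = rdot (P (G x)) x - (rdot (Q u) x + t * rdot (Q x) x) - rdot (V x) x.
  by rewrite !bopE !rdotE; ring.
rewrite -/u; rewrite h7 in h6; move: h1 h4 h5 h6.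
move: (eta / (2 * c)) (d ^+ 2 / (2 * eta)) => r1 r2; lra.
Qed.

End ChordBound.

(** * The mean of the identity and an operator *)

Section MeanCalculus.
Context {R : realType}.
Implicit Types H : hilbertSpace R.
Context (sigma : forall H : hilbertSpace R, bop H H -> bop H H -> bop H H).
Context (hsigma : operator_mean sigma).
Context (f : R -> R) (hf : representing_function sigma f).

Lemma conj_ge H (A C Ci : bop H H) (a : R) : 0 < a -> (a%:C *: id_bop H <= A)%OP ->
  (Ci ** C = id_bop H)%OP ->
  exists2 b : R, 0 < b & (b%:C *: id_bop H <= C^* ** A ** C)%OP.
Proof.
move=> a0 /op_geC[hA aA] CiC; have [c c0 hc] := bop_bound2 Ci.
exists (a / c); first by rewrite divr_gt0.
apply/op_geC; split; first exact: herm_conj.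
move=> x; rewrite !compoE adjointC; apply: le_trans (aA _).
rewrite mulrAC ler_pdivrMr// -mulrA ler_pM2l// mulrC.
by apply: le_trans (hc _); rewrite -!compoE CiC.
Qed.

(** The transformer inequality for an invertible C, used for C and for its
    inverse, is an equality. *)
Lemma mean_conj H (A B C Ci : bop H H) (a b : R) :
  0 < a -> (a%:C *: id_bop H <= A)%OP -> 0 < b -> (b%:C *: id_bop H <= B)%OP ->
  (C ** Ci = id_bop H)%OP -> (Ci ** C = id_bop H)%OP ->
  (C^* ** sigma A B ** C = sigma (C^* ** A ** C) (C^* ** B ** C))%OP.
Proof.
move=> a0 aA b0 bB CCi CiC.
have [a' a'0 aA'] := conj_ge a0 aA CiC; have [b' b'0 bB'] := conj_ge b0 bB CiC.
have sA := strictly_positiveI a0 aA; have sB := strictly_positiveI b0 bB.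
have sA' := strictly_positiveI a'0 aA'; have sB' := strictly_positiveI b'0 bB'.
apply: op_le_anti; first exact: (mean_transformer hsigma).
have back X : (Ci^* ** (C^* ** X ** C) ** Ci = X)%OP.
  apply: bop_ext => x; rewrite !compoE -[C (Ci x)]compoE CCi idoE.
  by rewrite -[Ci^*%OP _]compoE -adjointM CCi (adjoint_herm (@herm1 _ H)).
have forth X : (C^* ** (Ci^* ** X ** Ci) ** C = X)%OP.
  apply: bop_ext => x; rewrite !compoE -[Ci (C x)]compoE CiC idoE.
  by rewrite -[C^*%OP _]compoE -adjointM CiC (adjoint_herm (@herm1 _ H)).
rewrite -[X in (X <= _)%OP]forth; apply: op_le_conj.
have := mean_transformer hsigma (C := Ci) sA' sB'; rewrite !back; exact.
Qed.

Lemma mean_ge0 H (A B : bop H H) (a b : R) :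
  0 < a -> (a%:C *: id_bop H <= A)%OP -> 0 < b -> (b%:C *: id_bop H <= B)%OP ->
  herm (sigma A B) /\ forall x, 0 <= rdot (sigma A B x) x.
Proof.
move=> a0 /(strictly_positiveI a0) sA b0 /(strictly_positiveI b0) sB.
by have [/positive_opP] := mean_strictly_positive hsigma sA sB.
Qed.

Lemma id_geC H : ((1 : R)%:C *: id_bop H <= id_bop H)%OP.
Proof. by rewrite scale1r; exact: op_le_refl. Qed.

Lemma scale_geC H (s : R) : (s%:C *: id_bop H <= s%:C *: id_bop H)%OP.
Proof. exact: op_le_refl. Qed.

(** C = 1 + iX and its adjoint give the same pair (1 + X^2, X + X^3), so
    C^* F C = C F C^* for F = 1 sigma X, which says that F X = X F. *)
Lemma mean_comm H (X : bop H H) (b : R) : 0 < b -> (b%:C *: id_bop H <= X)%OP ->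
  opcomm (sigma (id_bop H) X) X.
Proof.
move=> b0 bX; have hX := herm_geC bX.
pose C : bop H H := id_bop H + 'i *: X; pose C' : bop H H := id_bop H - 'i *: X.
have CC' : (C^* = C')%OP.
  by apply: adjoint_unique => x y; rewrite !bopE !rdotE rdot_i hX bopZ.
have C'C : (C'^* = C)%OP.
  by apply: adjoint_unique => x y; rewrite !bopE !rdotE rdot_i hX bopZ opprK.
pose P : bop H H := id_bop H + (X ** X)%OP.
have EC : (C ** C' = P)%OP.
  apply: bop_ext => x; rewrite !bopE scalerA -expr2 sqr_i scaleN1r.
  by rewrite opprK !addrA subrK.
have EC' : (C' ** C = P)%OP.
  apply: bop_ext => x; rewrite !bopE scalerA -expr2 sqr_i scaleN1r.
  by rewrite opprD opprK !addrA addrK.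
have [B [PB BP hB]] : exists B : bop H H,
    [/\ (P ** B = id_bop H)%OP, (B ** P = id_bop H)%OP & herm B].
  apply: (@positive_inverse _ _ _ 1) => //; apply/op_geC; split.
    by apply: hermD; [exact: herm1 | exact: hermM].
  by move=> x; rewrite !bopE !rdotE mul1r lerDl hX rdot_ge0.
have compA (U V W : bop H H) : (U ** (V ** W) = U ** V ** W)%OP by exact: bop_ext.
have comp1 (U : bop H H) : (U ** id_bop H = U)%OP by exact: bop_ext.
have comp1l (U : bop H H) : (id_bop H ** U = U)%OP by exact: bop_ext.
have inv_of U V : (U ** V = P)%OP -> (V ** U = P)%OP ->
    (U ** (V ** B) = id_bop H)%OP /\ ((V ** B) ** U = id_bop H)%OP.
  move=> UV VU; split; first by rewrite compA UV.
  have -> : (V ** B = B ** V)%OP.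
    rewrite -[LHS]comp1l -BP -VU -[RHS]comp1 -PB -UV !compA.
    by rewrite -!compA.
  by rewrite -compA VU.
have [i1 i2] := inv_of _ _ EC EC'; have [j1 j2] := inv_of _ _ EC' EC.
have := mean_conj ltr01 (@id_geC H) b0 bX i1 i2.
have := mean_conj ltr01 (@id_geC H) b0 bX j1 j2.
rewrite CC' C'C !comp1 EC EC'.
have -> : (C ** X ** C' = C' ** X ** C)%OP.
  apply: bop_ext => x; apply: rdot_inj => z; rewrite !bopE !rdotE; lra.
move=> <- h x; apply: rdot_inj => z.
have := congr1 (fun T : bop H H => rdot (T x) ('i *: z)) h.
by rewrite !bopE !rdotE !rdot_iZ; lra.
Qed.

End MeanCalculus.

Section MeanBounds.
Context {R : realType}.
Implicit Types H : hilbertSpace R.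
Context (sigma : forall H : hilbertSpace R, bop H H -> bop H H -> bop H H).
Context (hsigma : operator_mean sigma).
Context (f : R -> R) (hf : representing_function sigma f).

(** Every pair (P, Q) is S (1, X) S with S the square root of P, which moves
    the mean of P and Q to the one of 1 and X. *)
Lemma mean_factor H (P Q : bop H H) (p q : R) :
  0 < p -> (p%:C *: id_bop H <= P)%OP -> 0 < q -> (q%:C *: id_bop H <= Q)%OP ->
  exists S X : bop H H, exists2 b : R, 0 < b & [/\ herm S,
    (b%:C *: id_bop H <= X)%OP,
    [/\ P = (S ** S)%OP, Q = (S ** X ** S)%OP &
        sigma P Q = (S ** sigma (id_bop H) X ** S)%OP] &
    forall r : R,
      ((r%:C *: P <= Q)%OP -> (r%:C *: id_bop H <= X)%OP) /\
      ((Q <= r%:C *: P)%OP -> (X <= r%:C *: id_bop H)%OP)].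
Proof.
move=> p0 pP q0 qQ; have hQ := herm_geC qQ.
have [S [s s0 [sS SS _]]] := sqrt_op p0 pP; have hS := herm_geC sS.
have [Si [SSi SiS hSi]] := positive_inverse s0 sS.
have E1 x : S (Si x) = x by rewrite -compoE SSi.
have E2 x : Si (S x) = x by rewrite -compoE SiS.
pose X : bop H H := (Si ** Q ** Si)%OP.
have [b b0 bX] : exists2 b : R, 0 < b & (b%:C *: id_bop H <= X)%OP.
  by have := conj_ge q0 qQ SSi; rewrite (adjoint_herm hSi).
have hX := herm_geC bX.
have PE : P = (S ** id_bop H ** S)%OP by rewrite -SS; exact: bop_ext.
have QE : Q = (S ** X ** S)%OP by apply: bop_ext => x; rewrite !compoE E1 E2.
exists S, X, b; first exact: b0.
split; [exact: hS | exact: bX | |].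
  split; [exact/esym | exact: QE |]; rewrite [in LHS]PE [in LHS]QE.
  have := mean_conj hsigma ltr01 (@id_geC R H) b0 bX SSi SiS.
  by rewrite (adjoint_herm hS) => <-.
move=> r; split=> /op_leP[_ h].
  apply/op_geC; split=> // x; have := h (Si x).
  by rewrite -SS !bopE !rdotE E1 -!hSi E2.
apply/op_leC; split=> // x; have := h (Si x).
by rewrite -SS !bopE !rdotE E1 -!hSi E2.
Qed.

(** D = S 1 S and s D = S (s 1) S for the square root S of D. *)
Lemma mean_scale H (D : bop H H) (d s : R) : 0 < d ->
  (d%:C *: id_bop H <= D)%OP -> 0 < s -> sigma D (s%:C *: D) = (f s)%:C *: D.
Proof.
move=> d0 dD s0.
have [S [r r0 [rS SS _]]] := sqrt_op d0 dD; have hS := herm_geC rS.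
have [Si [SSi SiS _]] := positive_inverse r0 rS.
have := mean_conj hsigma ltr01 (@id_geC R H) s0 (@scale_geC R H s) SSi SiS.
rewrite (adjoint_herm hS) hf//.
have scal t : (S ** (t%:C *: id_bop H) ** S)%OP = t%:C *: D.
  by apply: bop_ext => x; rewrite -SS !bopE.
have -> : (S ** id_bop H ** S)%OP = D by rewrite -SS; exact: bop_ext.
by rewrite !scal => <-.
Qed.

(** Completing the square in 2 K m u + x. *)
Lemma quad_absorb H (x u : H) (eta K m : R) : 0 < K -> 0 < m ->
  1 <= 4 * eta * K * m ^+ 2 ->
  0 <= K * m * rdot u u + rdot u x + eta * m * rdot x x.
Proof.
move=> K0 m0 hK; have Km : 0 < 4 * (K * m) by rewrite !mulr_gt0.
rewrite -(pmulr_rge0 _ Km).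
have -> : 4 * (K * m) * (K * m * rdot u u + rdot u x + eta * m * rdot x x) =
  rdot ((2 * (K * m))%:C *: u + x) ((2 * (K * m))%:C *: u + x) +
  (4 * eta * K * m ^+ 2 - 1) * rdot x x by rewrite !rdotE (rdotC x); ring.
by rewrite addr_ge0 ?rdot_ge0// mulr_ge0 ?rdot_ge0// subr_ge0.
Qed.

(** The operator D = 1 + eta + K (X - s)^2 satisfies 1 <= D and s <= D X, so
    that f s = 1 sigma s <= D sigma (D X) = D (1 sigma X); it is close to 1 on
    the part of the space where X is close to s. *)
Lemma mean_lower H (X : bop H H) (m s eta K : R) : 0 < m ->
  (m%:C *: id_bop H <= X)%OP -> 0 < s -> 0 < eta -> 0 < K ->
  1 <= 4 * eta * K * m ^+ 2 -> forall x,
  f s * rdot x x <= (1 + eta) * rdot (sigma (id_bop H) X x) x +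
    K * rdot (sigma (id_bop H) X (X x - s%:C *: x)) (X x - s%:C *: x).
Proof.
move=> m0 mX s0 eta0 K0 hK x; have [hX mX'] := iffLR (op_geC _ _) mX.
set F := sigma (id_bop H) X; have FX : opcomm F X := mean_comm hsigma m0 mX.
have [hF F0] := mean_ge0 hsigma ltr01 (@id_geC R H) m0 mX.
pose Z : bop H H := X - s%:C *: id_bop H.
have hZ : herm Z by apply/hermD/hermN/hermZ => //; exact: herm1.
have FZ : opcomm F Z by rewrite /Z; commute.
have ZX : opcomm Z X by rewrite /Z; commute.
have ZE y : X y - s%:C *: y = Z y by [].
rewrite ZE; clearbody Z.
pose D : bop H H := (1 + eta)%:C *: id_bop H + K%:C *: (Z ** Z)%OP.
have hD : herm D.
  by apply/hermD; apply/hermZ; [exact: herm1 | exact: hermM].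
have DE y : D y = (1 + eta)%:C *: y + K%:C *: Z (Z y) by [].
have DX : opcomm D X by rewrite /D; commute.
have DF : opcomm D F by apply: opcomm_sym; rewrite /D; commute.
clearbody D.
have D1 : ((1 : R)%:C *: id_bop H <= D)%OP.
  apply/op_geC; split=> // y; rewrite DE !rdotE hZ mul1r mulrDl mul1r -addrA lerDl.
  by rewrite addr_ge0 ?mulr_ge0 ?rdot_ge0// ltW.
have [S [r r0 [rS SS Scomm]]] := sqrt_op ltr01 D1; have hS := herm_geC rS.
have [Si [SSi SiS _]] := positive_inverse r0 rS.
have SF : opcomm S F := Scomm _ DF; have SX : opcomm S X := Scomm _ DX.
have SSE y : S (S y) = D y by rewrite -SS.
have := mean_conj hsigma ltr01 (@id_geC R H) m0 mX SSi SiS.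
rewrite (adjoint_herm hS).
have -> : (S ** id_bop H ** S)%OP = D by rewrite -SS; exact: bop_ext.
have -> : (S ** X ** S = D ** X)%OP.
  by apply: bop_ext => y; rewrite !compoE -SX SSE.
have -> : (S ** sigma (id_bop H) X ** S = D ** F)%OP.
  by apply: bop_ext => y; rewrite !compoE -SF SSE.
have hDX : herm (D ** X)%OP by exact: hermM.
have sDX : (s%:C *: id_bop H <= D ** X)%OP.
  apply/op_geC; split=> // y; rewrite compoE DE.
  have h1 := mX' y; have h2 := mX' (Z y).
  have h3 := quad_absorb y (Z y) K0 m0 hK.
  rewrite !rdotE hZ ZX.
  have -> : rdot (X y) y = rdot (Z y) y + s * rdot y y by rewrite -ZE !rdotE; ring.
  have h4 := ler_wpM2l (ltW eta0) h1; have h5 := ler_wpM2l (ltW K0) h2.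
  have h6 : rdot (X y) y = rdot (Z y) y + s * rdot y y by rewrite -ZE !rdotE; ring.
  rewrite h6 in h4; nra.
move=> eDF.
have /op_leP[_ /(_ x)] : (sigma (id_bop H) (s%:C *: id_bop H) <= D ** F)%OP.
  rewrite eDF; apply: (mean_monotone hsigma) => //.
  - exact: strictly_positiveI ltr01 (@id_geC R H).
  - exact: strictly_positiveI ltr01 D1.
  - exact: strictly_positiveI s0 (@scale_geC R H s).
  - exact: strictly_positiveI s0 sDX.
  - by have := D1; rewrite scale1r.
rewrite hf// scaleoE idoE compoE DF rdotZl => /le_trans; apply.
by rewrite DE bopD !bopZ !FZ !rdotE hZ.
Qed.

(** With the same D, now X <= s D and 1 <= D, so that
    1 sigma X <= D sigma (s D) = f(s) D. *)
Lemma mean_upper H (X : bop H H) (m s eta K : R) : 0 < m ->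
  (m%:C *: id_bop H <= X)%OP -> 0 < s -> 0 < eta -> 0 < K ->
  1 <= 4 * eta * K * s ^+ 2 -> forall x,
  rdot (sigma (id_bop H) X x) x <= f s * ((1 + eta) * rdot x x +
    K * rdot (X x - s%:C *: x) (X x - s%:C *: x)).
Proof.
move=> m0 mX s0 eta0 K0 hK x; have [hX mX'] := iffLR (op_geC _ _) mX.
pose Z : bop H H := X - s%:C *: id_bop H.
have hZ : herm Z by apply/hermD/hermN/hermZ => //; exact: herm1.
have ZE y : X y - s%:C *: y = Z y by [].
rewrite ZE; clearbody Z.
pose D : bop H H := (1 + eta)%:C *: id_bop H + K%:C *: (Z ** Z)%OP.
have hD : herm D.
  by apply/hermD; apply/hermZ; [exact: herm1 | exact: hermM].
have DE y : D y = (1 + eta)%:C *: y + K%:C *: Z (Z y) by [].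
clearbody D.
have Dq y : rdot (D y) y = (1 + eta) * rdot y y + K * rdot (Z y) (Z y).
  by rewrite DE !rdotE hZ.
have D1 : ((1 : R)%:C *: id_bop H <= D)%OP.
  apply/op_geC; split=> // y; rewrite Dq mul1r mulrDl mul1r -addrA lerDl.
  by rewrite addr_ge0 ?mulr_ge0 ?rdot_ge0// ltW.
rewrite -Dq.
have XD : (X <= s%:C *: D)%OP.
  apply: op_le_herm => // [|y]; first exact: hermZ.
  rewrite scaleoE rdotZl Dq.
  have -> : X y = Z y + s%:C *: y by rewrite -ZE subrK.
  have := quad_absorb y (- Z y) K0 s0 hK; rewrite !rdotE; lra.
have sD : ((s * 1)%:C *: id_bop H <= s%:C *: D)%OP.
  by rewrite rmorphM -scalerA; apply: op_leZ => //; exact: ltW.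
have /op_leP[_ /(_ x)] : (sigma (id_bop H) X <= sigma D (s%:C *: D))%OP.
  apply: (mean_monotone hsigma) => //.
  - exact: strictly_positiveI ltr01 (@id_geC R H).
  - exact: strictly_positiveI ltr01 D1.
  - exact: strictly_positiveI m0 mX.
  - by apply: strictly_positiveI sD; rewrite mulr1.
  - by have := D1; rewrite scale1r.
by rewrite (mean_scale ltr01 D1 s0) scaleoE rdotZl.
Qed.

(** Together the two bounds say that 1 sigma X is f(X), without a functional
    calculus: up to eta it equals f t where X is close to t. The constant K is
    the least one allowed in mean_lower and mean_upper for all t >= m. *)
Lemma mean_local H (X : bop H H) (m M : R) : 0 < m ->
  (m%:C *: id_bop H <= X)%OP ->
  forall eta : R, 0 < eta -> exists2 K : R, 0 <= K & forall t, m <= t <= M ->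
  forall x,
   (f t * rdot x x <= (1 + eta) * rdot (sigma (id_bop H) X x) x +
    K * rdot (sigma (id_bop H) X (X x - t%:C *: x)) (X x - t%:C *: x)) /\
   (rdot (sigma (id_bop H) X x) x <= f t * ((1 + eta) * rdot x x +
    K * rdot (X x - t%:C *: x) (X x - t%:C *: x))).
Proof.
move=> m0 mX eta eta0; pose K := (4 * eta * m ^+ 2)^-1.
have K0 : 0 < K by rewrite invr_gt0 !mulr_gt0 ?exprn_gt0.
have hK : 4 * eta * K * m ^+ 2 = 1 by rewrite /K; field; rewrite !gt_eqF.
exists K; first exact: ltW.
move=> t /andP[mt tM] x; have t0 := lt_le_trans m0 mt; split.
  by apply: (mean_lower m0 mX) => //; rewrite hK.
apply: (mean_upper m0 mX) => //; rewrite -[leLHS]hK.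
apply: ler_wpM2l; first by rewrite ltW// !mulr_gt0.
by rewrite (@ler_pXn2r _ 2) ?nnegrE ?(ltW m0) ?(ltW t0).
Qed.

(** Where X is close to t the mean is close to f t <= a t + b, which is close
    to a X + b. *)
Lemma mean_le_line1 H (X : bop H H) (m M a b : R) : 0 < m -> m < M ->
  (m%:C *: id_bop H <= X)%OP -> (X <= M%:C *: id_bop H)%OP ->
  (forall t, m <= t <= M -> f t <= a * t + b) ->
  forall x, rdot (sigma (id_bop H) X x) x <= a * rdot (X x) x + b * rdot x x.
Proof.
move=> m0 mM mX XM fab; have hX := herm_geC mX.
have [hF _] := mean_ge0 hsigma ltr01 (@id_geC R H) m0 mX.
have FX := mean_comm hsigma m0 mX.
set F := sigma _ _ in hF FX *.
pose W : bop H H := a%:C *: X + b%:C *: id_bop H - F.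
have hW : herm W.
  by apply/hermD/hermN => //; apply/hermD; apply/hermZ => //; exact: herm1.
have WX : opcomm W X by rewrite /W; commute.
have WE x : rdot (W x) x = a * rdot (X x) x + b * rdot x x - rdot (F x) x.
  by rewrite !bopE !rdotE.
suff W0 x : 0 <= rdot (W x) x by move=> x; have := W0 x; rewrite WE subr_ge0.
clearbody W; move: x; apply: (localize mM hW mX XM WX) => eta eta0.
pose c := `|a| * M + `|b| + 1.
have M0 : 0 < M := lt_trans m0 mM.
have c0 : 0 < c by rewrite ltr_wpDl// addr_ge0// mulr_ge0// ltW.
have fc t : m <= t <= M -> f t <= c.
  move=> tmM; apply: le_trans (fab t tmM) _; rewrite /c.
  have : a * t <= `|a| * M.
    apply: le_trans (ler_norm _) _; rewrite normrM ler_wpM2l//.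
    by move/andP: tmM => [h1 h2]; rewrite ger0_norm// ltW// (lt_le_trans m0).
  by have := ler_norm b; lra.
have e0 : 0 < eta / (2 * c) by rewrite divr_gt0// mulr_gt0.
have [K K0 hK] := mean_local M m0 mX e0.
exists (c * K + a ^+ 2 / (2 * eta)) => [|t tmM x].
  apply: addr_ge0; first by rewrite mulr_ge0// ltW.
  by rewrite divr_ge0 ?sqr_ge0// mulr_ge0// ltW.
have [_] := hK t tmM x; rewrite -/F WE; set u := X x - t%:C *: x.
have -> : X x = u + t%:C *: x by rewrite subrK.
move=> h1; have h2 := fc t tmM; have h3 := fab t tmM.
have q0 := rdot_ge0 x; have u0 := rdot_ge0 u.
have h4 : - (a * rdot u x) <= eta / 2 * rdot x x + a ^+ 2 / (2 * eta) * rdot u u.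
  rewrite -subr_ge0.
  have -> : eta / 2 * rdot x x + a ^+ 2 / (2 * eta) * rdot u u - - (a * rdot u x) =
    rdot (eta%:C *: x + a%:C *: u) (eta%:C *: x + a%:C *: u) / (2 * eta).
    by rewrite !rdotE (rdotC x); field; rewrite gt_eqF.
  by rewrite divr_ge0 ?rdot_ge0// mulr_ge0// ltW.
have h5 : f t * (eta / (2 * c) * rdot x x + K * rdot u u) <=
  c * (eta / (2 * c) * rdot x x + K * rdot u u).
  by rewrite ler_wpM2r// addr_ge0// mulr_ge0// ltW.
have h6 : c * (eta / (2 * c) * rdot x x + K * rdot u u) =
  eta / 2 * rdot x x + c * K * rdot u u by field; rewrite gt_eqF.
have h7 := ler_wpM2r q0 h3; rewrite h6 in h5.
rewrite [rdot (u + _) x]rdotDl rdotZl.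
move: h1 h4 h5 h7; move: (eta / (2 * c)) (a ^+ 2 / (2 * eta)) => r1 r2; lra.
Qed.

Lemma mean_le_line H (P Q : bop H H) (p q m M a b : R) :
  0 < p -> (p%:C *: id_bop H <= P)%OP -> 0 < q -> (q%:C *: id_bop H <= Q)%OP ->
  0 < m -> m < M -> (m%:C *: P <= Q)%OP -> (Q <= M%:C *: P)%OP ->
  (forall t, m <= t <= M -> f t <= a * t + b) ->
  (sigma P Q <= a%:C *: Q + b%:C *: P)%OP.
Proof.
move=> p0 pP q0 qQ m0 mM mPQ QMP fab.
have [S [X [r r0 [hS rX [PE QE sE] hr]]]] := mean_factor p0 pP q0 qQ.
have [hs _] := mean_ge0 hsigma p0 pP q0 qQ.
apply: op_le_herm => //.
  by apply: hermD; apply: hermZ; [exact: herm_geC qQ | exact: herm_geC pP].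
move=> x; rewrite sE {1}QE {1}PE.
have := mean_le_line1 m0 mM ((hr m).1 mPQ) ((hr M).2 QMP) fab (S x).
by rewrite addoE !scaleoE !compoE !rdotE !hS.
Qed.

End MeanBounds.

(** * Tensor products of operators *)

Section DenseSpan.
Context {R : realType}.
Implicit Types H K : hilbertSpace R.

Lemma dense_orth H (S : set H) (u : H) : dense (lin_span S) ->
  (forall v, S v -> hdot v u = 0) -> u = 0.
Proof.
move=> dS uS; apply: nrm_small_eq0 => e e0.
have [_ [n [a [v [vS ->]]]] hd] := dense_approx dS u e0.
set d := \sum_(i < n) _ in hd.
have du : rdot u d = 0.
  rewrite rdotC /rdot /d; elim/big_ind: _ => [|x y hx hy|i _].
  - by rewrite hdot0l.
  - by rewrite hdotDl cReD hx hy addr0.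
  - by rewrite hdotZl uS// mulr0.
apply: le_trans (ltW hd); rewrite -(@ler_pXn2r _ 2) ?nnegrE ?nrm_ge0//.
rewrite !sqr_nrm !rdotE (rdotC d) du; have := rdot_ge0 d; lra.
Qed.

Lemma dense_sub H (S S' : set H) : (forall x, S x -> S' x) -> dense S -> dense S'.
Proof.
move=> SS' dS O O0 oO; have [x [Ox Sx]] := dS O O0 oO.
by exists x; split=> //; exact: SS'.
Qed.

Lemma bop_dense_eq H K (S : set H) (A B : bop H K) : dense (lin_span S) ->
  (forall v, S v -> A v = B v) -> A = B.
Proof.
move=> dS AB; apply: bop_ext => x; apply/eqP; rewrite -subr_eq0; apply/eqP.
have [c c0 hc] := bop_bound (A - B).
apply: nrm_small_eq0 => e e0; have ec : 0 < e / c by rewrite divr_gt0.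
have [_ [n [a [v [vS ->]]]] hd] := dense_approx dS x ec.
set d := \sum_(i < n) _ in hd.
have dE : (A - B) d = 0.
  rewrite /d; elim/big_ind: _ => [|y z hy hz|i _].
  - by rewrite bop0.
  - by rewrite bopD hy hz addr0.
  - by rewrite bopZ !bopE AB// subrr scaler0.
have -> : A x - B x = (A - B) (x - d) by rewrite bopD bopN dE subr0.
by apply: le_trans (hc _) _; rewrite mulrC -ler_pdivlMr// ltW.
Qed.

(** Two families with the same Gram matrix: combinations with the same
    coefficients have the same inner products, whatever the relations. *)
Lemma hdot_sum2 H K (I J : Type) (r : seq I) (s : seq J) (F : I -> H) (G : J -> H)
    (F' : I -> K) (G' : J -> K) :
  (forall i j, hdot (F i) (G j) = hdot (F' i) (G' j)) ->
  hdot (\sum_(i <- r) F i) (\sum_(j <- s) G j) =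
  hdot (\sum_(i <- r) F' i) (\sum_(j <- s) G' j).
Proof.
move=> FG; elim: r => [|i r IH]; first by rewrite !big_nil !hdot0l.
rewrite !big_cons !hdotDl IH; congr (_ + _).
elim: s {IH} => [|j s IH]; first by rewrite !big_nil hdotC hdot0l [RHS]hdotC hdot0l.
have hdotDr L (x y z : hilbert_sort L) : hdot x (y + z) = hdot x y + hdot x z.
  exact: linearDr.
by rewrite !big_cons !hdotDr IH FG.
Qed.

End DenseSpan.

Section OneSidedTensor.
Context {R : realType} (H K T : hilbertSpace R) (t : H -> K -> T).
Context (tDl : forall x x' y, t (x + x') y = t x y + t x' y).
Context (tZl : forall a x y, t (a *: x) y = a *: t x y).
Context (tdot : forall x x' y y',
  hdot (t x y) (t x' y') = hdot x x' * hdot y y').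
Context (tdense : dense (lin_span (range (fun p : H * K => t p.1 p.2)))).

Let ten (A : bop H H) (s : seq (H * K)) : T := \sum_(p <- s) t (A p.1) p.2.

Let tenD A B s : ten (A + B) s = ten A s + ten B s.
Proof. by rewrite -big_split; apply: eq_bigr => p _; rewrite addoE tDl. Qed.

Let tenZ a A s : ten (a *: A) s = a *: ten A s.
Proof. by rewrite scaler_sumr; apply: eq_bigr => p _; rewrite scaleoE tZl. Qed.

Let tenN A s : ten (- A) s = - ten A s.
Proof. by rewrite -scaleN1r tenZ scaleN1r. Qed.

Let ten_herm (S B C : bop H H) s : herm S ->
  rdot (ten (S ** B)%OP s) (ten C s) = rdot (ten B s) (ten (S ** C)%OP s).
Proof.
move=> hS; rewrite /rdot; congr complex.Re; apply: hdot_sum2 => p q.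
by rewrite !tdot !compoE (hdot_rdot hS).
Qed.

(** For A hermitian and c large the operator c - A^2 is a square S^2, so that
    c |d|^2 - |(A (x) 1) d|^2 = |(S (x) 1) d|^2 is nonnegative. The tensor map t
    is abstract so that exchanging its arguments gives 1 (x) B as well. *)
Lemma ampliation_exists (A : bop H H) : herm A ->
  exists L : bop T T, forall x y, L (t x y) = t (A x) y.
Proof.
move=> hA; have [c c0 Ac] := bop_bound2 A.
pose E : bop H H := (c + 1)%:C *: id_bop H - (A ** A)%OP.
have E1 : ((1 : R)%:C *: id_bop H <= E)%OP.
  apply/op_geC; split.
    by apply/hermD/hermN; [apply/hermZ/herm1 | exact: hermM].
  by move=> x; have := Ac x; rewrite !bopE !rdotE (hA (A x)); lra.
have [S [r r0 [/op_geC[hS _] SS _]]] := sqrt_op ltr01 E1.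
have bound s : nrm (ten A s) <= Num.sqrt (c + 1) * nrm (ten (id_bop H) s).
  apply/nrm_leP; rewrite ?sqrtr_ge0// sqr_sqrtr; last by rewrite addr_ge0// ltW.
  have := rdot_ge0 (ten (S ** id_bop H)%OP s).
  rewrite -ten_herm// (_ : (S ** (S ** id_bop H) = E)%OP); last first.
    by rewrite -SS; exact: bop_ext.
  rewrite /E tenD tenN tenZ rdotDl rdotNl rdotZl.
  have -> : (A ** A = A ** (A ** id_bop H))%OP by exact: bop_ext.
  rewrite ten_herm// (_ : (A ** id_bop H = A)%OP); last exact: bop_ext.
  by rewrite subr_ge0.
have [|a d w d' w' [s [-> ->]] [s' [-> ->]]|d w [s [-> ->]]||L _ hL] :=
  @extend_dense R T T (fun d w => exists s, d = ten (id_bop H) s /\ w = ten A s)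
    (Num.sqrt (c + 1)); rewrite ?sqrtr_ge0//.
- exists ([seq (a *: p.1, p.2) | p <- s] ++ s').
  by rewrite /ten !big_cat !big_map !scaler_sumr; split;
    congr (_ + _); apply: eq_bigr => p _; rewrite /= ?bopZ tZl.
- apply: dense_sub tdense => _ [n [a [v [vS ->]]]].
  have /boolp.choice[p hp] : forall i, exists p : H * K, v i = t p.1 p.2.
    by move=> i; have [p _ <-] := vS i; exists p.
  exists (ten A [seq (a i *: (p i).1, (p i).2) | i <- index_enum 'I_n]).
  exists [seq (a i *: (p i).1, (p i).2) | i <- index_enum 'I_n]; split=> //.
  by rewrite /ten big_map; apply: eq_bigr => i _; rewrite hp tZl.
exists L => x y; apply: hL; exists [:: (x, y)].
by rewrite /ten !big_seq1.
Qed.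

End OneSidedTensor.

Section PositiveMap.
Context {R : realType} (H K : hilbertSpace R) (Phi : bop H H -> bop K K).
Context (Phi_herm : forall A, herm A -> herm (Phi A)).
Context (PhiM : forall A B, herm A -> herm B -> herm (A ** B)%OP ->
  Phi (A ** B)%OP = (Phi A ** Phi B)%OP).
Context (PhiD : forall A B, herm A -> herm B -> Phi (A + B) = Phi A + Phi B).
Context (PhiZ : forall (a : R) A, herm A -> Phi (a%:C *: A) = a%:C *: Phi A).
Context (Phi1 : Phi (id_bop H) = id_bop K).

(** If A + e = S^2 then Phi A + e = (Phi S)^2. *)
Lemma morphism_ge0 A : herm A -> (forall x, 0 <= rdot (A x) x) ->
  forall z, 0 <= rdot (Phi A z) z.
Proof.
move=> hA pA z; apply/ler_addgt0Pr => e e0.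
have z0 : 0 < rdot z z + 1 by rewrite ltr_wpDl ?rdot_ge0.
pose d := e / (rdot z z + 1); have d0 : 0 < d by rewrite divr_gt0.
have h1 : herm (d%:C *: id_bop H) by apply/hermZ/herm1.
have dA : (d%:C *: id_bop H <= A + d%:C *: id_bop H)%OP.
  apply/op_geC; split; first exact: hermD.
  by move=> y; rewrite !bopE !rdotE lerDr.
have [S [s s0 [/op_geC[hS _] SS _]]] := sqrt_op d0 dA.
have : 0 <= rdot (Phi (A + d%:C *: id_bop H) z) z.
  rewrite -SS PhiM//; last by rewrite SS; exact: hermD.
  by rewrite compoE Phi_herm// rdot_ge0.
rewrite PhiD// PhiZ// Phi1 !bopE !rdotE => /le_trans; apply.
by rewrite lerD2l /d mulrAC ler_pdivrMr// ler_pM2l// lerDl.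
Qed.

Lemma morphism_le A B : (A <= B)%OP -> herm A -> herm B -> (Phi A <= Phi B)%OP.
Proof.
move=> /op_leP[hd hle] hA hB; apply/op_leP; split.
  by apply/hermD/hermN; exact: Phi_herm.
have E : Phi B = Phi (B - A) + Phi A by rewrite -PhiD// subrK.
move=> z; rewrite E addoE rdotDl lerDr; apply: morphism_ge0 => // x.
by rewrite !bopE rdotDl rdotNl subr_ge0.
Qed.

End PositiveMap.

Section TensorCalculus.
Context {R : realType} (H K : hilbertSpace R) (T : hilbert_tensor H K).
Implicit Types (A : bop H H) (B : bop K K).

Local Notation t := (tmul T).

Lemma tensor_bop_eq (L : hilbertSpace R) (X Y : bop T L) :
  (forall x y, X (t x y) = Y (t x y)) -> X = Y.
Proof.
move=> XY; apply: (bop_dense_eq (@tmul_dense R H K T)) => _ [p _ <-]; exact: XY.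
Qed.

(** A (x) B is the composite of the two ampliations. *)
Lemma tensor_opP A B : herm A -> herm B ->
  forall x y, tensor_op T A B (t x y) = t (A x) (B y).
Proof.
move=> hA hB.
have [||||L hL] := @ampliation_exists R H K T t _ _ _ _ A hA.
- by move=> x x' y; exact: linearDl.
- by move=> a x y; exact: linearZl_LR.
- exact: tmul_dot.
- exact: (@tmul_dense R H K T).
have [||||L' hL'] := @ampliation_exists R K H T (fun y x => t x y) _ _ _ _ B hB.
- by move=> y y' x; exact: linearDr.
- by move=> a y x; exact: linearZr_LR.
- by move=> y y' x x'; rewrite tmul_dot mulrC.
- have := @tmul_dense R H K T; congr (dense (lin_span _)).
  by apply/seteqP; split=> _ [[x y] _ <-]; exists (y, x).
rewrite /tensor_op; set P := [set _ | _]; suff : P (get P) by [].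
by apply: getPex; exists (L ** L')%OP => x y; rewrite compoE hL' hL.
Qed.

Lemma tensor_herm A B : herm A -> herm B -> herm (tensor_op T A B).
Proof.
move=> hA hB; have [C hC] := adjoint_exists (tensor_op T A B).
suff CE : C = tensor_op T A B by move=> x y; rewrite hC CE.
apply: tensor_bop_eq => x y; apply/eqP; rewrite -subr_eq0; apply/eqP.
apply: (dense_orth (@tmul_dense R H K T)) => _ [[x' y'] _ <-] /=.
have hdotBr (u v w : T) : hdot u (v - w) = hdot u v - hdot u w by exact: linearBr.
rewrite hdotBr -(hdot_rdot hC) !tensor_opP// !tmul_dot.
by rewrite !(hdot_rdot hA) !(hdot_rdot hB) subrr.
Qed.

Definition ampl A := tensor_op T A (id_bop K).
Definition ampr B := tensor_op T (id_bop H) B.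

Lemma amplE A : herm A -> forall x y, ampl A (t x y) = t (A x) y.
Proof. by move=> hA x y; rewrite tensor_opP//; exact: herm1. Qed.

Lemma amprE B : herm B -> forall x y, ampr B (t x y) = t x (B y).
Proof. by move=> hB x y; rewrite tensor_opP//; exact: herm1. Qed.

Lemma ampl_herm A : herm A -> herm (ampl A).
Proof. by move=> hA; apply: tensor_herm => //; exact: herm1. Qed.

Lemma ampr_herm B : herm B -> herm (ampr B).
Proof. by move=> hB; apply: tensor_herm => //; exact: herm1. Qed.

Lemma ampl_ampr A B : herm A -> herm B -> tensor_op T A B = (ampl A ** ampr B)%OP.
Proof.
move=> hA hB; apply: tensor_bop_eq => x y.
by rewrite compoE tensor_opP// amprE// amplE.
Qed.

Lemma ampl_opcommr A B : herm A -> herm B -> opcomm (ampl A) (ampr B).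
Proof.
move=> hA hB; apply/opcommP; rewrite -ampl_ampr//; apply: tensor_bop_eq => x y.
by rewrite compoE tensor_opP// amplE// amprE.
Qed.

Lemma ampl_comp A A' : herm A -> herm A' -> herm (A ** A')%OP ->
  ampl (A ** A')%OP = (ampl A ** ampl A')%OP.
Proof. by move=> *; apply: tensor_bop_eq => x y; rewrite compoE !amplE. Qed.

Lemma ampr_comp B B' : herm B -> herm B' -> herm (B ** B')%OP ->
  ampr (B ** B')%OP = (ampr B ** ampr B')%OP.
Proof. by move=> *; apply: tensor_bop_eq => x y; rewrite compoE !amprE. Qed.

Lemma tmulDl x x' y : t (x + x') y = t x y + t x' y. Proof. exact: linearDl. Qed.
Lemma tmulZl a x y : t (a *: x) y = a *: t x y. Proof. exact: linearZl_LR. Qed.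
Lemma tmulNl x y : t (- x) y = - t x y. Proof. exact: linearNl. Qed.
Lemma tmulNr x y : t x (- y) = - t x y. Proof. exact: linearNr. Qed.
Lemma tmulDr x y y' : t x (y + y') = t x y + t x y'. Proof. exact: linearDr. Qed.
Lemma tmulZr a x y : t x (a *: y) = a *: t x y. Proof. exact: linearZr_LR. Qed.

Lemma amplD A A' : herm A -> herm A' -> ampl (A + A') = ampl A + ampl A'.
Proof.
move=> hA hA'; apply: tensor_bop_eq => x y.
by rewrite addoE !amplE ?addoE ?tmulDl//; exact: hermD.
Qed.

Lemma amplZ (a : R) A : herm A -> ampl (a%:C *: A) = a%:C *: ampl A.
Proof.
move=> hA; apply: tensor_bop_eq => x y.
by rewrite scaleoE !amplE ?scaleoE ?tmulZl//; exact: hermZ.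
Qed.

Lemma ampl1 : ampl (id_bop H) = id_bop T.
Proof. by apply: tensor_bop_eq => x y; rewrite amplE. Qed.

Lemma amprD B B' : herm B -> herm B' -> ampr (B + B') = ampr B + ampr B'.
Proof.
move=> hB hB'; apply: tensor_bop_eq => x y.
by rewrite addoE !amprE ?addoE ?tmulDr//; exact: hermD.
Qed.

Lemma amprZ (a : R) B : herm B -> ampr (a%:C *: B) = a%:C *: ampr B.
Proof.
move=> hB; apply: tensor_bop_eq => x y.
by rewrite scaleoE !amprE ?scaleoE ?tmulZr//; exact: hermZ.
Qed.

Lemma amprN B : herm B -> ampr (- B) = - ampr B.
Proof.
move=> hB; apply: tensor_bop_eq => x y.
rewrite oppoE !amprE ?oppoE//; last exact: hermN.
by rewrite -scaleN1r tmulZr scaleN1r.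
Qed.

Lemma ampr1 : ampr (id_bop K) = id_bop T.
Proof. by apply: tensor_bop_eq => x y; rewrite amprE. Qed.

Lemma ampl_ge0 A : herm A -> (forall x, 0 <= rdot (A x) x) ->
  forall z, 0 <= rdot (ampl A z) z.
Proof.
exact: (morphism_ge0 ampl_herm ampl_comp amplD amplZ ampl1).
Qed.

Lemma ampr_ge0 B : herm B -> (forall x, 0 <= rdot (B x) x) ->
  forall z, 0 <= rdot (ampr B z) z.
Proof.
exact: (morphism_ge0 ampr_herm ampr_comp amprD amprZ ampr1).
Qed.

Lemma ampl_le A A' : (A <= A')%OP -> herm A -> herm A' -> (ampl A <= ampl A')%OP.
Proof. exact: (morphism_le ampl_herm ampl_comp amplD amplZ ampl1). Qed.

Lemma ampr_le B B' : (B <= B')%OP -> herm B -> herm B' -> (ampr B <= ampr B')%OP.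
Proof. exact: (morphism_le ampr_herm ampr_comp amprD amprZ ampr1). Qed.

Lemma ampl_scalar (a : R) : ampl (a%:C *: id_bop H) = a%:C *: id_bop T.
Proof. by rewrite amplZ ?ampl1//; exact: herm1. Qed.

Lemma ampr_scalar (a : R) : ampr (a%:C *: id_bop K) = a%:C *: id_bop T.
Proof. by rewrite amprZ ?ampr1//; exact: herm1. Qed.

(** A (x) B is the product of the commuting positive operators A (x) 1 and
    1 (x) B. *)
Lemma tensor_bounds A B (a a' b b' : R) : 0 < a -> 0 < b ->
  (a%:C *: id_bop H <= A)%OP -> (A <= a'%:C *: id_bop H)%OP ->
  (b%:C *: id_bop K <= B)%OP -> (B <= b'%:C *: id_bop K)%OP -> 0 <= a' ->
  ((a * b)%:C *: id_bop T <= tensor_op T A B)%OP /\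
  (tensor_op T A B <= (a' * b')%:C *: id_bop T)%OP.
Proof.
move=> a0 b0 aA Aa' bB Bb' a'0; have hA := herm_geC aA; have hB := herm_geC bB.
have sc L (r : R) : herm (r%:C *: id_bop L) by apply/hermZ/herm1.
have /op_geC[hLA lA] : (a%:C *: id_bop T <= ampl A)%OP.
  by rewrite -ampl_scalar; exact: ampl_le.
have /op_leC[_ uA] : (ampl A <= a'%:C *: id_bop T)%OP.
  by rewrite -ampl_scalar; exact: ampl_le.
have /op_geC[hRB lB] : (b%:C *: id_bop T <= ampr B)%OP.
  by rewrite -ampr_scalar; exact: ampr_le.
have /op_leC[_ uB] : (ampr B <= b'%:C *: id_bop T)%OP.
  by rewrite -ampr_scalar; exact: ampr_le.
have B0 z : 0 <= rdot (ampr B z) z.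
  by apply: le_trans (lB z); rewrite mulr_ge0 ?rdot_ge0 ?ltW.
have cAB := ampl_opcommr hA hB.
have hT := tensor_herm hA hB.
split; [apply/op_geC | apply/op_leC]; split=> // z; rewrite ampl_ampr// compoE.
- have hLa : herm (ampl A - a%:C *: id_bop T) by apply/hermD/hermN.
  apply: le_trans (_ : a * rdot (ampr B z) z <= _).
    by rewrite -mulrA ler_wpM2l ?(ltW a0).
  rewrite -subr_ge0.
  have -> : rdot (ampl A (ampr B z)) z - a * rdot (ampr B z) z =
    rdot ((ampl A - a%:C *: id_bop T) (ampr B z)) z by rewrite !bopE !rdotE.
  apply: positive_mul => // [y|]; first by rewrite !bopE !rdotE subr_ge0.
  by commute.
- have hLa : herm (a'%:C *: id_bop T - ampl A) by apply/hermD/hermN.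
  apply: le_trans (_ : a' * rdot (ampr B z) z <= _); last first.
    by rewrite -mulrA ler_wpM2l.
  rewrite -subr_ge0.
  have -> : a' * rdot (ampr B z) z - rdot (ampl A (ampr B z)) z =
    rdot ((a'%:C *: id_bop T - ampl A) (ampr B z)) z by rewrite !bopE !rdotE.
  apply: positive_mul => // [y|]; first by rewrite !bopE !rdotE subr_ge0.
  by commute.
Qed.

End TensorCalculus.

(** * Tensor products of means *)

Section TensorMean.
Context {R : realType}.
Implicit Types H K : hilbertSpace R.
Context (sigma : forall H : hilbertSpace R, bop H H -> bop H H -> bop H H).
Context (hsigma : operator_mean sigma).
Context (f : R -> R) (hf : representing_function sigma f).
Context (fpos : forall t : R, 0 < t -> 0 < f t).

(** chord_bound with G = 1 sigma X, Q = a, V = b and P = c. *)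
Lemma mean_ge_line1 H (X : bop H H) (m M a b c : R) : 0 < m -> m < M -> 0 <= c ->
  (m%:C *: id_bop H <= X)%OP -> (X <= M%:C *: id_bop H)%OP ->
  (forall t, m <= t <= M -> a * t + b <= c * f t) ->
  forall x, a * rdot (X x) x + b * rdot x x <= c * rdot (sigma (id_bop H) X x) x.
Proof.
move=> m0 mM c0 mX XM fab x.
have [hF F0] := mean_ge0 hsigma ltr01 (@id_geC R H) m0 mX.
have FX := mean_comm hsigma m0 mX.
have sc (r : R) : herm (r%:C *: id_bop H) by apply/hermZ/herm1.
have sX (r : R) A : opcomm (r%:C *: id_bop H) A by commute.
have := @chord_bound R H (c%:C *: id_bop H) (sigma (id_bop H) X) X
  (a%:C *: id_bop H) (b%:C *: id_bop H) m M f mM mX XM (sc _) hF (sc _) (sc _)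
  _ (sX _ _) FX (sX _ _) (sX _ _) (sX _ _) _ _ x.
rewrite !bopE !rdotE; apply => [y|eta eta0|t tmM y].
- by rewrite !bopE !rdotE mulr_ge0 ?rdot_ge0.
- have [K K0 hK] := mean_local hsigma hf M m0 mX eta0; exists K => // t tmM y.
  exact: (hK t tmM y).1.
- by have := ler_wpM2r (rdot_ge0 y) (fab t tmM); rewrite !bopE !rdotE; lra.
Qed.

(** chord_bound is applied to the second factor, with G = 1 (x) (1 sigma Y) and
    P = (1 sigma X) (x) 1: for a fixed value y of Y, the hypothesis on f x f y
    is an affine lower bound of f in x, that is mean_ge_line1 for X. *)
Lemma tensor_chord H K (T : hilbert_tensor H K) (X : bop H H) (Y : bop K K)
    (m1 M1 m2 M2 mu nu : R) : 0 < m1 -> m1 < M1 -> 0 < m2 -> m2 < M2 ->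
  (m1%:C *: id_bop H <= X)%OP -> (X <= M1%:C *: id_bop H)%OP ->
  (m2%:C *: id_bop K <= Y)%OP -> (Y <= M2%:C *: id_bop K)%OP ->
  (forall x y, m1 <= x <= M1 -> m2 <= y <= M2 -> mu * (x * y) + nu <= f x * f y) ->
  forall z, mu * rdot (ampl T X (ampr T Y z)) z + nu * rdot z z <=
    rdot (ampl T (sigma (id_bop H) X) (ampr T (sigma (id_bop K) Y) z)) z.
Proof.
move=> m10 mM1 m20 mM2 mX XM mY YM hfmn z.
have [hF F0] := mean_ge0 hsigma ltr01 (@id_geC R H) m10 mX.
have [hG G0] := mean_ge0 hsigma ltr01 (@id_geC R K) m20 mY.
have FX := mean_comm hsigma m10 mX; have GY := mean_comm hsigma m20 mY.
have hX := herm_geC mX; have hY := herm_geC mY.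
set F := sigma (id_bop H) X in hF F0 FX *; set G := sigma (id_bop K) Y in hG G0 GY *.
have hid L (r : R) : herm (r%:C *: id_bop L) by apply/hermZ/herm1.
have mY' : (m2%:C *: id_bop T <= ampr T Y)%OP.
  by rewrite -(ampr_scalar T); apply: ampr_le.
have YM' : (ampr T Y <= M2%:C *: id_bop T)%OP.
  by rewrite -(ampr_scalar T); apply: ampr_le.
have cFY := ampl_opcommr (T := T) hF hY; have cFG := ampl_opcommr (T := T) hF hG.
have cXY := ampl_opcommr (T := T) hX hY.
have cGY : opcomm (ampr T G) (ampr T Y).
  apply/opcommP; apply: tensor_bop_eq => x y.
  by rewrite !compoE !amprE// GY.
have := @chord_bound R T (ampl T F) (ampr T G) (ampr T Y) (mu%:C *: ampl T X)
  (nu%:C *: id_bop T) m2 M2 f mM2 mY' YM' (ampl_herm (T := T) hF) (ampr_herm (T := T) hG)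
  (hermZ mu (ampl_herm (T := T) hX)) (hid _ nu) (ampl_ge0 hF F0) cFY cGY
  (opcommZ _ cXY) (opcommZ _ (@opcomm1 R T _)) cFG _ _ z.
rewrite !scaleoE idoE !rdotZl; apply => [eta eta0|t tmM w].
  have [C C0 hC] := mean_local hsigma hf M2 m20 mY eta0; exists C => // t tmM w.
  pose Z : bop K K := Y - t%:C *: id_bop K.
  have hZ : herm Z by apply/hermD/hermN.
  have ZE y : Y y - t%:C *: y = Z y by [].
  have ampZ : ampr T Y w - t%:C *: w = ampr T Z w.
    have -> : ampr T Z = ampr T Y - t%:C *: id_bop T; last by [].
    rewrite /Z amprD ?amprN//; last exact: hermN.
    by rewrite ampr_scalar.
  rewrite ampZ; clearbody Z.
  pose E : bop K K := (1 + eta)%:C *: G + C%:C *: (Z ** (G ** Z))%OP - (f t)%:C *: id_bop K.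
  have hE : herm E.
    apply/hermD/hermN => //; apply/hermD; apply/hermZ => //.
    by move=> y y'; rewrite !compoE hZ hG hZ.
  have E0 y : 0 <= rdot (E y) y.
    have [+ _] := hC t tmM y; rewrite -/G ZE.
    have -> : E y = (1 + eta)%:C *: G y + C%:C *: Z (G (Z y)) - (f t)%:C *: y by [].
    by rewrite !rdotE hZ subr_ge0.
  have := ampr_ge0 hE E0 w.
  have -> : ampr T E = (1 + eta)%:C *: ampr T G +
      C%:C *: (ampr T Z ** (ampr T G ** ampr T Z))%OP - (f t)%:C *: id_bop T.
    apply: tensor_bop_eq => x y.
    rewrite amprE// /E !(addoE, oppoE, scaleoE, compoE, idoE) !amprE//.
    by rewrite !(tmulDr, tmulNr, tmulZr).
  by rewrite !(addoE, oppoE, scaleoE, compoE, idoE) !rdotE (ampr_herm (T := T) hZ) subr_ge0.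
have t0 : 0 < t by case/andP: tmM => [h _]; exact: lt_le_trans h.
pose E : bop H H := (f t)%:C *: F - (t * mu)%:C *: X - nu%:C *: id_bop H.
have hE : herm E.
  by apply/hermD/hermN => //; apply/hermD/hermN; exact: hermZ.
have E0 y : 0 <= rdot (E y) y.
  have := @mean_ge_line1 H X m1 M1 (t * mu) nu (f t) m10 mM1 (ltW (fpos t0)) mX XM _ y.
  rewrite -/F => h; rewrite !bopE !rdotE -addrA -opprD subr_ge0; apply: h => x xmM.
  by have := hfmn x t xmM tmM; rewrite (mulrC (f x)); apply: le_trans; lra.
have := ampl_ge0 hE E0 w.
have -> : ampl T E = (f t)%:C *: ampl T F - (t * mu)%:C *: ampl T X - nu%:C *: id_bop T.
  apply: tensor_bop_eq => x y.
  rewrite amplE// /E !(addoE, oppoE, scaleoE, idoE) !amplE//.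
  by rewrite !(tmulDl, tmulNl, tmulZl).
rewrite !(addoE, oppoE, scaleoE, idoE) !rdotE -addrA -opprD subr_ge0.
by rewrite mulrA.
Qed.

Lemma tensor_conj H K (T : hilbert_tensor H K) (S X : bop H H) (S' Y : bop K K) :
  herm S -> herm X -> herm S' -> herm Y -> forall z,
  rdot (tensor_op T (S ** X ** S)%OP (S' ** Y ** S')%OP z) z =
  rdot (ampl T X (ampr T Y (tensor_op T S S' z))) (tensor_op T S S' z).
Proof.
move=> hS hX hS' hY z.
have hc L (S0 X0 : bop L L) : herm S0 -> herm X0 -> herm (S0 ** X0 ** S0)%OP.
  by move=> h1 h2 x y; rewrite !compoE h1 h2 h1.
have -> : tensor_op T (S ** X ** S)%OP (S' ** Y ** S')%OP =
  (tensor_op T S S' ** (ampl T X ** (ampr T Y ** tensor_op T S S')))%OP.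
  apply: tensor_bop_eq => x y; rewrite !compoE.
  by rewrite [in RHS]tensor_opP// amprE// amplE// !tensor_opP//; exact: hc.
by rewrite !compoE tensor_herm.
Qed.

(** Both means are reduced to 1 sigma X and 1 sigma Y by mean_factor, and the
    square roots S and S' are moved to the vector by tensor_conj. *)
Lemma tensor_mean_ge H K (T : hilbert_tensor H K) (A C : bop H H) (B D : bop K K)
    (a b c d m1 M1 m2 M2 mu nu : R) :
  0 < a -> (a%:C *: id_bop H <= A)%OP -> 0 < c -> (c%:C *: id_bop H <= C)%OP ->
  0 < b -> (b%:C *: id_bop K <= B)%OP -> 0 < d -> (d%:C *: id_bop K <= D)%OP ->
  0 < m1 -> m1 < M1 -> 0 < m2 -> m2 < M2 ->
  (m1%:C *: A <= C)%OP -> (C <= M1%:C *: A)%OP ->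
  (m2%:C *: B <= D)%OP -> (D <= M2%:C *: B)%OP ->
  (forall x y, m1 <= x <= M1 -> m2 <= y <= M2 -> mu * (x * y) + nu <= f x * f y) ->
  forall z, mu * rdot (tensor_op T C D z) z + nu * rdot (tensor_op T A B z) z <=
    rdot (tensor_op T (sigma A C) (sigma B D) z) z.
Proof.
move=> a0 aA c0 cC b0 bB d0 dD m10 mM1 m20 mM2 mA AM mB BM hmn z.
have [S [X [r r0 [hS rX [AE CE sE] hr]]]] := mean_factor hsigma a0 aA c0 cC.
have [S' [Y [s s0 [hS' sY [BE DE sE'] hs]]]] := mean_factor hsigma b0 bB d0 dD.
have mX := (hr _).1 mA; have XM := (hr _).2 AM.
have mY := (hs _).1 mB; have YM := (hs _).2 BM.
have hX := herm_geC mX; have hY := herm_geC mY.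
have [hF _] := mean_ge0 hsigma ltr01 (@id_geC R H) m10 mX.
have [hG _] := mean_ge0 hsigma ltr01 (@id_geC R K) m20 mY.
have sq1 (L : hilbertSpace R) (P : bop L L) : (P ** P = P ** id_bop L ** P)%OP.
  exact: bop_ext.
rewrite sE sE' AE BE CE DE (sq1 H S) (sq1 K S') !tensor_conj//; try exact: herm1.
rewrite ampr1 ampl1 !idoE.
apply: (@tensor_chord H K T X Y m1 M1 m2 M2 mu nu m10 mM1 m20 mM2 mX XM mY YM hmn).
Qed.

End TensorMean.

(** * The diagonal isometry and the Hadamard product *)

Section Hadamard.
Context {R : realType} (H : hilbertSpace R) (T : hilbert_tensor H H).
Context (I : Type) (e : I -> H) (he : orthonormal_basis e).
Implicit Types A B : bop H H.

Let basis_dot i j : hdot (e i) (e j) * hdot (e i) (e j) = hdot (e i) (e j).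
Proof.
have [e1 e0 _] := he; have [->|ij] := pselect (i = j); first by rewrite e1 mulr1.
by rewrite e0// mulr0.
Qed.

(** The vectors e i and e i (x) e i have the same Gram matrix, since 0 and 1 are
    their own squares; the isometry between their spans extends by density. *)
Lemma diag_isometry_nrm x : nrm (diag_isometry T e x) = nrm x.
Proof.
have [e1 e0 ed] := he.
pose d (s : seq (R[i] * I)) := \sum_(p <- s) p.1 *: e p.2.
pose w (s : seq (R[i] * I)) := \sum_(p <- s) p.1 *: tmul T (e p.2) (e p.2).
have dw s : nrm (w s) = nrm (d s).
  rewrite /nrm /rdot; congr (Num.sqrt (complex.Re _)); apply: hdot_sum2 => p q.
  by rewrite !hdotZl !hdotZr tmul_dot basis_dot.
have [|a _ _ _ _ [s [-> ->]] [s' [-> ->]]|_ _ [s [-> ->]]||U Ub hU] :=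
  @extend_dense R H T (fun x y => exists s, x = d s /\ y = w s) 1; rewrite ?ler01//.
- exists ([seq (a * p.1, p.2) | p <- s] ++ s').
  by rewrite /d /w !big_cat !big_map !scaler_sumr; split;
    congr (_ + _); apply: eq_bigr => p _; rewrite scalerA.
- by rewrite dw mul1r.
- apply: dense_sub ed => _ [n [a [v [vS ->]]]].
  have /boolp.choice[p hp] : forall i, exists j, v i = e j.
    by move=> i; have [j _ <-] := vS i; exists j.
  exists (w [seq (a i, p i) | i <- index_enum 'I_n]).
  exists [seq (a i, p i) | i <- index_enum 'I_n]; split=> //.
  by rewrite /d big_map; apply: eq_bigr => i _; rewrite hp.
have Ue i : U (e i) = tmul T (e i) (e i).
  by apply: hU; exists [:: (1, i)]; rewrite /d /w !big_seq1 !scale1r.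
(* The conclusion of extend_dense is only a bound; U is isometric because U^* U
   fixes the basis. *)
have UU : ((U^* ** U)%OP = id_bop H).
  apply: (bop_dense_eq ed) => _ [i _ <-]; apply/eqP; rewrite -subr_eq0; apply/eqP.
  apply: (dense_orth ed) => _ [j _ <-].
  have hdotBr (u v z : H) : hdot u (v - z) = hdot u v - hdot u z by exact: linearBr.
  rewrite hdotBr compoE -(hdot_rdot (adjointP U)) !Ue tmul_dot idoE basis_dot.
  by rewrite subrr.
have Uiso y : `|U y| = `|y|.
  by rewrite !norm_nrm /nrm adjointP -compoE UU.
suff [h _] : [set V : bop H T | (forall y, `|V y| = `|y|) /\
    forall i, V (e i) = tmul T (e i) (e i)] (diag_isometry T e).
  by have := h x; rewrite !norm_nrm => -[].
by rewrite /diag_isometry; apply: getPex; exists U.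
Qed.

Lemma rdot_diag_isometry x : rdot (diag_isometry T e x) (diag_isometry T e x) = rdot x x.
Proof. by rewrite -!sqr_nrm diag_isometry_nrm. Qed.

Lemma hadamard_form A B x : rdot (hadamard T e A B x) x =
  rdot (tensor_op T A B (diag_isometry T e x)) (diag_isometry T e x).
Proof. by rewrite /hadamard !compoE adjointC. Qed.

Lemma hadamard_herm A B : herm A -> herm B -> herm (hadamard T e A B).
Proof. by move=> hA hB; apply/herm_conj/tensor_herm. Qed.

Lemma hadamard_bounds A B (a a' b b' : R) : 0 < a -> 0 < b -> 0 <= a' ->
  (a%:C *: id_bop H <= A)%OP -> (A <= a'%:C *: id_bop H)%OP ->
  (b%:C *: id_bop H <= B)%OP -> (B <= b'%:C *: id_bop H)%OP ->
  ((a * b)%:C *: id_bop H <= hadamard T e A B)%OP /\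
  (hadamard T e A B <= (a' * b')%:C *: id_bop H)%OP.
Proof.
move=> a0 b0 a'0 aA Aa' bB Bb'.
have [/op_geC[_ l] /op_leC[_ u]] := tensor_bounds T a0 b0 aA Aa' bB Bb' a'0.
have hh := hadamard_herm (herm_geC aA) (herm_geC bB).
split; [apply/op_geC|apply/op_leC]; split=> // x; rewrite hadamard_form.
  by rewrite -rdot_diag_isometry.
by rewrite -[rdot x x]rdot_diag_isometry.
Qed.

End Hadamard.

(** * Concavity of the representing function *)

Section Jensen.
Context {R : realType}.
Implicit Types H K : hilbertSpace R.
Context (sigma : forall H : hilbertSpace R, bop H H -> bop H H -> bop H H).
Context (hsigma : operator_mean sigma).
Context (f : R -> R) (hf : representing_function sigma f).

Lemma rdot_scale2 H (a : R[i]) (x y : H) :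
  rdot (a *: x) (a *: y) = (complex.Re `|a|) ^+ 2 * rdot x y.
Proof.
have aa : a * a^*%C = ((complex.Re `|a|) ^+ 2)%:C.
  by rewrite -sqr_normc -[X in X ^+ 2]RRe_real ?normr_real// rmorphXn.
have ReCM (b : R) (z : R[i]) : complex.Re (b%:C * z) = b * complex.Re z.
  by rewrite cReM /= mul0r subr0.
by rewrite /rdot hdotZl hdotZr mulrA aa; exact: ReCM.
Qed.

Lemma rank_one_projection H (v : H) : rdot v v = 1 -> exists E : bop H H,
  [/\ herm E, forall x, E (E x) = E x & forall x, E x = hdot x v *: v].
Proof.
move=> v1; have vv : hdot v v = 1 by rewrite hdotE rdot_ix v1.
pose e x := hdot x v *: v.
have le_ : linear e.
  by move=> a x y; rewrite /e hdotDl hdotZl scalerDl scalerA.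
have eherm x y : rdot (e x) y = rdot x (e y).
  by rewrite /rdot /e hdotZl hdotZr mulrC -hdotC mulrC.
have ee x : e (e x) = e x by rewrite /e hdotZl vv mulr1.
have be x : nrm (e x) <= 1 * nrm x.
  have h : rdot (e x) (e x) <= nrm (e x) * nrm x.
    by rewrite -eherm ee rdot_le_nrm.
  have [->|n0] := eqVneq (nrm (e x)) 0; first by rewrite mul1r nrm_ge0.
  have n1 : 0 < nrm (e x) by rewrite lt0r n0 nrm_ge0.
  by rewrite -(ler_pM2l n1) -expr2 sqr_nrm mul1r.
by exists (Bop (mk_bopP le_ be)).
Qed.

Lemma projection_pythagoras H (E : bop H H) : herm E -> (forall x, E (E x) = E x) ->
  forall x, rdot (E x) x = rdot (E x) (E x) /\
    rdot x x = rdot (E x) (E x) + rdot (x - E x) (x - E x).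
Proof.
move=> hE EE x; have h : rdot (E x) x = rdot (E x) (E x) by rewrite -hE EE.
by split=> //; rewrite !rdotE (rdotC x (E x)) h; ring.
Qed.

(** X is at most s (1 + N (1 - E)) for N large, with E the projection onto v
    and s slightly above <X v, v>; the mean of 1 + N (1 - E) and s times itself
    is known, and its value at v is f s. *)
Lemma mean_jensen H (X : bop H H) (v : H) (m eps : R) : 0 < m ->
  (m%:C *: id_bop H <= X)%OP -> rdot v v = 1 -> 0 < eps ->
  rdot (sigma (id_bop H) X v) v <= f (rdot (X v) v + eps).
Proof.
move=> m0 mX v1 eps0; have [hX mX'] := iffLR (op_geC _ _) mX.
set r := rdot (X v) v; pose s := r + eps.
have r0 : 0 < r by apply: lt_le_trans (mX' v); rewrite v1 mulr1.
have s0 : 0 < s by rewrite addr_gt0.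
have [k k0 hk] := bop_bound X.
have vv : hdot v v = 1 by rewrite hdotE rdot_ix v1.
have [E [hE EE Ev]] := rank_one_projection v1.
have pyth x := projection_pythagoras hE EE x.
(* N absorbs the cross terms 2 <X E x, (1 - E) x>, at the price of eps on the
   range of E. *)
pose N := (k + k ^+ 2 / eps) / s.
have N0 : 0 <= N by rewrite divr_ge0 ?addr_ge0 ?divr_ge0 ?sqr_ge0// ltW.
pose Z : bop H H := (1 + N)%:C *: id_bop H - N%:C *: E.
have hZ : herm Z by apply/hermD/hermN; apply/hermZ => //; exact: herm1.
have Zq x : rdot (Z x) x = rdot x x + N * rdot (x - E x) (x - E x).
  have [p1 p2] := pyth x; have -> : rdot (x - E x) (x - E x) = rdot x x - rdot (E x) (E x).
    by rewrite p2 addrAC subrr add0r.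
  by rewrite !bopE rdotDl rdotNl !rdotZl p1; ring.
clearbody Z.
have Z1 : ((1 : R)%:C *: id_bop H <= Z)%OP.
  apply/op_geC; split=> // x.
  by rewrite Zq mul1r lerDl mulr_ge0 ?rdot_ge0.
have XZ : (X <= s%:C *: Z)%OP.
  apply: op_le_herm => // [|x]; first exact: hermZ.
  rewrite scaleoE rdotZl Zq.
  have cross y w : rdot (X (y + w)) (y + w) =
      rdot (X y) y + 2 * rdot (X y) w + rdot (X w) w.
    by rewrite bopD !rdotE (hX w y) (rdotC w); ring.
  have exv : rdot (X (E x)) (E x) = r * rdot (E x) (E x).
    by rewrite Ev bopZ !rdot_scale2 v1 mulr1 mulrC.
  have [_ xx] := pyth x; set y := E x in exv xx *; set w := x - y in xx *.
  have xyw : x = y + w by rewrite addrC subrK.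
  have hXx : rdot (X x) x = r * rdot y y + 2 * rdot (X y) w + rdot (X w) w.
    by rewrite {1 2}xyw cross exv.
  have h1 : rdot (X y) w <= k * nrm y * nrm w.
    by apply: le_trans (rdot_le_nrm _ _) _; rewrite ler_wpM2r ?nrm_ge0.
  have h2 : rdot (X w) w <= k * nrm w * nrm w.
    by apply: le_trans (rdot_le_nrm _ _) _; rewrite ler_wpM2r ?nrm_ge0.
  rewrite hXx xx -!sqr_nrm.
  have h3 : 0 <= (eps * nrm y - k * nrm w) ^+ 2 / eps.
    by rewrite divr_ge0 ?sqr_ge0// ltW.
  have h4 : 0 <= (r + eps) * nrm w ^+ 2 by rewrite mulr_ge0 ?sqr_ge0// ltW.
  have e3 : (eps * nrm y - k * nrm w) ^+ 2 / eps =
     eps * nrm y ^+ 2 - 2 * (k * nrm y * nrm w) + k ^+ 2 / eps * nrm w ^+ 2.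
    by field; rewrite gt_eqF.
  have hN : s * (N * nrm w ^+ 2) = k * nrm w * nrm w + k ^+ 2 / eps * nrm w ^+ 2.
    by rewrite /N; field; rewrite !gt_eqF.
  rewrite e3 in h3; rewrite mulrDr hN /s; move: h1 h2 h3 h4.
  by move: (k ^+ 2 / eps * nrm w ^+ 2) => q; lra.
have sZ : (s%:C *: id_bop H <= s%:C *: Z)%OP.
  by have := op_leZ (ltW s0) Z1; rewrite scale1r.
have /op_leP[_ /(_ v)] : (sigma (id_bop H) X <= sigma Z (s%:C *: Z))%OP.
  apply: (mean_monotone hsigma) => //.
  - exact: strictly_positiveI ltr01 (@id_geC R H).
  - exact: strictly_positiveI ltr01 Z1.
  - exact: strictly_positiveI m0 mX.
  - exact: strictly_positiveI s0 sZ.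
  - by have := Z1; rewrite scale1r.
rewrite (mean_scale hsigma hf ltr01 Z1 s0) scaleoE rdotZl Zq v1.
by rewrite Ev vv scale1r subrr rdot0l mulr0 addr0 mulr1.
Qed.

(** mean_lower at an eigenvector, where the quadratic error vanishes. *)
Lemma mean_eigen H (X : bop H H) (v : H) (m s : R) : 0 < m ->
  (m%:C *: id_bop H <= X)%OP -> rdot v v = 1 -> m <= s -> X v = s%:C *: v ->
  f s <= rdot (sigma (id_bop H) X v) v.
Proof.
move=> m0 mX v1 ms Xv; apply/ler_addgt0Pr => e e0.
have [_ F0] := mean_ge0 hsigma ltr01 (@id_geC R H) m0 mX.
set q := rdot _ _; have q0 : 0 <= q := F0 v.
have q1 : 0 < q + 1 by rewrite ltr_wpDl.
have eq0 : 0 < e / (q + 1) by rewrite divr_gt0.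
have [K _ /(_ s)] := mean_local hsigma hf s m0 mX eq0.
rewrite ms lexx => /(_ isT v)[+ _]; rewrite Xv subrr rdot0r mulr0 addr0 v1 mulr1.
move/le_trans; apply; rewrite mulrDl mul1r -/q lerD2l mulrAC ler_pdivrMr//.
by rewrite ler_pM2l// lerDl.
Qed.

(** Evaluate 1 sigma X, for X = diag(s, t), at the vector (sqrt l, sqrt (1 - l)). *)
Lemma mean_concave_eps H (u v : H) (s t l eps : R) :
  rdot u u = 1 -> rdot v v = 1 -> hdot u v = 0 ->
  0 < s -> 0 < t -> s != t -> 0 <= l <= 1 -> 0 < eps ->
  l * f s + (1 - l) * f t <= f (l * s + (1 - l) * t + eps).
Proof.
move=> u1 v1 uv s0 t0 st /andP[l0 l1] eps0.
have uvR : rdot u v = 0 by rewrite /rdot uv.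
have uu : hdot u u = 1 by rewrite hdotE rdot_ix u1.
have [E [hE EE Eu]] := rank_one_projection u1.
pose X : bop H H := t%:C *: id_bop H + (s - t)%:C *: E.
have hX : herm X by apply/hermD; apply/hermZ => //; exact: herm1.
have XE x : X x = t%:C *: x + (s - t)%:C *: E x by [].
pose m := Num.min s t; have m0 : 0 < m by rewrite lt_min s0.
have E_le x : 0 <= rdot (E x) x <= rdot x x.
  by have [-> ->] := projection_pythagoras hE EE x; rewrite rdot_ge0 lerDl rdot_ge0.
have mX : (m%:C *: id_bop H <= X)%OP.
  apply/op_geC; split=> // x; rewrite XE !rdotE.
  have /andP[q0 q1] := E_le x; rewrite /m minEle; case: ifP => lt_st; first nra.
  by move/negbT: lt_st; rewrite -ltNge => lt_st; nra.
have Xu : X u = s%:C *: u by rewrite XE Eu uu scale1r -scalerDl -rmorphD addrC subrK.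
have Xv : X v = t%:C *: v.
  by rewrite XE Eu [hdot v u]hdotC uv conjc0 scale0r scaler0 addr0.
clearbody X.
pose F := sigma (id_bop H) X.
have [hF _] := mean_ge0 hsigma ltr01 (@id_geC R H) m0 mX.
have FX := mean_comm hsigma m0 mX.
pose a := Num.sqrt l; pose b := Num.sqrt (1 - l).
have aa : a * a = l by rewrite -expr2 sqr_sqrtr.
have bb : b * b = 1 - l by rewrite -expr2 sqr_sqrtr// subr_ge0.
(* X commutes with F, so that F u and v are orthogonal: they belong to different
   eigenvalues of X. *)
have cross : (s - t) * rdot (F u) v = 0.
  have := congr1 (fun z => rdot z v) (FX u).
  by rewrite /= Xu bopZ rdotZl hX Xv rdotZr -/F; lra.
pose w := a%:C *: u + b%:C *: v.
have w1 : rdot w w = 1.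
  by rewrite /w !rdotE u1 v1 (rdotC v) uvR !mulr0 !mulr1 aa bb; lra.
have := mean_jensen m0 mX w1 eps0; rewrite -/F.
have -> : rdot (X w) w = l * s + (1 - l) * t.
  rewrite /w !bopE Xu Xv !rdotE u1 v1 (rdotC v) uvR.
  by rewrite -bb -aa; ring.
have Fu : f s <= rdot (F u) u by apply: mean_eigen m0 mX u1 _ Xu; rewrite ge_min lexx.
have Fv : f t <= rdot (F v) v by apply: mean_eigen m0 mX v1 _ Xv; rewrite ge_min lexx orbT.
move/(le_trans _); apply.
have c0 : rdot (F u) v = 0.
  by apply/eqP; move/eqP: cross; rewrite mulf_eq0 subr_eq0 (negbTE st).
have -> : rdot (F w) w = l * rdot (F u) u + (1 - l) * rdot (F v) v.
  rewrite /w !bopE !rdotE c0 (hF v u) (rdotC v) c0 -bb -aa; ring.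
by rewrite lerD// ler_wpM2l// subr_ge0.
Qed.

End Jensen.

(** * A two-dimensional Hilbert space *)

Section ComplexPlane.
Context {R : realType}.

(** C^2 carries the two eigenvalues of the Jensen argument. It is a type of its
    own because the product type is normed by the maximum. *)
Definition complex_plane : Type := (R[i]^o * R[i]^o)%type.

HB.instance Definition _ := Vector.copy complex_plane (R[i]^o * R[i]^o)%type.

Definition plane_dot (x y : complex_plane) : R[i] :=
  x.1 * Num.conj y.1 + x.2 * Num.conj y.2.

Fact plane_dot_bilinear :
  bilinear_for ( *%R ) (Num.conj \; *%R) plane_dot.
Proof.
split=> [y a x x'|x a y y']; rewrite /plane_dot /=.
  by rewrite !mulrDl !mulrDr !mulrA addrACA.
rewrite !rmorphD !rmorphM /= !mulrDr addrACA; congr (_ + _ + _).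
  by rewrite mulrCA.
by rewrite mulrCA.
Qed.

HB.instance Definition _ := bilinear_isBilinear.Build R[i] complex_plane complex_plane
  R[i] ( *%R ) (Num.conj \; *%R) plane_dot plane_dot_bilinear.

Fact plane_dot_herm x y : plane_dot x y = (-1) ^+ false * Num.conj (plane_dot y x).
Proof.
rewrite expr0 mul1r /plane_dot rmorphD !rmorphM /= !conjCK.
by rewrite mulrC (mulrC x.2).
Qed.

HB.instance Definition _ := isHermitianSesquilinear.Build R[i] complex_plane false
  Num.conj plane_dot plane_dot_herm.

Fact plane_dotE x : plane_dot x x = `|x.1| ^+ 2 + `|x.2| ^+ 2.
Proof. by rewrite /plane_dot -!normCK. Qed.

Fact plane_dot_gt0 x : x != 0 -> 0 < plane_dot x x.
Proof.
move=> x0; rewrite plane_dotE lt0r addr_ge0 ?exprn_ge0// andbT.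
apply: contra x0; rewrite paddr_eq0 ?exprn_ge0// !expf_eq0 /= !normr_eq0.
by case: x => a b /= /andP[/eqP -> /eqP ->].
Qed.

HB.instance Definition _ := isDotProduct.Build R[i] complex_plane plane_dot plane_dot_gt0.

Definition plane_norm (x : complex_plane) : R[i] := sqrtC (plane_dot x x).

Fact plane_norm0 x : plane_norm x = 0 -> x = 0.
Proof.
move/eqP; rewrite sqrtC_eq0 => h; apply/eqP; apply: contraLR h => x0.
by rewrite gt_eqF// plane_dot_gt0.
Qed.

Fact plane_normZ (a : R[i]) x : plane_norm (a *: x) = `|a| * plane_norm x.
Proof.
have d0 y : 0 <= plane_dot y y by rewrite plane_dotE addr_ge0 ?exprn_ge0.
apply: (@pexpIrn _ 2) => //; rewrite ?nnegrE ?mulr_ge0 ?sqrtC_ge0//.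
by rewrite exprMn !sqrtCK !plane_dotE /= !normrM !exprMn mulrDr.
Qed.

Fact plane_normD x y : plane_norm (x + y) <= plane_norm x + plane_norm y.
Proof. by case: (triangle_lerif plane_dot x y). Qed.

HB.instance Definition _ := Lmodule_isNormed.Build R[i] complex_plane
  plane_normD plane_normZ plane_norm0.

Fact plane_coord1 (x : complex_plane) : `|x.1| <= `|x|.
Proof.
rewrite -(@ler_pXn2r _ 2) ?nnegrE// [`|x|]/(plane_norm x) sqrtCK plane_dotE.
by rewrite lerDl exprn_ge0.
Qed.

Fact plane_coord2 (x : complex_plane) : `|x.2| <= `|x|.
Proof.
rewrite -(@ler_pXn2r _ 2) ?nnegrE// [`|x|]/(plane_norm x) sqrtCK plane_dotE.
by rewrite lerDr exprn_ge0.
Qed.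

Fact plane_norm_le (x : complex_plane) : `|x| <= `|x.1| + `|x.2|.
Proof.
rewrite -(@ler_pXn2r _ 2) ?nnegrE ?addr_ge0// [`|x|]/(plane_norm x) sqrtCK plane_dotE.
by rewrite sqrrD addrAC lerDl mulrn_wge0// mulr_ge0.
Qed.

Fact cReB (z w : R[i]) : complex.Re (z - w) = complex.Re z - complex.Re w.
Proof. by case: z; case: w. Qed.

Fact cImB (z w : R[i]) : complex.Im (z - w) = complex.Im z - complex.Im w.
Proof. by case: z; case: w. Qed.

Fact norm_le_ReIm (z : R[i]) : `|z| <= (`|complex.Re z| + `|complex.Im z|)%:C.
Proof.
rewrite normc_def lecR -(@ler_pXn2r _ 2) ?nnegrE ?addr_ge0 ?sqrtr_ge0//.
rewrite sqr_sqrtr ?addr_ge0 ?sqr_ge0// sqrrD !real_normK ?num_real//.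
by rewrite addrAC lerDl mulrn_wge0// mulr_ge0.
Qed.

Fact normc_ge_Im (z : R[i]) : `|complex.Im z|%:C <= `|z|.
Proof.
by rewrite normc_def lecR -sqrtr_sqr ler_sqrt ?lerDr ?sqr_ge0// addr_ge0 ?sqr_ge0.
Qed.

Fact plane_complete (F : set_system complex_plane) : ProperFilter F -> cauchy F -> cvg F.
Proof.
move=> FF /cauchyP cF.
have coord (p : complex_plane -> R) : (forall x y, p (x - y) = p x - p y) ->
    (forall x, `|p x|%:C <= `|x|) -> exists l : R, p @ F --> l.
  move=> pB ple; apply/cvg_ex; apply: R_complete.
  apply/cauchyP => e e0; have e0C : (0 : R[i]) < e%:C by rewrite ltcR.
  have [x hx] := cF _ e0C; exists (p x).
  suff : F [set y | ball (p x) e (p y)] by [].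
  apply: filterS hx => y; rewrite -!ball_normE /= => h.
  by rewrite -pB -ltcR; apply: le_lt_trans (ple _) h.
have [l1 h1] := coord (fun x => complex.Re x.1) (fun x y => cReB x.1 y.1)
  (fun x => le_trans (normc_ge_Re x.1) (plane_coord1 x)).
have [l2 h2] := coord (fun x => complex.Im x.1) (fun x y => cImB x.1 y.1)
  (fun x => le_trans (normc_ge_Im x.1) (plane_coord1 x)).
have [l3 h3] := coord (fun x => complex.Re x.2) (fun x y => cReB x.2 y.2)
  (fun x => le_trans (normc_ge_Re x.2) (plane_coord2 x)).
have [l4 h4] := coord (fun x => complex.Im x.2) (fun x y => cImB x.2 y.2)
  (fun x => le_trans (normc_ge_Im x.2) (plane_coord2 x)).
pose l : complex_plane := (l1 +i* l2, l3 +i* l4).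
apply/cvg_ex; exists l; apply/cvgrPdist_lt => _ /gt0C[e e0 ->].
have e4 : 0 < e / 4 by lra.
move/cvgrPdist_lt: h1 => /(_ _ e4) h1.
move/cvgrPdist_lt: h2 => /(_ _ e4) h2.
move/cvgrPdist_lt: h3 => /(_ _ e4) h3.
move/cvgrPdist_lt: h4 => /(_ _ e4) h4.
near=> x.
have k1 : `|l1 - complex.Re x.1| < e / 4 by near: x.
have k2 : `|l2 - complex.Im x.1| < e / 4 by near: x.
have k3 : `|l3 - complex.Re x.2| < e / 4 by near: x.
have k4 : `|l4 - complex.Im x.2| < e / 4 by near: x.
apply: le_lt_trans (plane_norm_le _) _.
apply: le_lt_trans (lerD (norm_le_ReIm _) (norm_le_ReIm _)) _.
rewrite -rmorphD ltcR /= !cReB !cImB /=; lra.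
Unshelve. all: by end_near. Qed.

HB.instance Definition _ := Uniform_isComplete.Build complex_plane plane_complete.

End ComplexPlane.

Section ComplexPlaneHilbert.
Context {R : realType}.

Fact plane_dot_norm (x : @complex_plane R) : plane_dot x x = `|x| ^+ 2.
Proof. by rewrite [`|x|]/(plane_norm x) sqrtCK. Qed.

Definition plane_hilbert : hilbertSpace R :=
  @HilbertSpace R (@complex_plane R) (@plane_dot R) plane_dot_norm.

Lemma plane_orthonormal : exists u v : plane_hilbert,
  [/\ rdot u u = 1, rdot v v = 1 & hdot u v = 0].
Proof.
have d1 : plane_dot ((1, 0) : @complex_plane R) (1, 0) = 1.
  by rewrite /plane_dot /= conjC1 conjC0 mulr1 mulr0 addr0.
have d2 : plane_dot ((0, 1) : @complex_plane R) (0, 1) = 1.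
  by rewrite /plane_dot /= conjC1 conjC0 mulr1 mulr0 add0r.
have d3 : plane_dot ((1, 0) : @complex_plane R) (0, 1) = 0.
  by rewrite /plane_dot /= conjC1 conjC0 mulr0 mul0r addr0.
exists ((1, 0) : complex_plane), ((0, 1) : complex_plane).
by split; rewrite /rdot ?[hdot _ _]d1 ?[hdot _ _]d2 ?[hdot _ _]d3.
Qed.

End ComplexPlaneHilbert.

(** * Properties of the representing function *)

Section RepresentingFunction.
Context {R : realType}.
Context (sigma : forall H : hilbertSpace R, bop H H -> bop H H -> bop H H).
Context (hsigma : operator_mean sigma).
Context (f : R -> R) (hf : representing_function sigma f).

Lemma representing_at1 : f 1 = 1.
Proof.
have [u [_ [u1 _ _]]] := @plane_orthonormal R.
have := hf plane_hilbert ltr01; rewrite scale1r (mean_id hsigma).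
move=> /(congr1 (fun T : bop _ _ => rdot (T u) u)).
by rewrite scaleoE idoE rdotZl u1 mulr1.
Qed.

Lemma representing_gt0 t : 0 < t -> 0 < f t.
Proof.
move=> t0; have [u [_ [u1 _ _]]] := @plane_orthonormal R.
have := mean_strictly_positive hsigma (strictly_positiveI ltr01 (@id_geC R plane_hilbert))
  (strictly_positiveI t0 (@scale_geC R plane_hilbert t)).
rewrite hf// => -[/positive_opP[_ /(_ u)]].
rewrite scaleoE idoE rdotZl u1 mulr1 lt0r => -> [B [hB _]].
rewrite andbT; apply/eqP => f0.
have : rdot (((f t)%:C *: id_bop plane_hilbert ** B)%OP u) u = 1.
  by rewrite hB idoE u1.
rewrite compoE scaleoE f0 rdotZl mul0r => /esym/eqP.
by rewrite oner_eq0.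
Qed.

Lemma representing_mono s t : 0 < s -> s <= t -> f s <= f t.
Proof.
move=> s0 st; have t0 := lt_le_trans s0 st.
have [u [_ [u1 _ _]]] := @plane_orthonormal R.
have sp (r : R) : 0 < r -> strictly_positive (r%:C *: id_bop (@plane_hilbert R)).
  by move=> r0; exact: strictly_positiveI r0 (@scale_geC _ _ _).
have sp1 := strictly_positiveI ltr01 (@id_geC R plane_hilbert).
have le_st : (s%:C *: id_bop (@plane_hilbert R) <= t%:C *: id_bop plane_hilbert)%OP.
  apply/op_geC; split; first exact/hermZ/herm1.
  by move=> x; rewrite scaleoE idoE rdotZl ler_wpM2r ?rdot_ge0.
have := mean_monotone hsigma sp1 sp1 (sp s s0) (sp t t0) (op_le_refl _) le_st.
rewrite !hf// => /op_leP[_ /(_ u)].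
by rewrite !scaleoE !idoE !rdotZl u1 !mulr1.
Qed.

Context (fcont : {in `]0, +oo[, continuous f}).

(** mean_concave_eps on the plane, with eps tending to 0. *)
Lemma representing_concave s t l : 0 < s -> 0 < t -> 0 <= l <= 1 ->
  l * f s + (1 - l) * f t <= f (l * s + (1 - l) * t).
Proof.
move=> s0 t0 l01; have [<-|st] := eqVneq s t.
  by rewrite -!mulrDl addrC subrK !mul1r.
have [u [v [u1 v1 uv]]] := @plane_orthonormal R.
set r := l * s + (1 - l) * t.
have r0 : 0 < r.
  rewrite /r; case/andP: l01 => l0 l1; have [->|ln0] := eqVneq l 0.
    by lra.
  have lp : 0 < l by rewrite lt0r ln0.
  by rewrite ltr_pwDl ?mulr_gt0// mulr_ge0 ?subr_ge0// ltW.
apply/ler_addgt0Pr => e e0.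
have rin : r \in `]0, +oo[ by rewrite in_itv /= r0.
have /cvgrPdist_lt/(_ e e0) := fcont rin.
move=> /nbhs_ballP[d /= d0 hd].
have d2 : 0 < d / 2 by lra.
have := mean_concave_eps hsigma hf u1 v1 uv s0 t0 st l01 d2; rewrite -/r.
move/le_trans; apply.
have := hd (r + d / 2); rewrite /ball /= opprD addNKr normrN gtr0_norm// => h.
have : `|f r - f (r + d / 2)| < e by apply: h; lra.
by rewrite ltr_norml => /andP[h1 _]; lra.
Qed.

End RepresentingFunction.

(** * Chords of a concave submultiplicative function *)

Section ConcaveFunction.
Context {R : realType} (f : R -> R).
Context (fpos : forall t : R, 0 < t -> 0 < f t).
Context (fmono : forall s t : R, 0 < s -> s <= t -> f s <= f t).
Context (fconc : forall s t l : R, 0 < s -> 0 < t -> 0 <= l <= 1 ->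
  l * f s + (1 - l) * f t <= f (l * s + (1 - l) * t)).
Context (fcont : {in `]0, +oo[, continuous f}).

Lemma concave_three x y z : 0 < x -> x <= y -> y <= z ->
  (z - y) * f x + (y - x) * f z <= (z - x) * f y.
Proof.
move=> x0 xy yz; have [xz|xz] := eqVneq x z.
  have -> : y = x by apply/le_anti; rewrite xy {1}xz yz.
  by rewrite -xz; lra.
have d0 : 0 < z - x by rewrite subr_gt0 lt_neqAle xz (le_trans xy yz).
have l01 : 0 <= (z - y) / (z - x) <= 1.
  by rewrite divr_ge0 ?subr_ge0 ?(le_trans xy yz)// ler_pdivrMr// mul1r lerB.
have := fconc x0 (lt_le_trans x0 (le_trans xy yz)) l01.
have -> : (z - y) / (z - x) * x + (1 - (z - y) / (z - x)) * z = y.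
  by field; rewrite gt_eqF.
have -> : (z - y) / (z - x) * f x + (1 - (z - y) / (z - x)) * f z =
  ((z - y) * f x + (y - x) * f z) / (z - x) by field; rewrite gt_eqF.
by rewrite ler_pdivrMr// [f y * _]mulrC.
Qed.

Let fcvg (m t : R) : 0 < m -> m <= t -> {for t, continuous f}.
Proof. by move=> m0 mt; apply: fcont; rewrite in_itv /= (lt_le_trans m0). Qed.

(** The minimiser c of f + K (t - t1)^2 is interior for K large; there a
    parabola touches f from below, and for a concave function this forces
    differentiability, the slope being that of the parabola. *)
Lemma concave_derivable_between m M : 0 < m -> m < M ->
  exists2 c, c \in `]m, M[ & derivable f c 1 /\
    forall t, m <= t <= M -> f t <= f c + derive1 f c * (t - c).
Proof.
move=> m0 mM; pose t1 := (m + M) / 2; pose d := (M - m) / 2.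
have d0 : 0 < d by rewrite /d; lra.
pose K := (f M - f m + 1) / d ^+ 2.
have fmM := fmono m0 (ltW mM).
have K0 : 0 < K by rewrite divr_gt0 ?exprn_gt0//; lra.
have Kd : K * d ^+ 2 = f M - f m + 1 by rewrite divfK// gt_eqF// exprn_gt0.
pose h t := f t + K * (t - t1) ^+ 2.
have hcont : {within `[m, M], continuous h}.
  apply: continuous_in_subspaceT => x; rewrite inE /= in_itv /= => /andP[mx _].
  apply: cvgD; first exact: fcvg mx.
  apply: cvgM; first exact: cvg_cst.
  under eq_fun do rewrite expr2.
  by rewrite expr2; apply: cvgM; apply: cvgB => //; exact: cvg_cst.
have [c cmM hc] := EVT_min (ltW mM) hcont.
have t1in : t1 \in `[m, M] by rewrite in_itv /= /t1; lra.
have ht1 : h t1 <= f M.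
  rewrite /h subrr expr0n mulr0 addr0; apply: fmono; rewrite /t1; lra.
have hm : f M < h m.
  rewrite /h; have -> : (m - t1) ^+ 2 = d ^+ 2 by rewrite /t1 /d; field.
  by rewrite Kd; lra.
have hM : f M < h M.
  rewrite /h; have -> : (M - t1) ^+ 2 = d ^+ 2 by rewrite /t1 /d; field.
  by rewrite Kd; lra.
have hct1 := hc _ t1in.
have [mc cM] : m < c /\ c < M.
  move: cmM; rewrite in_itv /= => /andP[mc cM]; split; rewrite lt_neqAle.
    by rewrite mc andbT; apply/eqP => e; move: hct1 hm; rewrite e; lra.
  by rewrite cM andbT; apply/eqP => e; move: hct1; rewrite e; lra.
pose s := - (2 * K * (c - t1)).
have below t : m <= t <= M -> f c + s * (t - c) - K * (t - c) ^+ 2 <= f t.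
  move=> tmM; have := hc t; rewrite in_itv /= => /(_ tmM).
  by rewrite /h /s; lra.
have above t : m <= t <= M -> f t <= f c + s * (t - c).
  move=> /andP[mt tM]; have [ct|tc|<-] := ltgtP c t; last by rewrite subrr mulr0 addr0.
  - apply/ler_addgt0Pr => e e0.
    have tc0 : 0 < K * (t - c) by rewrite mulr_gt0// subr_gt0.
    pose r := Num.min (c - m) (e / (K * (t - c))).
    have r0 : 0 < r by rewrite lt_min subr_gt0 mc divr_gt0.
    have r1 : r <= c - m by rewrite ge_min lexx.
    have r2 : r * (K * (t - c)) <= e by rewrite -ler_pdivlMr// ge_min lexx orbT.
    have b : f c + s * (- r) - K * r ^+ 2 <= f (c - r).
      by have := below (c - r); rewrite (_ : c - r - c = - r) ?sqrrN; [apply; lra | ring].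
    have h3 : (t - c) * f (c - r) + r * f t <= (t - c + r) * f c.
      have := @concave_three (c - r) c t.
      have -> : c - (c - r) = r by ring.
      have -> : t - (c - r) = t - c + r by ring.
      by apply; lra.
    have T0 : 0 <= t - c by rewrite subr_ge0 ltW.
    have h4 := ler_wpM2l T0 b; have h5 := ler_wpM2l (ltW r0) r2.
    by rewrite -(ler_pM2l r0); lra.
  - apply/ler_addgt0Pr => e e0.
    have tc0 : 0 < K * (c - t) by rewrite mulr_gt0// subr_gt0.
    pose r := Num.min (M - c) (e / (K * (c - t))).
    have r0 : 0 < r by rewrite lt_min subr_gt0 cM divr_gt0.
    have r1 : r <= M - c by rewrite ge_min lexx.
    have r2 : r * (K * (c - t)) <= e by rewrite -ler_pdivlMr// ge_min lexx orbT.
    have b : f c + s * r - K * r ^+ 2 <= f (c + r).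
      by have := below (c + r); rewrite (_ : c + r - c = r); [apply; lra | ring].
    have h3 : r * f t + (c - t) * f (c + r) <= (c - t + r) * f c.
      have := @concave_three t c (c + r).
      have -> : c + r - c = r by ring.
      have -> : c + r - t = c - t + r by ring.
      by apply; lra.
    have T0 : 0 <= c - t by rewrite subr_ge0 ltW.
    have h4 := ler_wpM2l T0 b; have h5 := ler_wpM2l (ltW r0) r2.
    by rewrite -(ler_pM2l r0); lra.
have quad t : m <= t <= M -> `|f t - f c - s * (t - c)| <= K * (t - c) ^+ 2.
  move=> tmM; have := below t tmM; have := above t tmM => h1 h2.
  by rewrite ler_norml; apply/andP; split; lra.
have lim : (fun r => r^-1 *: (f (r + c) - f c)) @ 0^' --> s.
  apply/cvgrPdist_le => e e0; rewrite near_withinE.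
  pose r := Num.min (Num.min (c - m) (M - c)) (e / K).
  have r0 : 0 < r by rewrite !lt_min !subr_gt0 mc cM divr_gt0.
  apply/nbhs_ballP; exists r => //= x; rewrite /ball /= sub0r normrN => xr x0.
  move: xr; rewrite !lt_min => /andP[/andP[x1 x2] x3].
  have := quad (x + c); rewrite addrK => q.
  have {}q : `|f (x + c) - f c - s * x| <= K * x ^+ 2.
    by apply: q; move: x1 x2; rewrite !ltr_norml; lra.
  have -> : s - x^-1 *: (f (x + c) - f c) = - (x^-1 * (f (x + c) - f c - s * x)).
    by rewrite /GRing.scale /=; field.
  have ax : 0 < `|x| by rewrite normr_gt0.
  rewrite normrN normrM normfV mulrC ler_pdivrMr//; apply: le_trans q _.
  rewrite -(real_normK (num_real x)) expr2 mulrA ler_pM2r// -ler_pdivlMl//.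
  by rewrite mulrC ltW.
exists c; first by rewrite in_itv /= mc cM.
have -> : derive1 f c = s by exact: cvg_lim lim.
split=> //; rewrite /derivable.
have -> : (fun r => r^-1 *: ((f \o shift c) (r *: (1 : R)) - f c)) =
    (fun r => r^-1 *: (f (r + c) - f c)).
  by apply/funext => r /=; rewrite [_ *: 1]mulr1.
exact: cvgP lim.
Qed.

Context (f1 : f 1 = 1).
Context (fsub : forall x y : R, 0 < x -> 0 < y -> f (x * y) <= f x * f y).
Context (fnc : nonconstant_on_pos f).

(** If f were constant beyond m then f (x y) <= f x f y with x large would give
    1 <= f y for all y, hence f = 1 on ]0, 1] and, by concavity, everywhere. *)
Lemma concave_submul_lt m M : 0 < m -> m < M -> f m < f M.
Proof.
move=> m0 mM; rewrite lt_neqAle fmono ?ltW// andbT; apply/eqP => fmM.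
have fK t : m <= t -> f t = f m.
  move=> mt; apply/le_anti; rewrite (fmono m0 mt) andbT.
  have [tM|Mt] := leP t M; first by rewrite fmM fmono// (lt_le_trans m0).
  have := concave_three m0 (ltW mM) (ltW Mt); rewrite -fmM => h.
  have Mm : 0 < M - m by rewrite subr_gt0.
  by rewrite -(ler_pM2l Mm); lra.
have ge1 y : 0 < y -> 1 <= f y.
  move=> y0; pose x := Num.max m (m / y).
  have x0 : 0 < x by rewrite lt_max m0.
  have mx : m <= x by rewrite le_max lexx.
  have mxy : m <= x * y by rewrite -ler_pdivrMr// le_max lexx orbT.
  by have := fsub x0 y0; rewrite (fK _ mx) (fK _ mxy) -[leLHS]mulr1 ler_pM2l ?fpos.
have le1 y : 0 < y -> y <= 1 -> f y = 1.
  by move=> y0 y1; apply/le_anti; rewrite ge1// andbT -[leRHS]f1 fmono.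
have one y : 0 < y -> f y = 1.
  move=> y0; have [y1|y1] := leP y 1; first exact: le1.
  apply/le_anti; rewrite ge1// andbT.
  have h0 : (0 : R) < 2^-1 by rewrite invr_gt0.
  have h1 : (2^-1 : R) <= 1 by lra.
  have := concave_three h0 h1 (ltW y1); rewrite f1 (le1 _ h0 h1); lra.
by have [x [y [x0 y0 []]]] := fnc; rewrite !one.
Qed.

Section Chord.
Context (m M : R).
Context (m0 : 0 < m) (mM : m < M).
Let mu := (f M - f m) / (M - m).
Let nu := (M * f m - m * f M) / (M - m).

Let Mm : 0 < M - m. Proof. by rewrite subr_gt0. Qed.

Let line_m : mu * m + nu = f m.
Proof. by rewrite /mu /nu; field; rewrite gt_eqF. Qed.

Let line_M : mu * M + nu = f M.
Proof. by rewrite /mu /nu; field; rewrite gt_eqF. Qed.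

Let mu_gt0 : 0 < mu.
Proof. by rewrite divr_gt0// subr_gt0 concave_submul_lt. Qed.

Lemma chord_le t : m <= t <= M -> mu * t + nu <= f t.
Proof.
move=> /andP[mt tM]; rewrite -(ler_pM2l Mm).
apply: le_trans (concave_three m0 mt tM); rewrite le_eqVlt; apply/orP; left.
by apply/eqP; rewrite /mu /nu; field; rewrite gt_eqF.
Qed.

Let line_gt0 t : m <= t -> 0 < mu * t + nu.
Proof.
move=> mt; apply: lt_le_trans (fpos m0) _; rewrite -line_m lerD2r.
by rewrite ler_wpM2l// ltW.
Qed.

(** A maximiser t0 of f minus its chord; at an endpoint the difference is 0, and
    then f is its chord and every interior point is a maximiser. *)
Lemma chord_gap : exists2 t0, t0 \in `]m, M[ &
  forall t, m <= t <= M -> f t <= mu * t + nu + (f t0 - (mu * t0 + nu)).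
Proof.
have cont : {within `[m, M], continuous (fun t => f t - (mu * t + nu))}.
  apply: continuous_in_subspaceT => x; rewrite inE /= in_itv /= => /andP[mx _].
  apply: cvgB; first exact: fcvg mx.
  by apply: cvgD; [apply: cvgM => //; exact: cvg_cst | exact: cvg_cst].
have [t0 t0in ht0] := EVT_max (ltW mM) cont.
have mid : (m + M) / 2 \in `]m, M[ by rewrite in_itv /=; move: mM; lra.
have gap t1 : f t1 - (mu * t1 + nu) >= f t0 - (mu * t0 + nu) ->
    forall t, m <= t <= M -> f t <= mu * t + nu + (f t1 - (mu * t1 + nu)).
  by move=> h t tmM; have := ht0 t; rewrite in_itv /= => /(_ tmM); lra.
have chmid : mu * ((m + M) / 2) + nu <= f ((m + M) / 2) by apply: chord_le; move: mM; lra.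
move: t0in; rewrite in_itv /= => /andP[mt0 t0M].
have [e|nm] := eqVneq t0 m.
  by exists ((m + M) / 2) => //; apply: gap; rewrite e line_m; lra.
have [e|nM] := eqVneq t0 M.
  by exists ((m + M) / 2) => //; apply: gap; rewrite e line_M; lra.
exists t0; last exact: gap.
by rewrite in_itv /= !lt_neqAle eq_sym nm nM mt0.
Qed.

(** Let c0 be a maximiser of f / (mu t + nu) and k the maximum. For c < c0 the
    tangent at c passes above (c0, k (mu c0 + nu)), and at c it is at most
    k (mu c + nu): its slope f' c is at least k mu. The ratio is 1 at both
    endpoints, so that c0 > m can be chosen. *)
Lemma chord_ratio : exists2 c, c \in `]m, M[ & derivable f c 1 /\
  forall t, m <= t <= M -> f t <= derive1 f c / mu * (mu * t + nu).
Proof.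
have cont : {within `[m, M], continuous (fun t => f t / (mu * t + nu))}.
  apply: continuous_in_subspaceT => x; rewrite inE /= in_itv /= => /andP[mx _].
  apply: cvgM; first exact: fcvg mx.
  apply: cvgV; first by rewrite gt_eqF// line_gt0.
  by apply: cvgD; [apply: cvgM => //; exact: cvg_cst | exact: cvg_cst].
have [c1 c1in hc1] := EVT_max (ltW mM) cont.
have [c0 [mc0 c0M] hc0] : exists2 c0, m < c0 /\ c0 <= M &
    forall t, m <= t <= M -> f t / (mu * t + nu) <= f c0 / (mu * c0 + nu).
  have hc1' t : m <= t <= M -> f t / (mu * t + nu) <= f c1 / (mu * c1 + nu).
    by move=> h; apply: hc1; rewrite in_itv.
  move: c1in; rewrite in_itv /= => /andP[mc1 c1M].
  have [e|nm] := eqVneq c1 m.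
    exists M => // t tmM; apply: le_trans (hc1' t tmM) _.
    by rewrite e line_m line_M !divff ?gt_eqF ?fpos// (lt_trans m0).
  by exists c1 => //; rewrite lt_neqAle eq_sym nm mc1.
have [c cin [dc hc]] := concave_derivable_between m0 mc0.
move: cin; rewrite in_itv /= => /andP[mc cc0].
exists c; first by rewrite in_itv /= mc (lt_le_trans cc0).
split=> // t tmM; set k := f c0 / (mu * c0 + nu) in hc0.
have lin x : m <= x <= M -> f x <= k * (mu * x + nu).
  move=> xmM; rewrite -ler_pdivrMr ?hc0//; apply: line_gt0.
  by case/andP: xmM.
have kc0 : f c0 = k * (mu * c0 + nu) by rewrite divfK// gt_eqF// line_gt0// ltW.
have slope : k * mu <= derive1 f c.
  have h1 := hc c0; rewrite lexx (ltW mc0) kc0 in h1; have {}h1 := h1 isT.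
  have h2 : f c <= k * (mu * c + nu) by apply: lin; lra.
  have cc : 0 < c0 - c by rewrite subr_gt0.
  by rewrite -(ler_pM2r cc); lra.
apply: le_trans (lin t tmM) _; rewrite ler_wpM2r//.
  by apply/ltW/line_gt0; case/andP: tmM.
by rewrite ler_pdivlMr.
Qed.

End Chord.

End ConcaveFunction.

(** * The Hadamard product of means *)

Section RatioBounds.
Context {R : realType} (H : hilbertSpace R).

Lemma ratio_le (A C : bop H H) (a b : R) : 0 < a -> 0 < b -> herm A ->
  (A <= a%:C *: id_bop H)%OP -> (b%:C *: id_bop H <= C)%OP -> ((b / a)%:C *: A <= C)%OP.
Proof.
move=> a0 b0 hA /op_leC[_ Aa] /op_geC[hC bC].
apply: op_le_herm => // [|x]; first exact: hermZ.
rewrite scaleoE rdotZl; apply: le_trans (bC x).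
by rewrite mulrAC ler_pdivrMr// -mulrA ler_pM2l// mulrC.
Qed.

Lemma ratio_ge (A C : bop H H) (b c : R) : 0 < b -> 0 < c -> herm C ->
  (b%:C *: id_bop H <= A)%OP -> (C <= c%:C *: id_bop H)%OP -> (C <= (c / b)%:C *: A)%OP.
Proof.
move=> b0 c0 hC /op_geC[hA bA] /op_leC[_ Cc].
apply: op_le_herm => // [|x]; first exact: hermZ.
rewrite scaleoE rdotZl; apply: le_trans (Cc x) _.
by rewrite mulrAC ler_pdivlMr// -mulrA ler_pM2l// mulrC.
Qed.

End RatioBounds.

Theorem theorem4p2 (R : realType) (H : hilbertSpace R)
    (HH : hilbert_tensor H H) (I : Type) (e : I -> H)
    (he : orthonormal_basis e)
    (a1 a2 a3 a4 b1 b2 b3 b4 : R)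
    (hb1 : 0 < b1) (hb2 : 0 < b2) (hb3 : 0 < b3) (hb4 : 0 < b4)
    (hab1 : b1 < a1) (hab2 : b2 < a2) (hab3 : b3 < a3) (hab4 : b4 < a4)
    (sigma : forall K : hilbertSpace R, bop K K -> bop K K -> bop K K)
    (hsigma : operator_mean sigma)
    (f : R -> R) (hf : representing_function sigma f)
    (hfnc : nonconstant_on_pos f) (hfsub : submultiplicative f) :
  let m := a1^-1 * a2^-1 * b3 * b4 in
  let M := a3 * a4 * b1^-1 * b2^-1 in
  let mu := (a1 * a2 * b1 * b2 * (f M - f m)) /
            (a1 * a2 * a3 * a4 - b1 * b2 * b3 * b4) in
  let nu := (a1 * a2 * a3 * a4 * f m - b1 * b2 * b3 * b4 * f M) /
            (a1 * a2 * a3 * a4 - b1 * b2 * b3 * b4) in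
  let g := fun t : R => mu * t + nu - f t in
  exists c t0 : R,
    [/\ c \in `]m, M[, t0 \in `]m, M[, derivable f c 1
      & let omega := (a1 * a2 * b1 * b2 * (f M - f m)) /
            ((a1 * a2 * a3 * a4 - b1 * b2 * b3 * b4) * derive1 f c) in
        forall A B C D : bop H H,
          (b1%:C *: id_bop H <= A)%OP -> (A <= a1%:C *: id_bop H)%OP ->
          (b2%:C *: id_bop H <= B)%OP -> (B <= a2%:C *: id_bop H)%OP ->
          (b3%:C *: id_bop H <= C)%OP -> (C <= a3%:C *: id_bop H)%OP ->
          (b4%:C *: id_bop H <= D)%OP -> (D <= a4%:C *: id_bop H)%OP ->
          (sigma H (hadamard HH e A B) (hadamard HH e C D)
             <= (1 / omega)%:C *:
                  hadamard HH e (sigma H A C) (sigma H B D))%OP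
          /\
          (sigma H (hadamard HH e A B) (hadamard HH e C D)
             - hadamard HH e (sigma H A C) (sigma H B D)
             <= (- g t0)%:C *: hadamard HH e A B)%OP].
Proof.
move=> m M mu nu g.
have [fcont fsub] := hfsub.
have fpos := representing_gt0 hsigma hf; have fmono := representing_mono hsigma hf.
have fconc := @representing_concave R sigma hsigma f hf fcont.
have f1 := representing_at1 hsigma hf.
have [pa1 pa2 pa3 pa4] : [/\ 0 < a1, 0 < a2, 0 < a3 & 0 < a4].
  by split; [exact: lt_trans hab1 | exact: lt_trans hab2 |
             exact: lt_trans hab3 | exact: lt_trans hab4].
have mE : m = (b3 * b4) / (a1 * a2) by rewrite /m; field; rewrite !gt_eqF.
have ME : M = (a3 * a4) / (b1 * b2) by rewrite /M; field; rewrite !gt_eqF.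
have mE' : m = b3 / a1 * (b4 / a2) by rewrite /m; field; rewrite !gt_eqF.
have ME' : M = a3 / b1 * (a4 / b2) by rewrite /M; field; rewrite !gt_eqF.
have m0 : 0 < m by rewrite mE divr_gt0 ?mulr_gt0.
have l1 : b3 / a1 < a3 / b1 by rewrite ltr_pdivrMr// mulrAC ltr_pdivlMr// ltr_pM// ltW.
have l2 : b4 / a2 < a4 / b2 by rewrite ltr_pdivrMr// mulrAC ltr_pdivlMr// ltr_pM// ltW.
have mM : m < M by rewrite mE' ME' ltr_pM// divr_ge0// ltW.
have d0 : 0 < a1 * a2 * a3 * a4 - b1 * b2 * b3 * b4.
  by rewrite subr_gt0 !ltr_pM// ?mulr_ge0 ?ltW.
have Mm : M - m = (a1 * a2 * a3 * a4 - b1 * b2 * b3 * b4) / (a1 * a2 * b1 * b2).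
  by rewrite /m /M; field; rewrite !gt_eqF.
have muE : (f M - f m) / (M - m) = mu.
  by rewrite Mm /mu; field; rewrite !gt_eqF.
have nuE : (M * f m - m * f M) / (M - m) = nu.
  by rewrite Mm /nu mE ME; field; rewrite !gt_eqF.
(* The line mu t + nu is the chord of f between m and M. *)
have chord := chord_le fconc m0 mM.
have [t0 t0in gap] := chord_gap fconc fcont m0 mM.
have [c cin [dc ratio]] := chord_ratio fpos fmono fconc fcont f1 fsub hfnc m0 mM.
rewrite muE nuE in chord gap ratio.
exists c, t0; split=> // omega A B C D bA Aa bB Ba bC Ca bD Da.
have omegaE : 1 / omega = derive1 f c / mu.
  rewrite div1r /omega /mu !invf_div.
  by move: (derive1 f c) ((a1 * a2 * b1 * b2 * (f M - f m))^-1) => u v; ring.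
have [hA hB] := (herm_geC bA, herm_geC bB); have [hC hD] := (herm_geC bC, herm_geC bD).
have [hP1 hP2] := hadamard_bounds HH he hb1 hb2 (ltW pa1) bA Aa bB Ba.
have [hQ1 hQ2] := hadamard_bounds HH he hb3 hb4 (ltW pa3) bC Ca bD Da.
set P := hadamard HH e A B in hP1 hP2 *.
set Q := hadamard HH e C D in hQ1 hQ2 *.
set S := hadamard HH e (sigma H A C) (sigma H B D).
have hP := herm_geC hP1; have hQ := herm_geC hQ1.
have p12 : 0 < b1 * b2 by rewrite mulr_gt0.
have p34 : 0 < b3 * b4 by rewrite mulr_gt0.
have mPQ : (m%:C *: P <= Q)%OP by rewrite mE; apply: ratio_le => //; rewrite mulr_gt0.
have QMP : (Q <= M%:C *: P)%OP by rewrite ME; apply: ratio_ge => //; rewrite mulr_gt0.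
have [hPQ _] := mean_ge0 hsigma p12 hP1 p34 hQ1.
have hS : herm S.
  by apply: hadamard_herm; [exact: (mean_ge0 hsigma hb1 bA hb3 bC).1 |
                            exact: (mean_ge0 hsigma hb2 bB hb4 bD).1].
(* f s f t >= f (s t) >= mu s t + nu when s t lies between m and M. *)
have lower x : mu * rdot (Q x) x + nu * rdot (P x) x <= rdot (S x) x.
  rewrite !hadamard_form.
  apply: (tensor_mean_ge hsigma hf fpos hb1 bA hb3 bC hb2 bB hb4 bD _ l1 _ l2);
    rewrite ?divr_gt0//.
  - exact: ratio_le.
  - exact: ratio_ge.
  - exact: ratio_le.
  - exact: ratio_ge.
  move=> s t /andP[s1 s2] /andP[t1 t2].
  have s0 : 0 < s by apply: lt_le_trans s1; rewrite divr_gt0.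
  have t0' : 0 < t by apply: lt_le_trans t1; rewrite divr_gt0.
  apply: le_trans (fsub _ _ s0 t0'); apply: chord.
  by rewrite mE' ME' !ler_pM// ?divr_ge0 ?ltW.
have upper a b : (forall t, m <= t <= M -> f t <= a * t + b) ->
    forall x, rdot (sigma H P Q x) x <= a * rdot (Q x) x + b * rdot (P x) x.
  move=> ab x; have /op_leP[_ /(_ x)] :=
    mean_le_line hsigma hf p12 hP1 p34 hQ1 m0 mM mPQ QMP ab.
  by rewrite addoE !scaleoE rdotDl !rdotZl.
set k := 1 / omega in omegaE *.
(* At t = m the bound of chord_ratio reads f m <= k f m, whence k > 0. *)
have fm : mu * m + nu = f m by rewrite -muE -nuE; field; rewrite gt_eqF// subr_gt0.
have k0 : 0 < k.
  have := ratio m; rewrite lexx (ltW mM) fm -omegaE => /(_ isT) h.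
  rewrite -(pmulr_lgt0 _ (fpos _ m0)); exact: lt_le_trans (fpos _ m0) h.
split.
  apply: op_le_herm => // [|x]; first exact: hermZ.
  rewrite scaleoE rdotZl; apply: le_trans (ler_wpM2l (ltW k0) (lower x)).
  rewrite mulrDr [k * (mu * _)]mulrA [k * (nu * _)]mulrA; apply: upper => t tmM.
  by move: (ratio t tmM); rewrite -omegaE mulrDr [k * (mu * _)]mulrA.
apply: op_le_herm => // [||x]; [by apply/hermD/hermN | exact: hermZ |].
rewrite !bopE !rdotE.
have := lower x; have := upper mu (nu - g t0) _ x => h1 h2.
have {}h1 : rdot (sigma H P Q x) x <= mu * rdot (Q x) x + (nu - g t0) * rdot (P x) x.
  by apply: h1 => t tmM; have := gap t tmM; rewrite /g; lra.
by move: h1 h2; move: (g t0) => r; lra.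
Qed.
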